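(* Let $T>0$, $\sigma>0$ and $(h,\theta)\in(0,\infty)\times(0,T]$. Let $p$ be the density of the random variable $X_\theta=\sigma W_\theta$ (centred Gaussian with variance $\sigma^2\theta$), and define $\varrho:\mathbb{R}\to\mathbb{R}$ by $\varrho(y)=q(y)-d_o(y)/h$. Then $\varrho$ is symmetric (i.e. $\varrho(-y)=\varrho(y)$), and $$(i)\quad\int_0^h|\varrho(y)|p(y)\,dy\le\frac{26}{10}\frac{h}{\sigma\sqrt\theta}+\frac{h^2}{\sigma^2\theta},\qquad(ii)\quad\int_h^\infty|\varrho(y)|p(y)\,dy\le\frac{29}{10}\frac{h}{\sigma\sqrt\theta}+\frac{h^2}{\sigma^2\theta}.$$
   Context: $(W_t)_{t\ge0}$ is a standard Brownian motion. For $x,y\in\mathbb{R}$ and $l>0$, a Brownian bridge from $x$ to $y$ of length $l$ is a continuous Gaussian process $(B^{x,l,y}_t)_{t\in[0,l]}$ with mean $x+\frac tl(y-x)$ and covariance $\mathrm{Cov}(B_s,B_t)=s(1-\frac tl)$ for $0\le s\le t\le l$. For $r>0$: $\mathbb{Z}^r_e:=\{2kr:k\in\mathbb{Z}\}$ and $\mathbb{Z}^r_o:=\{(2k+1)r:k\in\mathbb{Z}\}$. The function $d_o(x):=\mathrm{dist}(x,\mathbb{Z}^h_o)$. The function $q(y)=q(y,h,\theta)$ is the probability that the Brownian bridge $(B^{y/\sigma,\theta,0}_t)_{t\in[0,\theta]}$ hits $\mathbb{Z}^{h/\sigma}_e$ before hitting $\mathbb{Z}^{h/\sigma}_o$. 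*)

(* Defs.v *)
From HB Require Import structures.
From mathcomp Require Import all_boot all_order all_algebra.
From mathcomp Require Import all_classical all_reals all_analysis.
Import Order.TTheory GRing.Theory Num.Theory.
Import numFieldNormedType.Exports.

Set Implicit Arguments.
Unset Strict Implicit.
Unset Printing Implicit Defensive.

Local Open Scope classical_set_scope.
Local Open Scope ring_scope.

Section processes.
Context d (Omega : measurableType d) (R : realType) (P : probability Omega R).

(* [normal_prob m s] takes the standard deviation [s], and is not the Dirac
   mass at [m] when [s = 0]; degenerate Gaussians are therefore set apart. *)
Definition gaussian_rv (X : Omega -> R) :=
  exists m s : R, 0 <= s /\
    forall A : set R, measurable A ->
      P (X @^-1` A) = if s == 0 then \d_m A else normal_prob m s A.

Definition gaussian_process (I : set R) (X : R -> {RV P >-> R}) :=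
  forall (n : nat) (t a : 'I_n -> R), (forall i, I (t i)) ->
    gaussian_rv (fun w => \sum_(i < n) a i * X (t i) w).

Definition continuous_process (I : set R) (X : R -> {RV P >-> R}) :=
  forall w, {within I, continuous (fun t => X t w)}.

(* Only the variables indexed by [0, l] matter. *)
Definition brownian_bridge (x l y : R) (B : R -> {RV P >-> R}) :=
  [/\ continuous_process `[0, l] B,
      gaussian_process `[0, l] B,
      forall t : R, 0 <= t <= l -> 'E_P[B t]%E = (x + t / l * (y - x))%:E &
      forall s t : R, 0 <= s -> s <= t -> t <= l ->
        covariance P (B s) (B t) = (s * (1 - t / l))%:E].

Definition independent_increments (W : R -> {RV P >-> R}) :=
  forall (n : nat) (t : nat -> R) (A : nat -> set R),
    0 <= t 0%N -> (forall i, (i < n)%N -> t i <= t i.+1) ->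
    (forall i, measurable (A i)) ->
    P (\bigcap_(i < n) [set w | A i (W (t i.+1) w - W (t i) w)]) =
    (\prod_(i < n) P [set w | A i (W (t i.+1) w - W (t i) w)%R])%E.

Definition standard_brownian_motion (W : R -> {RV P >-> R}) :=
  [/\ continuous_process `[0, +oo[ W,
      {ae P, forall w, W 0 w = 0},
      independent_increments W &
      forall s t : R, 0 <= s -> s < t -> forall A : set R, measurable A ->
        P [set w | A (W t w - W s w)] = normal_prob 0 (Num.sqrt (t - s)) A].

Definition is_density (X : Omega -> R) (p : R -> R) :=
  [/\ measurable_fun [set: R] p,
      forall x, 0 <= p x &
      forall A : set R, measurable A ->
        P (X @^-1` A) = (\int[lebesgue_measure]_(x in A) (p x)%:E)%E].

End processes.

Arguments gaussian_rv {d Omega R} P X.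
Arguments gaussian_process {d Omega R} P I X.
Arguments brownian_bridge {d Omega R} P x l y B.
Arguments independent_increments {d Omega R} P W.
Arguments standard_brownian_motion {d Omega R} P W.
Arguments is_density {d Omega R} P X p.

Section lattices.
Context (R : realType).

Definition even_lattice (r : R) : set R :=
  [set x | exists k : int, x = (2 * k)%:~R * r].

Definition odd_lattice (r : R) : set R :=
  [set x | exists k : int, x = (2 * k + 1)%:~R * r].

Definition dist (x : R) (A : set R) : R := inf [set `|x - a| | a in A].

Definition d_o (h x : R) : R := dist x (odd_lattice h).

Definition hits_before (l : R) (f : R -> R) (A C : set R) :=
  exists t : R, [/\ 0 <= t <= l, A (f t) & forall s : R, 0 <= s <= t -> ~ C (f s)].

Definition hit_even_before_odd_prob d (Omega : measurableType d)
    (P : probability Omega R) (l r : R) (B : R -> {RV P >-> R}) : R :=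
  fine (P [set w | hits_before l (fun t => B t w)
                     (even_lattice r) (odd_lattice r)]).

Definition varrho (h : R) (q : R -> R) (y : R) : R := q y - d_o h y / h.

End lattices.

Arguments hit_even_before_odd_prob {R d Omega} P l r B.

(* Main.v *)
Require Import Defs.
From HB Require Import structures.
From mathcomp Require Import all_boot all_order all_algebra.
From mathcomp Require Import all_classical all_reals all_analysis.
From mathcomp Require Import measurable_realfun.
From mathcomp Require Import ring lra zify.
Import Order.TTheory GRing.Theory Num.Theory.
Import numFieldNormedType.Exports.

Set Implicit Arguments.
Unset Strict Implicit.
Unset Printing Implicit Defensive.

Local Open Scope classical_set_scope.
Local Open Scope ring_scope.

(** Put [r = h / sigma], [l = theta] and [x = y / sigma]. On the cell from
    [alpha = k r] to [beta = (k + 1) r] that contains [x], the number [d_o y /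
    h] is the probability that a Brownian motion started at [x] leaves the cell
    through its even end, and [q y] is the same probability for the bridge. So
    [varrho] measures what the drift of the bridge changes, and for [k >= 1]
    this is of the order of [b = beta r / l]: [hit_prob_interior] gives
    [`|varrho h q y| <= 19 / 8 * b].

    For that bound, divide the bridge by [1 - t / l] and read it in the clock [s
    = t / (1 - t / l)]. The result is a Brownian motion started at [x], whose
    walls [alpha c] and [beta c] move with [c = 1 + s / l]. Let [lin] be its
    distance to the moving wall opposite to a chosen one. Then [V = lin / r + s
    / l + K (X - alpha c) (beta c - X)] is a supermartingale until the exit once
    [K] compensates the motion of the walls. It is nonnegative until then, and
    at least 1 at the chosen wall and at time [s = l]. Hence the path leaves
    through the chosen wall with probability at most [V] at time 0, which is the
    harmonic value plus [K (x - alpha) (beta - x) <= K r ^ 2 / 4]. Upper bounds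
    for the two walls together give a bound on both sides.

    The supermartingale is only used along the grid [s = i l / N], with walls
    moved inwards by [eta] so that an exit of the path is seen by every fine
    grid ([first_exit_grid]). The discrete bound [discrete_exit_bound] uses that
    an increment is uncorrelated with the past, through the expectations of its
    product with functions of past positions restricted to a rectangle
    ([rectangle_mean_indep] and its companions), and a fourth moment to discard
    large jumps. Continuity of paths and the lemma of Fatou, first for [N] and
    then for [eta], yield [first_exit_prob_le].

    Independence from vanishing covariance, and uniqueness of the law of a
    Gaussian process given its means and covariances, both come from
    [cos_determines_rectangles]: the integrals of all [cos (\sum_j a_j X_j + c)]
    determine the integrals over rectangles. The hitting event is built from
    countably many coordinates of the path ([hit_path_event]), so it has a
    probability that depends only on the law of the path. As minus the bridge
    from [- x] has the law of the bridge from [x], this gives the symmetry.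

    For the integrals write [a = h / (sigma sqrt theta)]. On the interval from
    [0] to [h] it is enough that [`|varrho| <= 1] and that a Gaussian density is
    bounded. On the half line [y >= h] one has [b <= a z + a ^ 2] with [z = y /
    (sigma sqrt theta)]. Here [z <= (1 + z ^ 2) / 2], and the right side has
    expectation 1 because [z] is a standard normal variable under the law of
    [y]; so the integral is at most [19 / 8 (a + a ^ 2)], which is below the
    claim when [a <= 1 / 3], while for larger [a] the claim exceeds 1. *)

(** * Densities and moments of normal laws *)

Section density.
Local Open Scope ereal_scope.
Context d (T : measurableType d) (R : realType).
Variables (mu nu : {measure set T -> \bar R}) (p : T -> R).
Hypotheses (mp : measurable_fun [set: T] p) (p0 : forall x, (0 <= p x)%R).
Hypothesis nup : forall A, measurable A -> nu A = \int[mu]_(x in A) (p x)%:E.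

Import HBNNSimple.

(** For indicators this is the definition of a density; simple functions and
    monotone convergence do the rest. *)
Lemma ge0_integral_density (f : T -> \bar R) :
  measurable_fun [set: T] f -> (forall x, 0 <= f x) ->
  \int[nu]_x f x = \int[mu]_x (f x * (p x)%:E).
Proof.
move=> mf f0; pose h := nnsfun_approx measurableT mf.
have hf x : (EFin \o h n) x @[n --> \oo] --> f x by exact: cvg_nnsfun_approx.
have hnd x a b : (a <= b)%N -> (h a x <= h b x)%R.
  by move=> ab; exact/lefP/nd_nnsfun_approx.
have mh n : measurable_fun [set: T] (EFin \o h n) by exact/measurable_EFinP.
have mpE : measurable_fun [set: T] (EFin \o p) by exact/measurable_EFinP.
have cvgl : \int[nu]_x (EFin \o h n) x @[n --> \oo] --> \int[nu]_x f x.
  have -> : \int[nu]_x f x = \int[nu]_x lim ((EFin \o h n) x @[n --> \oo]).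
    by apply: eq_integral => x _; apply/esym/cvg_lim => //; exact: hf.
  apply: cvg_monotone_convergence => //.
  - by move=> n x _; rewrite lee_fin.
  - by move=> x _ a b ab; rewrite lee_fin hnd.
have cvgr : \int[mu]_x ((EFin \o h n) x * (p x)%:E) @[n --> \oo] -->
    \int[mu]_x (f x * (p x)%:E).
  have -> : \int[mu]_x (f x * (p x)%:E) =
      \int[mu]_x lim (((EFin \o h n) x * (p x)%:E) @[n --> \oo]).
    apply: eq_integral => x _; apply/esym/cvg_lim => //.
    by apply: cvgeZr => //; exact: hf.
  apply: cvg_monotone_convergence => //.
  - by move=> n; exact: emeasurable_funM.
  - by move=> n x _; rewrite -EFinM lee_fin mulr_ge0.
  - by move=> x _ a b ab; rewrite -!EFinM lee_fin ler_wpM2r// hnd.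
suff hE n : \int[nu]_x (EFin \o h n) x = \int[mu]_x ((EFin \o h n) x * (p x)%:E).
  by move: cvgl; rewrite (funext hE) => cvgl; exact: (cvg_unique _ cvgl cvgr).
have mind r : measurable_fun [set: T] (fun x => (r * \1_(h n @^-1` [set r]) x)%:E).
  by apply/measurable_EFinP/measurable_funM.
transitivity (\int[nu]_x
   (\sum_(y \in range (h n)) (y * \1_(h n @^-1` [set y]) x)%:E)).
  by apply: eq_integral => t _; rewrite /= fimfunE -fsumEFin.
rewrite ge0_integral_fsum//; last by move=> m y _; exact: nnfun_muleindic_ge0.
transitivity (\int[mu]_x (\sum_(y \in range (h n))
    (y * \1_(h n @^-1` [set y]) x)%:E * (p x)%:E)); last first.
  apply: eq_integral => x _.
  rewrite -ge0_mule_fsuml; last by move=> y; exact: nnfun_muleindic_ge0.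
  by rewrite fsumEFin // -(fimfunE _ x).
rewrite ge0_integral_fsum//; last 2 first.
  - by move=> y; exact: emeasurable_funM.
  - by move=> m y _; apply: mule_ge0; [exact: nnfun_muleindic_ge0|rewrite lee_fin].
apply: eq_fsbigr => r; rewrite inE => -[t _ hr].
under eq_integral do rewrite EFinM.
under [RHS]eq_integral do rewrite EFinM -muleA.
have r0 : (0 <= r)%R by rewrite -hr.
rewrite ge0_integralZl_EFin//; last first.
  by apply/measurable_EFinP.
rewrite [RHS]ge0_integralZl_EFin//; last 2 first.
- by move=> x _; rewrite mule_ge0 ?lee_fin.
- by apply: emeasurable_funM => //; exact/measurable_EFinP.
congr (_ * _); rewrite integral_indic// setIT nup//.
rewrite integral_mkcond; apply: eq_integral => x _.
rewrite patchE /= indicE; case: ifPn => _; first by rewrite mul1e.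
by rewrite mul0e.
Qed.

Lemma integrable_density (f : T -> R) : measurable_fun [set: T] f ->
  nu.-integrable setT (EFin \o f) <->
  mu.-integrable setT (fun x => (f x * p x)%:E).
Proof.
move=> mf; have mfp : measurable_fun [set: T] (fun x => (f x * p x)%:E).
  by apply/measurable_EFinP/measurable_funM.
have E : \int[nu]_x `|(f x)%:E| = \int[mu]_x `|(f x * p x)%:E|.
  rewrite ge0_integral_density//; last first.
    by apply: measurableT_comp => //; exact/measurable_EFinP.
  by apply: eq_integral => x _; rewrite EFinM abseM (@gee0_abs _ (p x)%:E)// lee_fin.
split=> /integrableP[_ lty]; apply/integrableP; split => //.
- by rewrite -E.
- exact/measurable_EFinP.
- by rewrite E.
Qed.

Lemma Rintegral_density (f : T -> R) : measurable_fun [set: T] f ->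
  nu.-integrable setT (EFin \o f) ->
  (\int[nu]_x f x = \int[mu]_x (f x * p x))%R.
Proof.
move=> mf nuf; have muf := (integrable_density mf).1 nuf.
rewrite /Rintegral; congr fine; rewrite integralE [RHS]integralE.
have mfE : measurable_fun [set: T] (EFin \o f) by exact/measurable_EFinP.
congr (_ - _).
- rewrite ge0_integral_density//; last exact: measurable_funepos.
  by apply: eq_integral => x _; rewrite !funeposE /= EFinM maxe_pMl ?lee_fin// mul0e.
- rewrite ge0_integral_density//; last exact: measurable_funeneg.
  apply: eq_integral => x _; rewrite !funenegE /=.
  by rewrite maxe_pMl ?lee_fin// mul0e -EFinM mulNr.
Qed.

End density.

Lemma is_derive_continuous (R : realType) (f f' : R -> R) :
  (forall x : R, is_derive x 1 f (f' x)) -> continuous f.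
Proof.
move=> df x; apply: differentiable_continuous.
by apply/derivable1_diffP; exact: ex_derive.
Qed.

Lemma cvg_normal_fun_shift (R : realType) (m s e : R) : s != 0 -> `|e| = 1 ->
  normal_fun m s (m + e * n.+1%:R) @[n --> \oo] --> (0 : R).
Proof.
move=> s0 e1.
have s2 : 0 < s ^+ 2 by rewrite exprn_even_gt0.
apply: (@squeeze_cvgr _ _ _ _ (cst 0) (fun n => 2 * s ^+ 2 * harmonic n)).
- apply: nearW => n; rewrite normal_fun_ge0/= /normal_fun [m + _]addrC addrK exprMn.
  have -> : e ^+ 2 = 1 by rewrite -real_normK ?num_real// e1 expr1n.
  set u := n.+1%:R ^+ 2 / (s ^+ 2 *+ 2).
  have u0 : 0 < u by rewrite divr_gt0 ?exprn_gt0// mulrn_wgt0.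
  rewrite mul1r mulNr -/u expRN; apply: (@le_trans _ _ u^-1).
    by rewrite lef_pV2 ?posrE ?expR_gt0//; have := expR_ge1Dx u; lra.
  rewrite /u invf_div -(mulr_natl (s ^+ 2)); apply: ler_wpM2l.
    by apply: mulr_ge0 => //; exact: ltW.
  by rewrite lef_pV2 ?posrE// -natrX ler_nat expnS leq_pmulr.
- exact: cvg_cst.
- rewrite -[X in _ --> X](mulr0 (2 * s ^+ 2)).
  by apply: cvgM; [exact: cvg_cst|exact: cvg_harmonic].
Qed.

Section normal_moments.
Context {R : realType}.
Variables (m s : R).
Hypothesis s0 : s != 0.
Notation mu := (@lebesgue_measure R).
Notation phi := (normal_pdf m s).

(** Quartic growth is absorbed by doubling the variance.  This single estimate
    gives integrability of every moment needed, and the decay at infinity in the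
    integration by parts. *)
Lemma normal_pdf_quartic_bound : exists2 C, 0 <= C & forall x,
  (1 + (x - m) ^+ 4) * phi x <= C * normal_fun m (s * Num.sqrt 2) x.
Proof.
exists ((1 + 32 * s ^+ 4) * normal_peak s).
  by rewrite mulr_ge0 ?normal_peak_ge0// addr_ge0// mulr_ge0// exprn_even_ge0.
move=> x; rewrite normal_pdfE// mulrCA [leRHS]mulrAC [leRHS]mulrC.
rewrite ler_wpM2l ?normal_peak_ge0//.
rewrite /normal_fun exprMn sqr_sqrtr//.
set u := (x - m) ^+ 2 / (4 * s ^+ 2).
have s2 : s ^+ 2 != 0 by rewrite sqrf_eq0.
have -> : - (x - m) ^+ 2 / (s ^+ 2 *+ 2) = - u + - u.
  by rewrite /u -mulr_natr; field.
have -> : - (x - m) ^+ 2 / (s ^+ 2 * 2 *+ 2) = - u.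
  by rewrite /u -mulr_natr; field.
rewrite expRD mulrA ler_wpM2r ?expR_ge0//.
have -> : (x - m) ^+ 4 = 16 * s ^+ 4 * u ^+ 2 by rewrite /u; field.
have u0 : 0 <= u by rewrite divr_ge0 ?sqr_ge0// mulr_ge0 ?sqr_ge0.
have := expR_ge1Dxn 1 u0; rewrite -[2`!]/2%N => e2.
have e0 := expR_gt0 u; have s4 : 0 <= s ^+ 4 by rewrite exprn_even_ge0.
have u2 : 0 <= u ^+ 2 by rewrite sqr_ge0.
have su : 0 <= s ^+ 4 * (expR u - u ^+ 2 / 2) by rewrite mulr_ge0 ?subr_ge0//; lra.
have e1 : 1 <= expR u by rewrite -expR0 ler_expR.
rewrite expRN ler_pdivrMr//; nra.
Qed.

Lemma integrable_quartic (h : R -> R) C : measurable_fun [set: R] h ->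
  (forall x, `|h x| <= C * (1 + (x - m) ^+ 4)) ->
  mu.-integrable setT (fun x => (h x * phi x)%:E).
Proof.
move=> mh hC; have [D D0 HD] := normal_pdf_quartic_bound.
have C0 : 0 <= C.
  have := hC m; rewrite subrr expr0n/= addr0 mulr1; exact: le_trans.
have s2 : s * Num.sqrt 2 != 0 by rewrite mulf_neq0// gt_eqF// sqrtr_gt0.
have := @integrable_normal_pdf R m (s * Num.sqrt 2) => /(integrableZl measurableT).
move=> /(_ (C * D / normal_peak (s * Num.sqrt 2))); apply: le_integrable => //.
  by apply/measurable_EFinP/measurable_funM => //; exact: measurable_normal_pdf.
move=> x _; rewrite -EFinM lee_fin; apply: le_trans (ler_norm _).
rewrite (normal_pdfE m s2) -!mulrA mulKf ?gt_eqF ?normal_peak_gt0// normrM.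
rewrite (ger0_norm (normal_pdf_ge0 _ _ _)).
apply: le_trans (_ : C * ((1 + (x - m) ^+ 4) * phi x) <= _); last exact: ler_wpM2l.
by rewrite mulrA ler_wpM2r ?normal_pdf_ge0.
Qed.

Lemma is_derive_normal_pdf (x : R) :
  is_derive x 1 phi (- ((x - m) / s ^+ 2 * phi x)).
Proof.
rewrite normal_pdfE//.
rewrite /normal_fun.
pose f y := - (y - m) ^+ 2 / (s ^+ 2 *+ 2).
have df : is_derive x 1 f (- ((x - m) / s ^+ 2)).
  rewrite /f; apply: is_derive_eq; rewrite /GRing.scale/=.
  by rewrite -(mulr_natr (s ^+ 2)); field.
apply: is_derive_eq; rewrite /GRing.scale/= /f; ring.
Qed.

(** Integration by parts against [phi' = - (x - m) / s ^ 2 * phi].  The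
    moments and the cosine transform of the normal law are instances. *)
Lemma stein (g g' : R -> R) (C : R) :
  (forall x : R, is_derive x 1 g (g' x)) -> continuous g' ->
  (forall x, `|g x| <= C * (1 + (x - m) ^+ 4)) ->
  (forall x, `|g' x| <= C * (1 + (x - m) ^+ 4)) ->
  (forall x, `|(x - m) * g x| <= C * (1 + (x - m) ^+ 4)) ->
  \int[mu]_x (g' x * phi x) = (s ^+ 2)^-1 * \int[mu]_x ((x - m) * g x * phi x).
Proof.
move=> dg cg' gC g'C xgC.
have cg : continuous g by exact: is_derive_continuous dg.
have mg : measurable_fun [set: R] g by exact: continuous_measurable_fun.
have mg' : measurable_fun [set: R] g' by exact: continuous_measurable_fun.
have mxm : measurable_fun [set: R] (fun x => x - m) by exact: measurable_funB.
have mxg : measurable_fun [set: R] (fun x => (x - m) * g x).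
  exact: measurable_funM.
pose F x := g x * phi x.
pose f x := g' x * phi x - (s ^+ 2)^-1 * ((x - m) * g x * phi x).
have dF (x : R) : is_derive x 1 F (f x).
  have := is_derive_normal_pdf x => dphi.
  rewrite /F; apply: is_derive_eq; rewrite /GRing.scale/= /f; ring.
have i1 := integrable_quartic mg' g'C.
have i2 := integrable_quartic mxg xgC.
have i3 : mu.-integrable setT (fun x => ((s ^+ 2)^-1 * ((x - m) * g x * phi x))%:E).
  under eq_fun do rewrite EFinM; exact: integrableZl.
have fi : mu.-integrable setT (EFin \o f).
  rewrite /comp; under eq_fun do rewrite EFinB.
  exact: integrableB.
suff : \int[mu]_x f x = 0.
  rewrite RintegralB// RintegralZl// => /eqP; rewrite subr_eq0 => /eqP //.
have cphi : continuous phi by exact: continuous_normal_pdf.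
have cf : continuous f.
  move=> x; apply: cvgB; first by apply: cvgM; [exact: cg'|exact: cphi].
  apply: cvgM; first exact: cvg_cst.
  apply: cvgM; last exact: cphi.
  apply: cvgM; last exact: cg.
  by apply: cvgB; [exact: cvg_id|exact: cvg_cst].
pose I n := `[m - n.+1%:R, m + n.+1%:R]%classic.
have ftc n : \int[mu]_(x in I n) f x = F (m + n.+1%:R) - F (m - n.+1%:R).
  have cF : continuous F by move=> x; exact: cvgM (cg x) (cphi x).
  rewrite /Rintegral (@continuous_FTC2 _ f F)//.
  - by rewrite ltrBlDr -addrA ltrDl addr_gt0.
  - exact: continuous_subspaceT.
  - split; first by move=> x _; exact: ex_derive.
    + by apply: cvg_at_right_filter; exact: cF.
    + by apply: cvg_at_left_filter; exact: cF.
  - by move=> x _; rewrite derive1E derive_val.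
have lim1 : \int[mu]_(x in I n) f x @[n --> \oo] --> \int[mu]_x f x.
  have -> : (fun n => \int[mu]_(x in I n) f x) =
      (fun n => \int[mu]_x (f \_ (I n)) x).
    by apply/funext => n; rewrite -Rintegral_mkcond.
  apply: fine_cvg; rewrite /Rintegral fineK; last exact: integrable_fin_num.
  apply: (@dominated_cvg _ _ _ mu _ measurableT _ _ (fun x => (`|f x|)%:E)) => //.
  - move=> n; apply/measurable_EFinP; apply/(measurable_restrictT _ _).1 => //.
      exact: measurable_itv.
    by apply: measurable_funTS; exact: continuous_measurable_fun.
  - move=> x _; apply: cvg_near_cst; exists (Num.truncn `|x - m|) => // n /= xn.
    rewrite patchE ifT// inE /I/= in_itv/=.
    have : `|x - m| <= n.+1%:R.
      by apply/ltW/(lt_le_trans (truncnS_gt _)); rewrite ler_nat.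
    by rewrite ler_norml; lra.
  - exact: integrable_norm.
  - move=> n x _; rewrite lee_fin patchE.
    by case: ifP => // _; rewrite normr0.
have lim2 : \int[mu]_(x in I n) f x @[n --> \oo] --> (0 : R).
  rewrite (funext ftc).
  have [D D0 HD] := normal_pdf_quartic_bound.
  have s2 : s * Num.sqrt 2 != 0 by rewrite mulf_neq0// gt_eqF// sqrtr_gt0.
  have C0 : 0 <= C.
    have := gC m; rewrite subrr expr0n/= addr0 mulr1; exact: le_trans.
  have Fe (e : R) : `|e| = 1 -> F (m + e * n.+1%:R) @[n --> \oo] --> (0 : R).
    move=> e1; apply: norm_cvg0.
    apply: (@squeeze_cvgr _ _ _ _ (cst 0) (fun n => C * D *
        normal_fun m (s * Num.sqrt 2) (m + e * n.+1%:R))).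
    - apply: nearW => n /=; rewrite normr_ge0/= /F normrM -mulrA.
      rewrite (ger0_norm (normal_pdf_ge0 _ _ _)).
      apply: le_trans (ler_wpM2l C0 (HD _)); rewrite mulrA.
      by rewrite ler_wpM2r ?normal_pdf_ge0.
    - exact: cvg_cst.
    - rewrite -[X in _ --> X](mulr0 (C * D)).
      by apply: cvgM; [exact: cvg_cst|exact: cvg_normal_fun_shift].
  rewrite -[X in _ --> X](subr0 0); apply: cvgB.
  - by have := Fe 1 (normr1 _); under eq_fun do rewrite mul1r.
  - by have := Fe (-1) (normrN1 _); under eq_fun do rewrite mulN1r.
exact: (cvg_unique _ lim1 lim2).
Qed.

Lemma expr_le_quartic (y : R) k : (k <= 4)%N -> `|y| ^+ k <= 1 + y ^+ 4.
Proof.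
move=> k4; have y4 : y ^+ 4 = `|y| ^+ 4 by rewrite -normrX ger0_norm ?exprn_even_ge0.
have [y1|y1] := leP `|y| 1.
  apply: le_trans (exprn_ile1 k (normr_ge0 y) y1) _.
  by rewrite lerDl exprn_even_ge0.
rewrite y4; apply: le_trans (_ : `|y| ^+ 4 <= _); last by rewrite lerDr.
by rewrite ler_eXn2l.
Qed.

Lemma integrable_normal_pow k : (k <= 4)%N ->
  mu.-integrable setT (fun x => ((x - m) ^+ k * phi x)%:E).
Proof.
move=> k4; apply: (@integrable_quartic (fun x => (x - m) ^+ k) 1).
  by apply: measurable_funX; exact: measurable_funB.
by move=> x; rewrite mul1r normrX expr_le_quartic.
Qed.

Lemma normal_mean : \int[mu]_x ((x - m) * phi x) = 0.
Proof.
have st : \int[mu]_x (0 * phi x) = s ^- 2 * \int[mu]_x ((x - m) * 1 * phi x).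
  apply: (@stein (cst 1) (cst 0) 1) => //.
  - by move=> x; exact: cst_continuous.
  - by move=> x; rewrite /= normr1 mul1r lerDl exprn_even_ge0.
  - by move=> x; rewrite /= normr0 mul1r addr_ge0// exprn_even_ge0.
  - by move=> x; rewrite /= mulr1 mul1r -[X in X <= _]expr1 expr_le_quartic.
move: st; under eq_Rintegral do rewrite mul0r.
rewrite Rintegral_cst// mul0r.
under eq_Rintegral do rewrite mulr1.
by move=> /esym/eqP; rewrite mulf_eq0 invr_eq0 sqrf_eq0 (negbTE s0) => /eqP.
Qed.

Lemma normal_variance : \int[mu]_x ((x - m) ^+ 2 * phi x) = s ^+ 2.
Proof.
have st : \int[mu]_x (1 * phi x) =
    s ^- 2 * \int[mu]_x ((x - m) * (x - m) * phi x).
  apply: (@stein (fun x => x - m) (cst 1) 1).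
  - by move=> x; apply: is_derive_eq; rewrite subr0.
  - by move=> x; exact: cst_continuous.
  - by move=> x; rewrite mul1r -[X in X <= _]expr1 expr_le_quartic.
  - by move=> x; rewrite /= normr1 mul1r lerDl exprn_even_ge0.
  - by move=> x; rewrite -expr2 mul1r normrX expr_le_quartic.
move: st; under eq_Rintegral do rewrite mul1r.
under [in X in _ = X -> _]eq_Rintegral do rewrite -expr2.
rewrite {1}/Rintegral integral_normal_pdf/=.
by move=> /(congr1 ( *%R (s ^+ 2))); rewrite mulr1 mulVKf ?sqrf_eq0// => ->.
Qed.

Lemma normal_fourth : \int[mu]_x ((x - m) ^+ 4 * phi x) = 3 * s ^+ 4.
Proof.
have st : \int[mu]_x (3 * (x - m) ^+ 2 * phi x) =
    s ^- 2 * \int[mu]_x ((x - m) * (x - m) ^+ 3 * phi x).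
  apply: (@stein (fun x => (x - m) ^+ 3) (fun x => 3 * (x - m) ^+ 2) 3).
  - move=> x; apply: is_derive_eq; rewrite /GRing.scale/=; ring.
  - apply: (@is_derive_continuous _ _ (fun x => 6 * (x - m))) => x.
    apply: is_derive_eq; rewrite /GRing.scale/=; ring.
  - move=> x; rewrite normrX; have := @expr_le_quartic (x - m) 3 isT.
    have : 0 <= `|x - m| ^+ 3 by rewrite exprn_ge0.
    lra.
  - move=> x; rewrite normrM normrX ger0_norm// ler_wpM2l//.
    exact: expr_le_quartic.
  - move=> x; rewrite -exprS normrX; have := @expr_le_quartic (x - m) 4 isT.
    have : 0 <= `|x - m| ^+ 4 by rewrite exprn_ge0.
    lra.
under eq_Rintegral do rewrite -[4%N]/(1 + 3)%N exprD expr1.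
move: st; under eq_Rintegral do rewrite -mulrA.
rewrite RintegralZl//; last exact: integrable_normal_pow.
rewrite normal_variance => /(congr1 ( *%R (s ^+ 2))).
by rewrite mulVKf ?sqrf_eq0// => <-; ring.
Qed.

(** Let [J t] be the integral with [cos (t (x - m) + b)].  Differentiating under
    the integral and applying Stein's identity to a cosine give
    [J' = - s ^ 2 t J], so that [J t * expR (s ^ 2 t ^ 2 / 2)] is constant. *)
Lemma normal_cos (b : R) :
  \int[mu]_x (cos (x - m + b) * phi x) = cos b * expR (- (s ^+ 2 / 2)).
Proof.
pose f (t x : R) := cos (t * (x - m) + b) * phi x.
pose J t := \int[mu]_x f t x.
pose K t := \int[mu]_x (- ((x - m) * sin (t * (x - m) + b)) * phi x).
have cB : continuous (fun x : R => x - m).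
  by move=> x; apply: cvgB; [exact: cvg_id|exact: cvg_cst].
have ct t : continuous (fun x : R => t * (x - m) + b).
  move=> x; apply: cvgD; last exact: cvg_cst.
  by apply: cvgM; [exact: cvg_cst|exact: cB].
have ccos t : continuous (fun x : R => cos (t * (x - m) + b)).
  move=> x; apply: (continuous_comp (ct t x)); exact: continuous_cos.
have csin t : continuous (fun x : R => sin (t * (x - m) + b)).
  move=> x; apply: (continuous_comp (ct t x)); exact: continuous_sin.
have csin1 t : continuous (fun x : R => (x - m) * sin (t * (x - m) + b)).
  by move=> x; apply: cvgM; [exact: cB|exact: csin].
have q1 x : 1 <= 1 + (x - m) ^+ 4 by rewrite lerDl exprn_even_ge0.
have KJ t : K t = - (s ^+ 2 * t * J t).
  have st : \int[mu]_x (t * cos (t * (x - m) + b) * phi x) =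
      s ^- 2 * \int[mu]_x ((x - m) * sin (t * (x - m) + b) * phi x).
    apply: (@stein _ _ (1 + `|t|)).
    - move=> x; apply: is_derive_eq; rewrite /GRing.scale/=; ring.
    - move=> x; apply: cvgM; first exact: cvg_cst.
      exact: ccos.
    - move=> x; apply: le_trans (sin_max _) _; rewrite -[leLHS]mulr1.
      by apply: ler_pM => //; rewrite ?lerDl.
    - move=> x; rewrite normrM; apply: ler_pM => //; first by rewrite lerDr.
      by apply: le_trans (cos_max _) _.
    - move=> x; rewrite normrM; apply: le_trans (_ : `|x - m| ^+ 1 <= _).
        by rewrite expr1 ler_piMr// sin_max.
      apply: le_trans (expr_le_quartic _ _) _ => //.
      by rewrite ler_peMl ?lerDl// (le_trans _ (q1 x)).
  have ic := integrable_quartic (continuous_measurable_fun (ccos t)) (_ : forall x, _ <= 1 * _).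
  have isn := integrable_quartic (continuous_measurable_fun (csin1 t)) (_ : forall x, _ <= 1 * _).
  move: st; under eq_Rintegral do rewrite -mulrA.
  rewrite RintegralZl//; last first.
    by apply: ic => x; rewrite mul1r (le_trans (cos_max _)).
  rewrite -/(J t) => /(congr1 ( *%R (s ^+ 2))).
  rewrite mulVKf ?sqrf_eq0// mulrA => ->; rewrite /K.
  under eq_Rintegral do rewrite mulNr -mulN1r.
  rewrite RintegralZl// ?mulN1r//.
  apply: isn => x; rewrite mul1r normrM; apply: le_trans (_ : `|x - m| ^+ 1 <= _).
    by rewrite expr1 ler_piMr// sin_max.
  exact: expr_le_quartic.
have Jd (t : R) : is_derive t 1 J (K t).
  have fd (u x : R) : is_derive u 1 (f^~ x) (- ((x - m) * sin (u * (x - m) + b)) * phi x).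
    by rewrite /f; apply: is_derive_eq; rewrite /GRing.scale/=; ring.
  have d1 (u x : R) : (partial1of2 f) u x = - ((x - m) * sin (u * (x - m) + b)) * phi x.
    by rewrite partial1of2E; have := fd u x => ?; exact: derive_val.
  have It : `]t - 1, t + 1[%classic t by rewrite /= in_itv/=; lra.
  have intf u : `]t - 1, t + 1[%classic u -> mu.-integrable setT (EFin \o f u).
    move=> _; apply: (integrable_quartic (continuous_measurable_fun (ccos u)) (C := 1)).
    by move=> x; rewrite mul1r (le_trans (cos_max _)).
  have derf (u x : R) : `]t - 1, t + 1[%classic u -> setT x -> derivable (f^~ x) u 1.
    by move=> _ _; have := fd u x => ?; exact: ex_derive.
  pose G x := `|x - m| * phi x.
  have G0 x : 0 <= G x by rewrite mulr_ge0 ?normal_pdf_ge0.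
  have intG : mu.-integrable setT (EFin \o G).
    apply: (@integrable_quartic (fun x => `|x - m|) 1).
      by apply: measurableT_comp => //; exact: measurable_funB.
    by move=> x; rewrite mul1r normr_id -[X in X <= _]expr1 expr_le_quartic.
  have G_ub (u x : R) : `]t - 1, t + 1[%classic u -> setT x -> `|partial1of2 f u x| <= G x.
    move=> _ _; rewrite d1 mulNr normrN !normrM (ger0_norm (normal_pdf_ge0 _ _ _)).
    by rewrite ler_wpM2r ?normal_pdf_ge0// ler_piMr// sin_max.
  have Jdv := derivable_under_integral measurableT It intf derf G0 intG G_ub.
  have := differentiation_under_integral measurableT It intf derf G0 intG G_ub.
  rewrite derive1E => JE; apply: DeriveDef => //.
  by rewrite JE; apply: eq_Rintegral => x _; exact: d1.
(* the integrating factor of [J' = - s ^ 2 t J] *)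
pose H t := J t * expR (s ^+ 2 * t ^+ 2 / 2).
have Hd (t : R) : is_derive t 1 H 0.
  have := Jd t => ?; rewrite /H; apply: is_derive_eq; rewrite /GRing.scale/= KJ.
  by field.
have : H 1 = H 0 by exact: is_derive_0_is_cst.
rewrite /H expr0n/= !(mulr0, mul0r) expR0 mulr1 expr1n mulr1 /J /f.
under eq_Rintegral do rewrite mul1r.
under [in X in _ = X -> _]eq_Rintegral do rewrite mul0r add0r.
rewrite RintegralZl//; last exact: integrable_normal_pdf.
rewrite [X in _ = _ * X]/Rintegral integral_normal_pdf/= mulr1 => <-.
by rewrite expRN mulfK// gt_eqF// expR_gt0.
Qed.

End normal_moments.

Section law.
Context d (Omega : measurableType d) (R : realType) (P : probability Omega R).
Variables (X : Omega -> R).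
Hypothesis mX : measurable_fun [set: Omega] X.
Variable f : R -> R.
Hypothesis mf : measurable_fun [set: R] f.

Lemma integral_dirac_law (c : R) :
  (forall A : set R, measurable A -> P (X @^-1` A) = \d_c A) ->
  P.-integrable setT (EFin \o (f \o X)) /\ \int[P]_w f (X w) = f c.
Proof.
move=> law.
have mfE : measurable_fun [set: R] (EFin \o f) by exact/measurable_EFinP.
have int : P.-integrable setT (EFin \o (f \o X)).
  apply/integrableP; split.
    by apply/measurable_EFinP; exact: measurableT_comp.
  have /= <- := @ge0_integral_pushforward _ _ _ _ _ _ mX P setT (abse \o (EFin \o f)) measurableT.
  - rewrite (eq_measure_integral \d_c) => [|A mA _]; last exact: law.
    rewrite integral_dirac//=; first by rewrite diracT mul1e ltry.
    by apply: (@measurableT_comp _ _ _ _ _ _ abse _ (EFin \o f)).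
  - by apply: (@measurableT_comp _ _ _ _ _ _ abse _ (EFin \o f)).
  - by move=> y _; rewrite lee_fin.
split => //; rewrite /Rintegral.
have /= <- := @integral_pushforward _ _ _ _ _ _ mX P setT (EFin \o f) mfE int measurableT.
rewrite (eq_measure_integral \d_c) => [|A mA _]; last exact: law.
by rewrite integral_dirac// diracT mul1e.
Qed.

Lemma integral_density_law (p : R -> R) :
  measurable_fun [set: R] p -> (forall x, 0 <= p x) ->
  (forall A : set R, measurable A ->
    P (X @^-1` A) = (\int[lebesgue_measure]_(x in A) (p x)%:E)%E) ->
  lebesgue_measure.-integrable setT (fun x => (f x * p x)%:E) ->
  P.-integrable setT (EFin \o (f \o X)) /\
  \int[P]_w f (X w) = \int[lebesgue_measure]_x (f x * p x).
Proof.
move=> mp p0 law ifp.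
have mfE : measurable_fun [set: R] (EFin \o f) by exact/measurable_EFinP.
pose X' : Omega -> measurableTypeR R := X.
have mX' : measurable_fun [set: Omega] X' by [].
have nuf : (pushforward P X').-integrable setT (EFin \o f).
  exact: (@integrable_density _ _ R lebesgue_measure (pushforward P X') p mp p0 law f mf).2 ifp.
have int : P.-integrable setT (EFin \o (f \o X)).
  apply/integrableP; split.
    by apply/measurable_EFinP; exact: measurableT_comp.
  have /= <- := @ge0_integral_pushforward _ _ _ _ _ _ mX' P setT (abse \o (EFin \o f)) measurableT.
  - by case/integrableP : nuf.
  - by apply: (@measurableT_comp _ _ _ _ _ _ abse _ (EFin \o f)).
  - by move=> y _; rewrite lee_fin.
split => //.
rewrite -(@Rintegral_density _ _ R lebesgue_measure (pushforward P X') p mp p0 law f mf nuf).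
rewrite /Rintegral.
by rewrite (@integral_pushforward _ _ _ _ _ _ mX' P setT (EFin \o f) mfE int measurableT).
Qed.

End law.

(** The consequences of normality on which the proof rests, in a form that also
    covers constants, as normal variables of variance 0. *)
Definition has_normal_moments d (Omega : measurableType d) (R : realType)
    (P : probability Omega R) (X : Omega -> R) (m v : R) :=
  [/\ forall k, (k <= 4)%N ->
        P.-integrable setT (EFin \o (fun w => (X w - m) ^+ k)),
      \int[P]_w (X w - m) = 0,
      \int[P]_w ((X w - m) ^+ 2) = v,
      \int[P]_w ((X w - m) ^+ 4) = 3 * v ^+ 2 &
      forall b, \int[P]_w cos (X w - m + b) = cos b * expR (- (v / 2))].

Lemma gaussian_rv_moments d (Omega : measurableType d) (R : realType)
    (P : probability Omega R) (X : Omega -> R) :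
  measurable_fun [set: Omega] X -> gaussian_rv P X ->
  exists m v, has_normal_moments P X m v.
Proof.
move=> mX [m [s [_ law]]]; exists m, (s ^+ 2).
have mp k : measurable_fun [set: R] (fun x : R => (x - m) ^+ k).
  by apply: measurable_funX; exact: measurable_funB.
have mc b : measurable_fun [set: R] (fun x : R => cos (x - m + b)).
  apply: measurableT_comp.
    by apply: continuous_measurable_fun; exact: continuous_cos.
  by apply: measurable_funD => //; exact: measurable_funB.
case: (eqVneq s 0) law => [->|s0] law.
  have E f mf := @integral_dirac_law _ _ _ P X mX f mf m law.
  split.
  - by move=> k _; exact: (E _ (mp k)).1.
  - by rewrite (E _ (mp 1%N)).2 subrr.
  - by rewrite (E _ (mp 2%N)).2 subrr.
  - by rewrite (E _ (mp 4%N)).2 subrr !expr0n /= mulr0.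
  - by move=> b; rewrite (E _ (mc b)).2 subrr add0r expr0n/= mul0r oppr0 expR0 mulr1.
have E f mf := @integral_density_law _ _ _ P X mX f mf _
  (measurable_normal_pdf m s) (normal_pdf_ge0 m s) law.
have Ek k k4 := E _ (mp k) (integrable_normal_pow m s0 k4).
split.
- by move=> k k4; exact: (Ek k k4).1.
- by rewrite (Ek 1%N isT).2 normal_mean.
- by rewrite (Ek 2%N isT).2 normal_variance.
- by rewrite (Ek 4%N isT).2 normal_fourth// -exprM.
- move=> b; rewrite (E _ (mc b) _).2 ?normal_cos//.
  apply: (@integrable_quartic _ m s s0 _ 1 (mc b)) => x.
  by rewrite mul1r (le_trans (cos_max _))// lerDl exprn_even_ge0.
Qed.

(** * Cosine transforms determine probabilities of rectangles *)

Section real_integrable.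
Context d (T : measurableType d) (R : realType) (mu : {measure set T -> \bar R}).
Implicit Types f g : T -> R.

Lemma integrableRD f g : mu.-integrable setT (EFin \o f) ->
  mu.-integrable setT (EFin \o g) ->
  mu.-integrable setT (EFin \o (fun x => f x + g x)).
Proof. by move=> intf intg; exact: (integrableD measurableT intf intg). Qed.

Lemma integrableRZ c f : mu.-integrable setT (EFin \o f) ->
  mu.-integrable setT (EFin \o (fun x => c * f x)).
Proof. by move=> intf; exact: (integrableZl measurableT c intf). Qed.

Lemma integrableRB f g : mu.-integrable setT (EFin \o f) ->
  mu.-integrable setT (EFin \o g) ->
  mu.-integrable setT (EFin \o (fun x => f x - g x)).
Proof. by move=> intf intg; exact: (integrableB measurableT intf intg). Qed.

Lemma integrableR_sum n (f : nat -> T -> R) :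
  (forall i, (i < n)%N -> mu.-integrable setT (EFin \o f i)) ->
  mu.-integrable setT (EFin \o (fun x => \sum_(i < n) f i x)).
Proof.
elim: n => [_|n IH intf].
  by rewrite /comp; under eq_fun do rewrite big_ord0; exact: integrable0.
rewrite /comp; under eq_fun do rewrite big_ord_recr/=.
apply: integrableRD; last exact: intf.
by apply: IH => i ilt; exact: intf (ltnW ilt).
Qed.

Lemma Rintegral_sum n (f : nat -> T -> R) :
  (forall i, (i < n)%N -> mu.-integrable setT (EFin \o f i)) ->
  \int[mu]_x (\sum_(i < n) f i x) = \sum_(i < n) \int[mu]_x f i x.
Proof.
elim: n => [_|n IH intf].
  by under eq_Rintegral do rewrite big_ord0; rewrite big_ord0 /Rintegral integral0.
have intf' i : (i < n)%N -> mu.-integrable setT (EFin \o f i).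
  by move=> ilt; exact: intf (ltnW ilt).
under eq_Rintegral do rewrite big_ord_recr/=.
by rewrite RintegralD ?big_ord_recr ?IH//; [exact: integrableR_sum|exact: intf].
Qed.

End real_integrable.

Section bounded_integration.
Context d (T : measurableType d) (R : realType) (P : probability T R).

Lemma integrable_bounded (f : T -> R) (M : R) : measurable_fun [set: T] f ->
  (forall x, `|f x| <= M) -> P.-integrable setT (EFin \o f).
Proof.
move=> mf fM; apply: measurable_bounded_integrable => //.
  by rewrite (le_lt_trans (probability_le1 _ _))// ltry.
exists M; split; first exact: num_real.
by move=> y My x _ /=; rewrite (le_trans (fM x))// ltW.
Qed.

Lemma Rintegral_dominated_cvg (f_ : nat -> T -> R) (f g : T -> R) :
  (forall n, measurable_fun [set: T] (f_ n)) ->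
  (forall x, f_ n x @[n --> \oo] --> f x) ->
  P.-integrable setT (EFin \o g) -> (forall n x, `|f_ n x| <= g x) ->
  \int[P]_x f_ n x @[n --> \oo] --> \int[P]_x f x.
Proof.
move=> mf_ f_f ig f_g.
have mf : measurable_fun [set: T] f by exact: measurable_fun_cvg mf_ (fun x _ => f_f x).
have intf : P.-integrable setT (EFin \o f).
  apply: le_integrable (ig) => //; first exact/measurable_EFinP.
  move=> x _; rewrite lee_fin; apply: le_trans (ler_norm _).
  apply: (@closed_cvg _ _ \oo _ (fun n => `|f_ n x|) [set y | y <= g x]) => //.
    by apply: nearW => n; exact: f_g.
  exact: cvg_norm.
apply: fine_cvg; rewrite /Rintegral fineK; last exact: integrable_fin_num.
apply: (@dominated_cvg _ _ _ P _ measurableT _ _ (EFin \o g)) => //.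
- by move=> n; exact/measurable_EFinP.
- by move=> x _; apply/fine_cvgP; split; [exact: nearW|exact: f_f].
- by move=> n x _; rewrite lee_fin.
Qed.

End bounded_integration.

Section sign_polynomials.
Context {R : realType}.

Lemma bernoulli_le (t : R) n : 0 <= t <= 1 -> 1 - n%:R * t <= (1 - t) ^+ n.
Proof.
move=> /andP[t0 t1]; elim: n => [|n IH]; first by rewrite mul0r subr0.
rewrite exprS; apply: le_trans (ler_wpM2l _ IH); last by rewrite subr_ge0.
by have n0 : 0 <= n%:R :> R by []; rewrite -natr1; nra.
Qed.

Lemma cvg_natrM_expr (q : R) : 0 <= q < 1 -> n%:R * q ^+ n @[n --> \oo] --> 0.
Proof.
move=> /andP[]; rewrite le_eqVlt => /orP[/eqP <- _|q0 q1].
  by apply: cvg_near_cst; near=> n; rewrite expr0n gtn_eqF ?mulr0//; near: n; exists 1%N.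
pose c := - ln q; have c0 : 0 < c by rewrite oppr_gt0 ln_lt0// q0.
rewrite -cvg_shiftS.
apply: (@squeeze_cvgr _ _ _ _ (cst 0) (fun n => 2 / c ^+ 2 * harmonic n)).
- apply: nearW => n /=; rewrite mulr_ge0 ?exprn_ge0 ?(ltW q0)//=.
  have -> : q ^+ n.+1 = (expR (n.+1%:R * c))^-1.
    by rewrite /c mulrN expRN invrK expRM_natl lnK.
  have nc0 : 0 < n.+1%:R * c by rewrite mulr_gt0.
  have := expR_ge1Dxn 1 (ltW nc0); rewrite -[2`!]/2%N => e2.
  have e0 := expR_gt0 (n.+1%:R * c).
  rewrite ler_pdivrMr//.
  have -> : 2 / c ^+ 2 / n.+1%:R * expR (n.+1%:R * c) =
      n.+1%:R * (expR (n.+1%:R * c) / ((n.+1%:R * c) ^+ 2 / 2)).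
    by field; rewrite gt_eqF//= pnatr_eq0.
  by rewrite ler_peMr// ler_pdivlMr ?divr_gt0 ?exprn_gt0// mul1r; lra.
- exact: cvg_cst.
- rewrite -[X in _ --> X](mulr0 (2 / c ^+ 2)).
  by apply: cvgM; [exact: cvg_cst|exact: cvg_harmonic].
Unshelve. all: by end_near. Qed.

(** Polynomials that switch at 0.  With [s = (1 + y) / 2] the value lies above
    [1 - n (2 s) ^ n] and below [expR (- n (2 s) ^ n)], and [2 s < 1] exactly
    when [y < 0]. *)
Lemma cvg_sign_poly (y : R) : `|y| <= 1 ->
  (1 - ((1 + y) / 2) ^+ n) ^+ (n * 2 ^ n) @[n --> \oo] --> ((y < 0)%R%:R : R).
Proof.
rewrite ler_norml => /andP[yN1 y1].
set s := (1 + y) / 2.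
have s0 : 0 <= s by rewrite /s; lra.
have s1 : s <= 1 by rewrite /s; lra.
have t01 n : 0 <= 1 - s ^+ n <= 1.
  by rewrite subr_ge0 exprn_ile1//= gerBl exprn_ge0.
case: ltP => y0 /=.
- apply: (@squeeze_cvgr _ _ _ _ (fun n => 1 - n%:R * (1 + y) ^+ n) (cst 1)).
  + apply: nearW => n; have /andP[tn0 tn1] := t01 n.
    rewrite exprn_ile1// andbT.
    apply: le_trans (bernoulli_le (n * 2 ^ n) _); last by rewrite exprn_ge0//= exprn_ile1.
    rewrite lerD2l lerN2 natrM natrX -mulrA -exprMn.
    by have -> : 2 * s = 1 + y by rewrite /s; field.
  + rewrite -[X in _ --> X](subr0 1); apply: cvgB; first exact: cvg_cst.
    by apply: cvg_natrM_expr; lra.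
  + exact: cvg_cst.
- apply: (@squeeze_cvgr _ _ _ _ (cst 0) (fun n => expR (- n%:R))).
  + apply: nearW => n /=; have /andP[tn0 tn1] := t01 n.
    rewrite exprn_ge0//=.
    apply: (@le_trans _ _ (expR (- s ^+ n) ^+ (n * 2 ^ n))).
      by apply: lerXn2r; rewrite ?nnegrE ?expR_ge0//; exact: expR_ge1Dx.
    rewrite -expRM_natl ler_expR mulrN lerN2 natrM natrX -mulrA -exprMn.
    by rewrite ler_peMr// exprn_ege1// /s; lra.
  + exact: cvg_cst.
  + exact: cvgn_expR.
Qed.

End sign_polynomials.

Section cosine_uniqueness.
Context d1 d2 (T1 : measurableType d1) (T2 : measurableType d2) (R : realType).
Variables (P1 : probability T1 R) (P2 : probability T2 R).

Section one_variable.
Variables (X1 W1 : T1 -> R) (X2 W2 : T2 -> R) (M : R).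
Hypotheses (mX1 : measurable_fun setT X1) (mW1 : measurable_fun setT W1).
Hypotheses (mX2 : measurable_fun setT X2) (mW2 : measurable_fun setT W2).
Hypotheses (W1M : forall x, `|W1 x| <= M) (W2M : forall x, `|W2 x| <= M).

(** The weights [W1] and [W2] make it possible to treat the coordinates of a
    random vector one at a time. *)
Definition same_integral (f : R -> R) :=
  \int[P1]_x (W1 x * f (X1 x)) = \int[P2]_x (W2 x * f (X2 x)).

Lemma integrable_bounded1 (f : R -> R) (C : R) : measurable_fun setT f ->
  (forall x, `|f x| <= C) -> P1.-integrable setT (fun x => (W1 x * f (X1 x))%:E).
Proof.
move=> mf fC; apply: (@integrable_bounded _ _ _ P1 (fun x => W1 x * f (X1 x)) (M * C)).
  by apply: measurable_funM => //; exact: measurableT_comp.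
by move=> x; rewrite normrM ler_pM.
Qed.

Lemma integrable_bounded2 (f : R -> R) (C : R) : measurable_fun setT f ->
  (forall x, `|f x| <= C) -> P2.-integrable setT (fun x => (W2 x * f (X2 x))%:E).
Proof.
move=> mf fC; apply: (@integrable_bounded _ _ _ P2 (fun x => W2 x * f (X2 x)) (M * C)).
  by apply: measurable_funM => //; exact: measurableT_comp.
by move=> x; rewrite normrM ler_pM.
Qed.

Lemma same_integralZ (f : R -> R) (c C : R) : measurable_fun setT f ->
  (forall x, `|f x| <= C) -> same_integral f -> same_integral (fun x => c * f x).
Proof.
move=> mf fC ff; rewrite /same_integral.
under eq_Rintegral do rewrite mulrCA.
under [RHS]eq_Rintegral do rewrite mulrCA.
rewrite RintegralZl//; last exact: integrable_bounded1 fC.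
rewrite RintegralZl//; last exact: integrable_bounded2 fC.
by rewrite ff.
Qed.

Lemma same_integralD (f g : R -> R) (C D : R) :
  measurable_fun setT f -> measurable_fun setT g ->
  (forall x, `|f x| <= C) -> (forall x, `|g x| <= D) ->
  same_integral f -> same_integral g -> same_integral (fun x => f x + g x).
Proof.
move=> mf mg fC gD ff gg; rewrite /same_integral.
under eq_Rintegral do rewrite mulrDr.
under [RHS]eq_Rintegral do rewrite mulrDr.
rewrite RintegralD//; [|exact: integrable_bounded1 fC|exact: integrable_bounded1 gD].
rewrite RintegralD//; [|exact: integrable_bounded2 fC|exact: integrable_bounded2 gD].
by rewrite ff gg.
Qed.

Lemma same_integral_cvg (f_ : nat -> R -> R) (f : R -> R) (C : R) :
  (forall n, measurable_fun setT (f_ n)) -> (forall n x, `|f_ n x| <= C) ->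
  (forall x, f_ n x @[n --> \oo] --> f x) ->
  (forall n, same_integral (f_ n)) -> same_integral f.
Proof.
move=> mf_ f_C f_f same.
have c1 : \int[P1]_x (W1 x * f_ n (X1 x)) @[n --> \oo] -->
    \int[P1]_x (W1 x * f (X1 x)).
  apply: (@Rintegral_dominated_cvg _ _ _ P1 (fun n x => W1 x * f_ n (X1 x)) _ (cst (M * C))).
  - by move=> n; apply: measurable_funM => //; exact: measurableT_comp.
  - by move=> x; apply: cvgM; [exact: cvg_cst|exact: f_f].
  - exact: (@integrable_bounded _ _ _ _ _ `|M * C|).
  - by move=> n x; rewrite normrM ler_pM.
have c2 : \int[P2]_x (W2 x * f_ n (X2 x)) @[n --> \oo] -->
    \int[P2]_x (W2 x * f (X2 x)).
  apply: (@Rintegral_dominated_cvg _ _ _ P2 (fun n x => W2 x * f_ n (X2 x)) _ (cst (M * C))).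
  - by move=> n; apply: measurable_funM => //; exact: measurableT_comp.
  - by move=> x; apply: cvgM; [exact: cvg_cst|exact: f_f].
  - exact: (@integrable_bounded _ _ _ _ _ `|M * C|).
  - by move=> n x; rewrite normrM ler_pM.
by move: c1; rewrite (funext same) => c1; exact: (cvg_unique _ c1 c2).
Qed.

Hypothesis same_cos : forall a b, same_integral (fun x => cos (a * x + b)).

Lemma measurable_cos_affine (a b : R) :
  measurable_fun [set: R] (fun x => cos (a * x + b)).
Proof.
apply: measurableT_comp.
  by apply: continuous_measurable_fun; exact: continuous_cos.
by apply: measurable_funD => //; exact: measurable_funM.
Qed.

Lemma measurable_sin_affine (a b : R) :
  measurable_fun [set: R] (fun x => sin (a * x + b)).
Proof.
apply: measurableT_comp.
  by apply: continuous_measurable_fun; exact: continuous_sin.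
by apply: measurable_funD => //; exact: measurable_funM.
Qed.

(** Products of sines and cosines are sums of sines and cosines, so polynomials in
    a sine are trigonometric polynomials. *)
Lemma same_integral_sinX_cos k (a b c e : R) :
  same_integral (fun x => sin (a * x + e) ^+ k * cos (b * x + c)).
Proof.
elim: k b c => [|k IH] b c.
  have := same_cos b c; congr same_integral.
  by apply/funext => x; rewrite mul1r.
pose g b c (x : R) := sin (a * x + e) ^+ k * cos (b * x + c).
have mg b' c' : measurable_fun setT (g b' c').
  apply: measurable_funM; last exact: measurable_cos_affine.
  by apply: measurable_funX; exact: measurable_sin_affine.
have g1 b' c' x : `|g b' c' x| <= 1.
  rewrite normrM normrX mulr_ile1 ?exprn_ge0 ?cos_max//.
  by rewrite exprn_ile1// sin_max.
have -> : (fun x => sin (a * x + e) ^+ k.+1 * cos (b * x + c)) =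
    (fun x => 2^-1 * (g (a + b) (e + c - pi / 2) x + g (a - b) (e - c - pi / 2) x)).
  apply/funext => x; rewrite /g.
  have -> : (a + b) * x + (e + c - pi / 2) = ((a * x + e) + (b * x + c)) - pi / 2 by ring.
  have -> : (a - b) * x + (e - c - pi / 2) = ((a * x + e) - (b * x + c)) - pi / 2 by ring.
  move: (a * x + e) (b * x + c) => u v.
  by rewrite !cosBpihalf sinD sinB exprS; field.
apply: (@same_integralZ _ _ (1 + 1)).
- exact: measurable_funD.
- by move=> x; rewrite (le_trans (ler_normD _ _))// lerD.
- by apply: (same_integralD (C := 1) (D := 1)) => //; exact: IH.
Qed.

Lemma same_integral_poly_sin (p : {poly R}) (a e : R) :
  same_integral (fun x => p.[sin (a * x + e)]).
Proof.
have msin k : measurable_fun setT (fun x => sin (a * x + e) ^+ k).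
  by apply: measurable_funX; exact: measurable_sin_affine.
have sin1 k x : `|sin (a * x + e) ^+ k| <= 1.
  by rewrite normrX exprn_ile1// sin_max.
have same_pow k : same_integral (fun x => sin (a * x + e) ^+ k).
  have := same_integral_sinX_cos k a 0 0 e; congr same_integral.
  by apply/funext => x; rewrite mul0r addr0 cos0 mulr1.
have mterm (c : nat -> R) i : measurable_fun setT (fun x => c i * sin (a * x + e) ^+ i).
  exact: measurable_funM.
have term_le (c : nat -> R) i x : `|c i * sin (a * x + e) ^+ i| <= `|c i|.
  by rewrite normrM ler_piMr.
have same_sum n (c : nat -> R) : same_integral (fun x => \sum_(i < n) c i * sin (a * x + e) ^+ i).
  elim: n => [|n IH].
    have := @same_integralZ _ 0 1 (msin 0%N) (sin1 0%N) (same_pow 0%N).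
    by congr same_integral; apply/funext => x; rewrite mul0r big_ord0.
  under eq_fun do rewrite big_ord_recr/=.
  apply: (@same_integralD _ _ (\sum_(i < n) `|c i|) `|c n|) => //.
  - by apply: measurable_sum => i; exact: mterm.
  - move=> x; apply: le_trans (ler_norm_sum _ _ _) _.
    by apply: ler_sum => i _; exact: term_le.
  - exact: same_integralZ (sin1 n) (same_pow n).
by have := same_sum (size p) (nth 0 p); under eq_fun do rewrite -horner_coef.
Qed.

(** The switching polynomials, composed with a sine, converge to this indicator
    boundedly and everywhere. *)
Lemma same_integral_sin_neg (a e : R) :
  same_integral (\1_[set x | sin (a * x + e) < 0]).
Proof.
pose f n x := (1 - ((1 + sin (a * x + e)) / 2) ^+ n) ^+ (n * 2 ^ n).
have f01 n x : 0 <= 1 - ((1 + sin (a * x + e)) / 2) ^+ n <= 1.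
  have := sin_max (a * x + e); rewrite ler_norml => /andP[s1 s2].
  have y0 : 0 <= (1 + sin (a * x + e)) / 2 by lra.
  by rewrite subr_ge0 exprn_ile1//= ?gerBl ?exprn_ge0//; lra.
have mf n : measurable_fun setT (f n).
  apply: measurable_funX; apply: measurable_funB => //.
  apply: measurable_funX; apply: measurable_funM => //.
  by apply: measurable_funD => //; exact: measurable_sin_affine.
apply: (@same_integral_cvg f _ 1) => //.
- move=> n x; have /andP[f0 f1] := f01 n x.
  by rewrite ger0_norm ?exprn_ge0// exprn_ile1.
- move=> x; have := cvg_sign_poly (sin_max (a * x + e)); rewrite indicE.
  suff -> : (x \in [set x | sin (a * x + e) < 0]) = (sin (a * x + e) < 0) by [].
  by apply/idP/idP => [/set_mem|/mem_set].
- move=> n.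
  have := same_integral_poly_sin ((1 - ((1 + 'X) * (2^-1)%:P) ^+ n) ^+ (n * 2 ^ n)) a e.
  by congr same_integral; apply/funext => x; rewrite !hornerE.
Qed.

(** The function [sin (a (x - u))] has the sign of [x - u] on a window around [u]
    that fills the line as [a] decreases to 0. *)
Lemma same_integral_lt (u : R) : same_integral (\1_[set x | x < u]).
Proof.
pose a n := (n.+1%:R : R)^-1; have a0 n : 0 < a n by rewrite invr_gt0.
have mind n : measurable [set x : R | sin (a n * x + - (a n * u)) < 0].
  have := @measurable_sin_affine (a n) (- (a n * u)) measurableT _ (measurable_itv `]-oo, 0[).
  by rewrite setTI; congr measurable; apply/seteqP; split => x /=; rewrite in_itv.
apply: (@same_integral_cvg (fun n => \1_[set x | sin (a n * x + - (a n * u)) < 0]) _ 1).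
- by move=> n; exact: measurable_indic.
- by move=> n x; rewrite ger0_norm// indicE; case: (_ \in _).
- move=> x; apply: cvg_near_cst; exists (Num.truncn `|x - u|) => // n /= nx.
  rewrite !indicE; congr ((nat_of_bool _)%:R); apply/idP/idP => /set_mem /= H; apply/mem_set => /=.
  + rewrite ltNge; apply/negP => ux; move: H; rewrite ltNge => /negP; apply.
    rewrite -mulrBr; apply: sin_ge0_pi; rewrite mulr_ge0 ?subr_ge0 ?(ltW (a0 n))//=.
    rewrite -(ger0_norm (_ : 0 <= x - u)) ?subr_ge0// mulrC ler_pdivrMr//.
    apply: ltW; apply: (lt_le_trans (lt_le_trans (truncnS_gt _) (_ : _ <= n.+1%:R))).
      by rewrite ler_nat.
    by rewrite ler_peMl// (le_trans _ (pi_ge2 R)) ?ler1n.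
  + rewrite -mulrBr -oppr_gt0 -sinN -mulrN opprB; apply: sin_gt0_pi.
    rewrite mulr_gt0 ?subr_gt0 ?a0//=.
    rewrite -(ger0_norm (_ : 0 <= u - x)) ?subr_ge0 ?ltW// distrC mulrC ltr_pdivrMr//.
    apply: (lt_le_trans (lt_le_trans (truncnS_gt _) (_ : _ <= n.+1%:R))).
      by rewrite ler_nat.
    by rewrite ler_peMl// (le_trans _ (pi_ge2 R)) ?ler1n.
- by move=> n; exact: same_integral_sin_neg.
Qed.

Lemma same_integral_indic (A : set R) : measurable A -> same_integral (\1_A).
Proof.
have ind_le1 (B : set R) x : `|\1_B x : R| <= 1.
  by rewrite ger0_norm// indicE; case: (_ \in _).
move=> mA; apply: (@dynkin_induction _ (measurableTypeR R) (@RGenInftyO.G R)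
  (fun A => same_integral (\1_A))) => //.
- exact: RGenInftyO.measurableE.
- move=> _ _ [x ->] [y ->]; exists (Num.min x y).
  by apply/seteqP; split => z /=; rewrite !in_itv/= lt_min => /andP.
- have := same_cos 0 0; congr same_integral; apply/funext => x.
  by rewrite mul0r addr0 cos0 indicT.
- move=> _ [x ->]; have := same_integral_lt x; congr same_integral.
- move=> S mS sS.
  have -> : \1_(~` S) = (fun x => \1_[set: R] x + -1 * \1_S x) :> (R -> R).
    apply/funext => x; rewrite indicC indicT/= indicE.
    by case: (_ \in _); rewrite ?mulr1 ?mulr0 ?subrr ?addr0.
  apply: (@same_integralD _ _ 1 1) => //.
  + exact: measurable_funM.
  + by move=> x; rewrite normrM normrN normr1 mul1r.
  + have := same_cos 0 0; congr same_integral; apply/funext => x.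
    by rewrite mul0r addr0 cos0 indicT.
  + exact: same_integralZ (ind_le1 S) sS.
- move=> F mF tF sF; pose U n := \big[setU/set0]_(i < n) F i.
  have mU n : measurable (U n) by exact: bigsetU_measurable.
  apply: (@same_integral_cvg (fun n => \1_(U n)) _ 1) => //.
  + by move=> n; apply: measurable_indic; exact: mU.
  + move=> x; apply: cvg_near_cst; have [[k _ Fkx]|nF] := pselect ((\bigcup_k F k) x).
      exists k.+1 => // n /= kn; rewrite !indicE !mem_set//; first by exists k.
      by rewrite /U -bigcup_mkord; exists k.
    apply: nearW => n; rewrite !indicE !memNset//.
    by rewrite /U -bigcup_mkord => -[k _ Fkx]; apply: nF; exists k.
  + elim => [|n IH].
      rewrite /same_integral /U big_ord0 indic0.
      by under eq_Rintegral do rewrite mulr0; under [RHS]eq_Rintegral do rewrite mulr0;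
        rewrite !Rintegral_cst// !mul0r.
    have -> : \1_(U n.+1) = (fun x => \1_(U n) x + \1_(F n) x) :> (R -> R).
      apply/funext => x; rewrite /U big_ord_recr/= -/(U n) !indicE in_setU.
      have [/set_mem Fx|_] := boolP (x \in F n); last by rewrite orbF addr0.
      rewrite memNset ?orbT ?add0r// => Ux.
      have : (U n `&` F n) x by [].
      have -> // : U n `&` F n = set0.
      by apply: (@trivIset_bigsetUI _ predT) => //; rewrite /predT /= trueE.
    by apply: (@same_integralD _ _ 1 1) => //; apply: measurable_indic; [exact: mU|exact: mF].
- by move: mA; rewrite -[X in X -> _]/(@measurable _ (measurableTypeR R) A) RGenInftyO.measurableE.
Qed.

End one_variable.

(** Induction on the number of coordinates.  The product formula for cosines
    turns the cosine of the remaining coordinates into a bounded weight, which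
    leaves a statement about one variable. *)
Lemma cos_determines_rectangles n (X1 : nat -> T1 -> R) (X2 : nat -> T2 -> R)
    (U1 : T1 -> R) (U2 : T2 -> R) (M : R) :
  (forall j, measurable_fun setT (X1 j)) ->
  (forall j, measurable_fun setT (X2 j)) ->
  measurable_fun setT U1 -> measurable_fun setT U2 ->
  (forall x, `|U1 x| <= M) -> (forall x, `|U2 x| <= M) ->
  (forall (a : nat -> R) c,
    \int[P1]_x (U1 x * cos (\sum_(j < n) a j * X1 j x + c)) =
    \int[P2]_x (U2 x * cos (\sum_(j < n) a j * X2 j x + c))) ->
  forall A : nat -> set R, (forall j, measurable (A j)) ->
    \int[P1]_x (U1 x * \prod_(j < n) \1_(A j) (X1 j x)) =
    \int[P2]_x (U2 x * \prod_(j < n) \1_(A j) (X2 j x)).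
Proof.
move=> mX1 mX2; elim: n U1 U2 => [|n IH] U1 U2 mU1 mU2 U1M U2M same A mA.
  have := same (fun=> 0) 0.
  under eq_Rintegral do rewrite big_ord0 addr0 cos0.
  under [RHS]eq_Rintegral do rewrite big_ord0 addr0 cos0.
  by under [X in _ -> X = _]eq_Rintegral do rewrite big_ord0;
     under [X in _ -> _ = X]eq_Rintegral do rewrite big_ord0.
have mind : measurable_fun setT (\1_(A n) : R -> R) by exact: measurable_indic.
have ind_le1 (B : set R) x : `|\1_B x : R| <= 1.
  by rewrite ger0_norm// indicE; case: (_ \in _).
under eq_Rintegral do rewrite big_ord_recr/= [_ * \1_(A n) _]mulrC mulrA.
under [RHS]eq_Rintegral do rewrite big_ord_recr/= [_ * \1_(A n) _]mulrC mulrA.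
apply: IH => //.
- by apply: measurable_funM => //; exact: measurableT_comp.
- by apply: measurable_funM => //; exact: measurableT_comp.
- by move=> x; rewrite normrM (le_trans _ (U1M x))// ler_piMr.
- by move=> x; rewrite normrM (le_trans _ (U2M x))// ler_piMr.
move=> a c; under eq_Rintegral do rewrite mulrAC.
under [RHS]eq_Rintegral do rewrite mulrAC.
pose g1 e b x := U1 x * cos (\sum_(j < n) a j * X1 j x + e * X1 n x + b).
pose g2 e b x := U2 x * cos (\sum_(j < n) a j * X2 j x + e * X2 n x + b).
have mlin1 : measurable_fun setT (fun x => \sum_(j < n) a j * X1 j x).
  by apply: measurable_sum => j; exact: measurable_funM.
have mlin2 : measurable_fun setT (fun x => \sum_(j < n) a j * X2 j x).
  by apply: measurable_sum => j; exact: measurable_funM.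
have mcos : measurable_fun setT (@cos R).
  by apply: continuous_measurable_fun; exact: continuous_cos.
have ig1 e b : P1.-integrable setT (EFin \o g1 e b).
  apply: (@integrable_bounded _ _ _ _ _ M).
    apply: measurable_funM => //; apply: measurableT_comp => //.
    by apply: measurable_funD => //; apply: measurable_funD => //; exact: measurable_funM.
  by move=> x; rewrite normrM (le_trans _ (U1M x))// ler_piMr// cos_max.
have ig2 e b : P2.-integrable setT (EFin \o g2 e b).
  apply: (@integrable_bounded _ _ _ _ _ M).
    apply: measurable_funM => //; apply: measurableT_comp => //.
    by apply: measurable_funD => //; apply: measurable_funD => //; exact: measurable_funM.
  by move=> x; rewrite normrM (le_trans _ (U2M x))// ler_piMr// cos_max.
have gE e b : \int[P1]_x g1 e b x = \int[P2]_x g2 e b x.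
  have := same (fun j => if (j < n)%N then a j else e) b.
  under eq_Rintegral do rewrite big_ord_recr/= ltnn (eq_bigr _ (fun i _ => congr1 ( *%R^~ _) (ifT _ _ (ltn_ord i)))).
  under [X in _ = X -> _]eq_Rintegral do rewrite big_ord_recr/= ltnn (eq_bigr _ (fun i _ => congr1 ( *%R^~ _) (ifT _ _ (ltn_ord i)))).
  by [].
apply: (@same_integral_indic (X1 n) (fun x => U1 x * cos (\sum_(j < n) a j * X1 j x + c))
  (X2 n) (fun x => U2 x * cos (\sum_(j < n) a j * X2 j x + c)) M) => //.
- by apply: measurable_funM => //; apply: measurableT_comp => //; exact: measurable_funD.
- by apply: measurable_funM => //; apply: measurableT_comp => //; exact: measurable_funD.
- by move=> x; rewrite normrM (le_trans _ (U1M x))// ler_piMr// cos_max.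
- by move=> x; rewrite normrM (le_trans _ (U2M x))// ler_piMr// cos_max.
move=> e b; rewrite /same_integral.
have prod2 (u v w : R) : u * cos v * cos w = 2^-1 * (u * cos (v + w) + u * cos (v - w)).
  by rewrite cosD cosB; field.
transitivity (2^-1 * (\int[P1]_x g1 e (c + b) x + \int[P1]_x g1 (- e) (c - b) x)).
  rewrite -RintegralD// -RintegralZl//; last first.
    exact: integrableRD.
  apply: eq_Rintegral => x _; rewrite prod2 /g1; congr (_ * (_ * cos _ + _ * cos _)).
  - by ring.
  - by ring.
rewrite !gE -RintegralD// -RintegralZl//; last first.
  exact: integrableRD.
apply: eq_Rintegral => x _; rewrite prod2 /g2; congr (_ * (_ * cos _ + _ * cos _)).
- by ring.
- by ring.
Qed.

End cosine_uniqueness.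

(** * Independence of uncorrelated Gaussian variables *)

Section small_sine.
Context {R : realType}.

Lemma normr_sin_le (x : R) : `|sin x| <= `|x|.
Proof.
wlog x0 : x / 0 <= x => [H|].
  have [/H//|/ltW x0] := leP 0 x.
  by rewrite -normrN -sinN -[leRHS]normrN; apply: H; rewrite oppr_ge0.
have [->|xn0] := eqVneq x 0; first by rewrite sin0.
have x_gt0 : 0 < x by rewrite lt_neqAle eq_sym xn0.
have [c _] := @MVT R sin cos 0 x x_gt0 (fun y _ => is_derive_sin y)
  (continuous_subspaceT (@continuous_sin R)).
by rewrite sin0 !subr0 => ->; rewrite normrM ler_piMl// cos_max.
Qed.

(** Bounded functions that converge to the identity and are shifted cosines: they
    bring unbounded factors within reach of the cosine transform. *)
Definition scaled_sin n (x : R) := n.+1%:R * sin (n.+1%:R^-1 * x).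

Lemma scaled_sin_le n x : `|scaled_sin n x| <= `|x|.
Proof.
rewrite /scaled_sin normrM ger0_norm//.
apply: le_trans (ler_wpM2l _ (normr_sin_le _)) _ => //.
by rewrite normrM ger0_norm ?invr_ge0// mulVKf// pnatr_eq0.
Qed.

Lemma scaled_sin_cvg x : scaled_sin n x @[n --> \oo] --> x.
Proof.
have [->|x0] := eqVneq x 0.
  by under eq_fun do rewrite /scaled_sin mulr0 sin0 mulr0; exact: cvg_cst.
have /cvg_ex[/= l Hl] := @derivable_sin R 0.
have l1 : l = 1.
  have <- : 'D_1 (@sin R) 0 = l by apply/cvg_lim => //.
  by rewrite derive_val cos0.
move/cvgr_dnbhsP : Hl => /(_ (fun n => n.+1%:R^-1 * x)) Hl.
have {}Hl : (n.+1%:R^-1 * x)^-1 * sin (n.+1%:R^-1 * x) @[n --> \oo] --> (1 : R).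
  rewrite (_ : (fun n => _) = fun n => (n.+1%:R^-1 * x)^-1 *:
      (sin ((n.+1%:R^-1 * x)%:A + 0) - sin 0)); last first.
    by apply/funext => n; rewrite /GRing.scale/= mulr1 addr0 sin0 subr0.
  rewrite -[X in _ --> X]l1; apply: Hl; split; first by move=> n; rewrite mulf_neq0// invr_eq0 pnatr_eq0.
  rewrite -[X in _ --> X](mul0r x); apply: cvgM; last exact: cvg_cst.
  exact: cvg_harmonic.
rewrite (_ : (fun n => _) = fun n => x * ((n.+1%:R^-1 * x)^-1 * sin (n.+1%:R^-1 * x))); last first.
  by apply/funext => n; rewrite /scaled_sin invfM invrK mulrA mulrCA divff// mulr1.
rewrite -[X in _ --> X]mulr1; apply: cvgM => //; exact: cvg_cst.
Qed.

Lemma measurable_scaled_sin n : measurable_fun setT (scaled_sin n).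
Proof.
apply: measurable_funM => //; apply: measurableT_comp; last exact: measurable_funM.
by apply: continuous_measurable_fun; exact: continuous_sin.
Qed.

End small_sine.

Section normal_moments_theory.
Context d (Omega : measurableType d) (R : realType) (P : probability Omega R).
Implicit Types X Y U V : Omega -> R.

Lemma Rintegral_cst_prob (c : R) : \int[P]_w c = c.
Proof. rewrite Rintegral_cst// -[RHS]mulr1; congr (_ * _).
by rewrite [X in fine X](@probability_setT _ _ _ P). Qed.

Lemma normal_moments_integrable X m v : has_normal_moments P X m v ->
  P.-integrable setT (EFin \o X).
Proof.
case=> iX _ _ _ _.
have := integrableRD (iX 1%N isT) (finite_measure_integrable_cst P m measurableT).
by apply: eq_integrable => // w _; rewrite /= expr1 subrK.
Qed.

Lemma normal_moments_mean X m v : has_normal_moments P X m v -> \int[P]_w X w = m.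
Proof.
move=> NX; have iX := normal_moments_integrable NX; case: NX => _ m0 _ _ _.
apply/eqP; rewrite -subr_eq0 -[X in _ - X]Rintegral_cst_prob -RintegralB ?m0//.
exact: (finite_measure_integrable_cst P m measurableT).
Qed.

Lemma normal_moments_cos X m v b : has_normal_moments P X m v ->
  \int[P]_w cos (X w + b) = cos (m + b) * expR (- (v / 2)).
Proof.
case=> _ _ _ _ <-; apply: eq_Rintegral => w _; congr cos; ring.
Qed.

Lemma integrable_mul_sqr X Y : measurable_fun setT X -> measurable_fun setT Y ->
  P.-integrable setT (EFin \o (fun w => X w ^+ 2)) ->
  P.-integrable setT (EFin \o (fun w => Y w ^+ 2)) ->
  P.-integrable setT (EFin \o (fun w => X w * Y w)).
Proof.
move=> mX mY iX iY; have := integrableRD iX iY; apply: le_integrable => //.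
  by apply/measurable_EFinP; exact: measurable_funM.
move=> w _; rewrite lee_fin; apply: le_trans (ler_norm _).
by rewrite ler_norml; apply/andP; split; nra.
Qed.

(** For two jointly Gaussian variables the variances of the sum and of the
    difference reveal the covariance, so uncorrelated variables have the cosine
    transform of independent ones. *)
Lemma gaussian_uncorrelated_cos U V :
  measurable_fun setT U -> measurable_fun setT V ->
  gaussian_rv P U -> gaussian_rv P V ->
  gaussian_rv P (fun w => U w + V w) -> gaussian_rv P (fun w => U w - V w) ->
  \int[P]_w ((U w - \int[P]_w' U w') * (V w - \int[P]_w' V w')) = 0 ->
  forall b c, \int[P]_w (cos (V w + c) * cos (U w + b)) =
    \int[P]_w cos (V w + c) * \int[P]_w cos (U w + b).
Proof.
move=> mU mV gU gV gp gm cov0 b c.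
have mp : measurable_fun setT (fun w => U w + V w) by exact: measurable_funD.
have mm : measurable_fun setT (fun w => U w - V w) by exact: measurable_funB.
have [mu [vu NU]] := gaussian_rv_moments mU gU.
have [mv [vv NV]] := gaussian_rv_moments mV gV.
have [m1 [v1 Np]] := gaussian_rv_moments mp gp.
have [m2 [v2 Nm]] := gaussian_rv_moments mm gm.
have iU := normal_moments_integrable NU; have iV := normal_moments_integrable NV.
have EU := normal_moments_mean NU; have EV := normal_moments_mean NV.
have m1E : m1 = mu + mv by rewrite -(normal_moments_mean Np) RintegralD// EU EV.
have m2E : m2 = mu - mv by rewrite -(normal_moments_mean Nm) RintegralB// EU EV.
rewrite EU EV in cov0.
have iU2 : P.-integrable setT (EFin \o (fun w => (U w - mu) ^+ 2)) by case: NU => /(_ 2%N isT).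
have iV2 : P.-integrable setT (EFin \o (fun w => (V w - mv) ^+ 2)) by case: NV => /(_ 2%N isT).
have iUV : P.-integrable setT (EFin \o (fun w => (U w - mu) * (V w - mv))).
  by apply: integrable_mul_sqr => //; exact: measurable_funB.
have vuE : \int[P]_w ((U w - mu) ^+ 2) = vu by case: NU.
have vvE : \int[P]_w ((V w - mv) ^+ 2) = vv by case: NV.
have v1E : v1 = vu + vv.
  have <- : \int[P]_w ((U w + V w - m1) ^+ 2) = v1 by case: Np.
  under eq_Rintegral => w _.
    rewrite (_ : _ ^+ 2 = (U w - mu) ^+ 2 + (V w - mv) ^+ 2 + 2 * ((U w - mu) * (V w - mv))); last first.
      by rewrite m1E; ring.
    over.
  rewrite RintegralD//; [|exact: integrableRD|exact: integrableRZ].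
  by rewrite RintegralD// RintegralZl// cov0 mulr0 addr0 vuE vvE.
have v2E : v2 = vu + vv.
  have <- : \int[P]_w ((U w - V w - m2) ^+ 2) = v2 by case: Nm.
  under eq_Rintegral => w _.
    rewrite (_ : _ ^+ 2 = (U w - mu) ^+ 2 + (V w - mv) ^+ 2 + -2 * ((U w - mu) * (V w - mv))); last first.
      by rewrite m2E; ring.
    over.
  rewrite RintegralD//; [|exact: integrableRD|exact: integrableRZ].
  by rewrite RintegralD// RintegralZl// cov0 mulr0 addr0 vuE vvE.
have mcos : measurable_fun setT (@cos R).
  by apply: continuous_measurable_fun; exact: continuous_cos.
have icos X e : measurable_fun setT X -> P.-integrable setT (EFin \o (fun w => cos (X w + e))).
  move=> mX; apply: (@integrable_bounded _ _ _ _ _ 1) => [|w]; last exact: cos_max.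
  by apply: measurableT_comp => //; exact: measurable_funD.
transitivity (2^-1 * (\int[P]_w cos (U w + V w + (b + c)) + \int[P]_w cos (U w - V w + (b - c)))).
  rewrite -RintegralD//; [|exact: icos|exact: icos].
  rewrite -RintegralZl//; last by apply: integrableRD; exact: icos.
  apply: eq_Rintegral => w _.
  have -> : U w + V w + (b + c) = (U w + b) + (V w + c) by ring.
  have -> : U w - V w + (b - c) = (U w + b) - (V w + c) by ring.
  by move: (U w + b) (V w + c) => u v; rewrite cosD cosB; field.
rewrite (normal_moments_cos _ NU) (normal_moments_cos _ NV).
rewrite (normal_moments_cos _ Np) (normal_moments_cos _ Nm).
have -> : m1 + (b + c) = (mu + b) + (mv + c) by rewrite m1E; ring.
have -> : m2 + (b - c) = (mu + b) - (mv + c) by rewrite m2E; ring.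
have -> : - (v1 / 2) = - (vu / 2) - vv / 2 by rewrite v1E; field.
have -> : - (v2 / 2) = - (vu / 2) - vv / 2 by rewrite v2E; field.
rewrite expRD; move: (mu + b) (mv + c) => u v.
by rewrite cosD cosB; field.
Qed.

End normal_moments_theory.

Section independence.
Context d (Omega : measurableType d) (R : realType) (P : probability Omega R).
Variables (n : nat) (X : nat -> Omega -> R) (Y : Omega -> R).
Hypotheses (mX : forall j, measurable_fun setT (X j)) (mY : measurable_fun setT Y).
Hypothesis gauss : forall (a : nat -> R) (e : R),
  gaussian_rv P (fun w => \sum_(j < n) a j * X j w + e * Y w).
Hypothesis cov0 : forall j, (j < n)%N ->
  \int[P]_w ((X j w - \int[P]_w' X j w') * (Y w - \int[P]_w' Y w')) = 0.

Let mlin (a : nat -> R) : measurable_fun setT (fun w => \sum_(j < n) a j * X j w).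
Proof. by apply: measurable_sum => j; exact: measurable_funM. Qed.

Let gauss_lin (a : nat -> R) : gaussian_rv P (fun w => \sum_(j < n) a j * X j w).
Proof. by have := gauss a 0; under eq_fun do rewrite mul0r addr0. Qed.

Let gaussX j : (j < n)%N -> gaussian_rv P (X j).
Proof.
move=> jn; have := gauss_lin (fun k => (k == j)%:R).
under eq_fun => w.
  rewrite (bigD1 (Ordinal jn))//= eqxx mul1r big1 ?addr0; last first.
    by move=> i; rewrite -val_eqE/= => /negbTE ->; rewrite mul0r.
  over.
by [].
Qed.

Let gaussY e : gaussian_rv P (fun w => e * Y w).
Proof.
have := gauss (fun=> 0) e; congr gaussian_rv; apply/funext => w.
by rewrite big1 ?add0r// => i _; rewrite mul0r.
Qed.

Let mcos : measurable_fun setT (@cos R).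
Proof. by apply: continuous_measurable_fun; exact: continuous_cos. Qed.

Lemma uncorrelated_cos (a : nat -> R) e b c :
  \int[P]_w (cos (e * Y w + c) * cos (\sum_(j < n) a j * X j w + b)) =
  \int[P]_w cos (e * Y w + c) * \int[P]_w cos (\sum_(j < n) a j * X j w + b).
Proof.
have meY : measurable_fun setT (fun w => e * Y w) by exact: measurable_funM.
apply: gaussian_uncorrelated_cos => //.
  by have := gauss a (- e); under eq_fun do rewrite mulNr.
have gY1 : gaussian_rv P Y by have := gaussY 1; under eq_fun do rewrite mul1r.
have [mY0 [vY NY]] := gaussian_rv_moments mY gY1.
have NX j : (j < n)%N -> exists m v, has_normal_moments P (X j) m v.
  by move=> jn; exact: gaussian_rv_moments (mX j) (gaussX jn).
have iX j : (j < n)%N -> P.-integrable setT (EFin \o X j).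
  by move=> /NX[m [v /normal_moments_integrable]].
have iaX j : (j < n)%N -> P.-integrable setT (EFin \o (fun w => a j * X j w)).
  by move=> jn; apply: integrableRZ; exact: iX.
have -> : \int[P]_w (\sum_(j < n) a j * X j w) = \sum_(j < n) a j * \int[P]_w X j w.
  rewrite (@Rintegral_sum _ _ _ P n (fun j w => a j * X j w))//.
  by apply: eq_bigr => j _; rewrite RintegralZl//; exact: iX.
have iY := normal_moments_integrable NY.
rewrite RintegralZl// (normal_moments_mean NY).
have icov j : (j < n)%N -> P.-integrable setT
    (EFin \o (fun w => (a j * e) * ((X j w - \int[P]_w' X j w') * (Y w - mY0)))).
  move=> jn; have [m [v NXj]] := NX j jn; rewrite (normal_moments_mean NXj).
  apply: integrableRZ; apply: integrable_mul_sqr => //.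
  - exact: measurable_funB.
  - exact: measurable_funB.
  - by case: NXj => /(_ 2%N isT).
  - by case: NY => /(_ 2%N isT).
under eq_Rintegral => w _.
  rewrite (_ : _ * _ = \sum_(j < n) (a j * e) * ((X j w - \int[P]_w' X j w') * (Y w - mY0))); last first.
    rewrite -sumrB mulr_suml; apply: eq_bigr => j _; ring.
  over.
rewrite (@Rintegral_sum _ _ _ P n (fun j w => (a j * e) * ((X j w - \int[P]_w' X j w') * (Y w - mY0))))//.
rewrite big1// => j _; rewrite RintegralZl//; last first.
  have [m [v NXj]] := NX j (ltn_ord j); rewrite (normal_moments_mean NXj).
  apply: integrable_mul_sqr => //.
  - exact: measurable_funB.
  - exact: measurable_funB.
  - by case: NXj => /(_ 2%N isT).
  - by case: NY => /(_ 2%N isT).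
by have := cov0 (ltn_ord j); rewrite (normal_moments_mean NY) => ->; rewrite mulr0.
Qed.

(** Both sides integrate a bounded weight over a rectangle, so it is enough to
    compare them against cosines of linear combinations; there the vanishing
    covariance makes the factors split. *)
Lemma rectangle_cos_indep (A : nat -> set R) (i : 'I_n) e b c g :
  (forall j, measurable (A j)) ->
  \int[P]_w (cos (e * Y w + c) * cos (g * X i w + b) * \prod_(j < n) \1_(A j) (X j w)) =
  \int[P]_w cos (e * Y w + c) *
    \int[P]_w (cos (g * X i w + b) * \prod_(j < n) \1_(A j) (X j w)).
Proof.
move=> mA; set k := \int[P]_w cos (e * Y w + c).
have mcY : measurable_fun setT (fun w => cos (e * Y w + c)).
  by apply: measurableT_comp => //; apply: measurable_funD => //; exact: measurable_funM.
have mcX : measurable_fun setT (fun w => cos (g * X i w + b)).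
  by apply: measurableT_comp => //; apply: measurable_funD => //; exact: measurable_funM.
have mprod : measurable_fun setT (fun w => \prod_(j < n) \1_(A j) (X j w) : R).
  apply: measurable_prod => j _; exact: measurableT_comp.
have prod1 w : `|\prod_(j < n) \1_(A j) (X j w) : R| <= 1.
  rewrite normr_prod; apply: prodr_ile1 => j _.
  by rewrite normr_ge0/= ger0_norm// indicE; case: (_ \in _).
have ipr : P.-integrable setT (EFin \o (fun w => cos (g * X i w + b) * \prod_(j < n) \1_(A j) (X j w))).
  apply: (@integrable_bounded _ _ _ _ _ 1); first exact: measurable_funM.
  by move=> w; rewrite normrM mulr_ile1// cos_max.
rewrite -RintegralZl//; under [RHS]eq_Rintegral do rewrite mulrA.
have k1 : `|k| <= 1.
  apply: le_trans (le_normr_Rintegral _ _) _ => //.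
    by apply: (@integrable_bounded _ _ _ _ _ 1) => // w; exact: cos_max.
  rewrite -[leRHS](Rintegral_cst_prob P); apply: le_Rintegral => //.
  - apply: (@integrable_bounded _ _ _ _ _ 1) => [|w]; first exact: measurableT_comp.
    by rewrite normr_id cos_max.
  - exact: (finite_measure_integrable_cst P 1 measurableT).
  - by move=> w _; exact: cos_max.
apply: (@cos_determines_rectangles _ _ _ _ _ P P n X X
  (fun w => cos (e * Y w + c) * cos (g * X i w + b))
  (fun w => k * cos (g * X i w + b)) 1) => //.
- exact: measurable_funM.
- exact: measurable_funM.
- by move=> w; rewrite normrM mulr_ile1// cos_max.
- by move=> w; rewrite normrM mulr_ile1// cos_max.
move=> a c'.
pose up s j := a j + s * (j == i :> nat)%:R * g.
have upE s w : \sum_(j < n) up s j * X j w = \sum_(j < n) a j * X j w + s * (g * X i w).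
  under eq_bigr do rewrite /up mulrDl.
  rewrite big_split/=; congr (_ + _); rewrite (bigD1 i)//= eqxx big1 ?addr0; last first.
    by move=> j /negbTE; rewrite -val_eqE/= => ->; rewrite mulr0 !mul0r.
  by rewrite mulr1 mulrA.
have icos (V : Omega -> R) (e' : R) : measurable_fun setT V -> P.-integrable setT (EFin \o (fun w => cos (V w + e') : R)).
  move=> mV; apply: (@integrable_bounded _ _ _ _ _ 1) => [|w]; last exact: cos_max.
  by apply: measurableT_comp => //; exact: measurable_funD.
have icoscos (V : Omega -> R) (e' : R) : measurable_fun setT V ->
    P.-integrable setT (EFin \o (fun w => cos (e * Y w + c) * cos (V w + e') : R)).
  move=> mV; apply: (@integrable_bounded _ _ _ _ _ 1) => [|w].
    by apply: measurable_funM => //; apply: measurableT_comp => //; exact: measurable_funD.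
  by rewrite normrM mulr_ile1// cos_max.
have cosM w : cos (g * X i w + b) * cos (\sum_(j < n) a j * X j w + c') =
   2^-1 * (cos (\sum_(j < n) up 1 j * X j w + (b + c')) +
           cos (\sum_(j < n) up (-1) j * X j w + (c' - b))).
  rewrite !upE mul1r mulN1r.
  have -> : \sum_(j < n) a j * X j w + g * X i w + (b + c') =
    (\sum_(j < n) a j * X j w + c') + (g * X i w + b) by ring.
  have -> : \sum_(j < n) a j * X j w - g * X i w + (c' - b) =
    (\sum_(j < n) a j * X j w + c') - (g * X i w + b) by ring.
  by move: (_ + c') (g * X i w + b) => u v; rewrite cosD cosB; field.
transitivity (2^-1 * (\int[P]_w (cos (e * Y w + c) * cos (\sum_(j < n) up 1 j * X j w + (b + c'))) +
   \int[P]_w (cos (e * Y w + c) * cos (\sum_(j < n) up (-1) j * X j w + (c' - b))))).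
  rewrite -RintegralD//; [|exact: icoscos|exact: icoscos].
  rewrite -RintegralZl//; last by apply: integrableRD; exact: icoscos.
  by apply: eq_Rintegral => w _; rewrite -mulrA cosM; ring.
rewrite !uncorrelated_cos -/k -mulrDr mulrCA.
rewrite -RintegralD//; [|exact: icos|exact: icos].
rewrite -RintegralZl//; last by apply: integrableRD; exact: icos.
rewrite -RintegralZl//; last by apply/integrableRZ/integrableRD; exact: icos.
by apply: eq_Rintegral => w _; rewrite -[in RHS]mulrA cosM.
Qed.

Variables (A : nat -> set R) (i : 'I_n) (C : R).
Hypotheses (mA : forall j, measurable (A j)) (C0 : 0 <= C) (AC : forall x, A i x -> `|x| <= C).
Let ind w : R := \prod_(j < n) \1_(A j) (X j w).

Let mind : measurable_fun setT ind.
Proof. by apply: measurable_prod => j _; exact: measurableT_comp. Qed.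

Let ind01 w : 0 <= ind w <= 1.
Proof.
rewrite prodr_ge0/=; last by move=> j _; rewrite indicE.
by apply: prodr_ile1 => j _; rewrite indicE; case: (_ \in _); rewrite ?lexx ?ler01.
Qed.

Let ind_le1 w : `|ind w| <= 1.
Proof. by have /andP[i0 i1] := ind01 w; rewrite ger0_norm. Qed.

Let XindC w : `|X i w * ind w| <= C.
Proof.
have [Ax|nAx] := pselect (A i (X i w)).
  by rewrite normrM (le_trans _ (AC Ax))// ler_piMr.
by rewrite /ind (bigD1 i)//= indicE memNset//= mul0r mulr0 normr0.
Qed.

Let iY : P.-integrable setT (EFin \o Y).
Proof.
have gY1 : gaussian_rv P Y by have := gaussY 1; under eq_fun do rewrite mul1r.
by have [mY0 [vY NY]] := gaussian_rv_moments mY gY1; exact: normal_moments_integrable NY.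
Qed.

Let iY2 : P.-integrable setT (EFin \o (fun w => Y w ^+ 2)).
Proof.
have gY1 : gaussian_rv P Y by have := gaussY 1; under eq_fun do rewrite mul1r.
have [m [v NY]] := gaussian_rv_moments mY gY1.
have iY' := normal_moments_integrable NY; case: NY => /(_ 2%N isT) iYm _ _ _ _.
have := integrableRD (integrableRD iYm (integrableRZ (2 * m) iY'))
  (finite_measure_integrable_cst P (- m ^+ 2) measurableT).
by apply: eq_integrable => // w _; congr EFin => /=; ring.
Qed.

Let iind (f : Omega -> R) : P.-integrable setT (EFin \o f) ->
  P.-integrable setT (EFin \o (fun w => f w * ind w)).
Proof.
move=> intf; apply: le_integrable (intf) => //.
  by apply/measurable_EFinP/measurable_funM => //; apply/measurable_EFinP; case/integrableP: intf.
by move=> w _; rewrite lee_fin normrM ler_piMr.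
Qed.

Let scaled_sinE m (y : R) : scaled_sin m y = m.+1%:R * cos (m.+1%:R^-1 * y + - (pi / 2)).
Proof. by rewrite cosBpihalf. Qed.

Let mscaled m (f : Omega -> R) : measurable_fun setT f -> measurable_fun setT (fun w : Omega => scaled_sin m (f w)).
Proof. by move=> mf; apply: measurableT_comp => //; exact: measurable_scaled_sin. Qed.

Let iscaled m (f : Omega -> R) : measurable_fun setT f ->
  P.-integrable setT (EFin \o (fun w : Omega => scaled_sin m (f w))).
Proof.
move=> mf; apply: (@integrable_bounded _ _ _ _ _ m.+1%:R) => [|w]; first exact: mscaled.
by rewrite /scaled_sin normrM ger0_norm// ler_piMr// sin_max.
Qed.

Let iprod (f : Omega -> R) : measurable_fun setT f -> (forall w, `|f w| <= 1) ->
  P.-integrable setT (EFin \o f).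
Proof. by move=> mf f1; exact: (@integrable_bounded _ _ _ _ _ 1). Qed.

(** The cosine version for [scaled_sin m (Y w)] passes to the limit by dominated
    convergence.  The two lemmas that follow have the same proof, the square
    being handled through [sin z ^ 2 = (1 - cos (2 z)) / 2]. *)
Lemma rectangle_mean_indep :
  \int[P]_w (Y w * ind w) = \int[P]_w Y w * \int[P]_w ind w.
Proof.
have E m : \int[P]_w (scaled_sin m (Y w) * ind w) =
    \int[P]_w scaled_sin m (Y w) * \int[P]_w ind w.
  have := rectangle_cos_indep i m.+1%:R^-1 0 (- (pi / 2)) 0 mA.
  have -> : (fun w => cos (m.+1%:R^-1 * Y w + - (pi / 2)) * cos (0 * X i w + 0) * \prod_(j < n) \1_(A j) (X j w)) =
     (fun w => m.+1%:R^-1 * (scaled_sin m (Y w) * ind w)).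
    by apply/funext => w; rewrite scaled_sinE mul0r addr0 cos0 mulr1 -mulrA mulKf.
  have -> : (fun w => cos (m.+1%:R^-1 * Y w + - (pi / 2))) = (fun w => m.+1%:R^-1 * scaled_sin m (Y w)).
    by apply/funext => w; rewrite scaled_sinE mulKf.
  have -> : (fun w => cos (0 * X i w + 0) * \prod_(j < n) \1_(A j) (X j w)) = ind.
    by apply/funext => w; rewrite mul0r addr0 cos0 mul1r.
  rewrite RintegralZl//; last by apply: iind; exact: iscaled.
  rewrite RintegralZl//; last exact: iscaled.
  by rewrite -mulrA => /(congr1 ( *%R m.+1%:R)); rewrite !mulVKf.
have l1 : \int[P]_w (scaled_sin m (Y w) * ind w) @[m --> \oo] --> \int[P]_w (Y w * ind w).
  apply: (@Rintegral_dominated_cvg _ _ _ P _ _ (fun w => `|Y w|)).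
  - by move=> m; apply: measurable_funM => //; exact: mscaled.
  - by move=> w; apply: cvgM; [exact: scaled_sin_cvg|exact: cvg_cst].
  - exact: integrable_norm.
  - by move=> m w; rewrite normrM (le_trans _ (scaled_sin_le m (Y w)))// ler_piMr.
have l2 : \int[P]_w (scaled_sin m (Y w) * ind w) @[m --> \oo] -->
    \int[P]_w Y w * \int[P]_w ind w.
  rewrite (funext E); apply: cvgM; last exact: cvg_cst.
  apply: (@Rintegral_dominated_cvg _ _ _ P _ _ (fun w => `|Y w|)).
  - by move=> m; exact: mscaled.
  - by move=> w; exact: scaled_sin_cvg.
  - exact: integrable_norm.
  - by move=> m w; exact: scaled_sin_le.
exact: (cvg_unique _ l1 l2).
Qed.

Lemma rectangle_cross_indep :
  \int[P]_w (Y w * (X i w * ind w)) = \int[P]_w Y w * \int[P]_w (X i w * ind w).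
Proof.
have E m : \int[P]_w (scaled_sin m (Y w) * (scaled_sin m (X i w) * ind w)) =
    \int[P]_w scaled_sin m (Y w) * \int[P]_w (scaled_sin m (X i w) * ind w).
  have := rectangle_cos_indep i m.+1%:R^-1 (- (pi / 2)) (- (pi / 2)) m.+1%:R^-1 mA.
  have -> : (fun w => cos (m.+1%:R^-1 * Y w + - (pi / 2)) * cos (m.+1%:R^-1 * X i w + - (pi / 2)) * \prod_(j < n) \1_(A j) (X j w)) =
     (fun w => (m.+1%:R^-1 * m.+1%:R^-1) * (scaled_sin m (Y w) * (scaled_sin m (X i w) * ind w))).
    apply/funext => w; rewrite !scaled_sinE /ind; set k := m.+1%:R.
    have k0 : k != 0 by rewrite pnatr_eq0.
    by clearbody k; field.
  have -> : (fun w => cos (m.+1%:R^-1 * Y w + - (pi / 2))) = (fun w => m.+1%:R^-1 * scaled_sin m (Y w)).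
    by apply/funext => w; rewrite scaled_sinE mulKf.
  have -> : (fun w => cos (m.+1%:R^-1 * X i w + - (pi / 2)) * \prod_(j < n) \1_(A j) (X j w)) =
      (fun w => m.+1%:R^-1 * (scaled_sin m (X i w) * ind w)).
    by apply/funext => w; rewrite scaled_sinE -mulrA mulKf.
  rewrite RintegralZl//; last first.
    have s_le (z : R) : `|scaled_sin m z| <= m.+1%:R.
      by rewrite /scaled_sin normrM ger0_norm// ler_piMr// sin_max.
    apply: (@integrable_bounded _ _ _ _ _ (m.+1%:R * m.+1%:R)) => [|w].
      by apply: measurable_funM; [exact: mscaled|apply: measurable_funM => //; exact: mscaled].
    by rewrite normrM ler_pM// normrM (le_trans _ (s_le (X i w)))// ler_piMr.
  rewrite RintegralZl//; last exact: iscaled.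
  rewrite [X in _ = _ * X -> _]RintegralZl//; last exact: (iind (iscaled m (mX i))).
  rewrite mulrACA => /(congr1 ( *%R (m.+1%:R * m.+1%:R))).
  by rewrite -!invfM !mulVKf// mulf_neq0.
have scaled_ind_le m w : `|scaled_sin m (X i w) * ind w| <= `|X i w * ind w|.
  by rewrite (normrM (scaled_sin _ _)) (normrM (X i w)) ler_wpM2r// scaled_sin_le.
have l0 : \int[P]_w (scaled_sin m (X i w) * ind w) @[m --> \oo] --> \int[P]_w (X i w * ind w).
  apply: (@Rintegral_dominated_cvg _ _ _ P _ _ (cst C)).
  - by move=> m; apply: measurable_funM => //; exact: mscaled.
  - by move=> w; apply: cvgM; [exact: scaled_sin_cvg|exact: cvg_cst].
  - exact: (finite_measure_integrable_cst P C measurableT).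
  - by move=> m w; rewrite (le_trans _ (XindC w))// scaled_ind_le.
have l1 : \int[P]_w (scaled_sin m (Y w) * (scaled_sin m (X i w) * ind w)) @[m --> \oo] -->
    \int[P]_w (Y w * (X i w * ind w)).
  apply: (@Rintegral_dominated_cvg _ _ _ P _ _ (fun w => C * `|Y w|)).
  - by move=> m; apply: measurable_funM; [exact: mscaled|apply: measurable_funM => //; exact: mscaled].
  - move=> w; apply: cvgM; first exact: scaled_sin_cvg.
    by apply: cvgM; [exact: scaled_sin_cvg|exact: cvg_cst].
  - by apply: integrableRZ; exact: integrable_norm.
  - move=> m w; rewrite (normrM (scaled_sin _ _)) [leRHS]mulrC ler_pM ?scaled_sin_le//.
    by rewrite (le_trans _ (XindC w))// scaled_ind_le.
have l2 : \int[P]_w (scaled_sin m (Y w) * (scaled_sin m (X i w) * ind w)) @[m --> \oo] -->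
    \int[P]_w Y w * \int[P]_w (X i w * ind w).
  rewrite (funext E); apply: cvgM => //.
  apply: (@Rintegral_dominated_cvg _ _ _ P _ _ (fun w => `|Y w|)).
  - by move=> m; exact: mscaled.
  - by move=> w; exact: scaled_sin_cvg.
  - exact: integrable_norm.
  - by move=> m w; exact: scaled_sin_le.
exact: (cvg_unique _ l1 l2).
Qed.

Lemma rectangle_sqr_indep :
  \int[P]_w (Y w ^+ 2 * ind w) = \int[P]_w (Y w ^+ 2) * \int[P]_w ind w.
Proof.
have E m : \int[P]_w (scaled_sin m (Y w) ^+ 2 * ind w) =
    \int[P]_w (scaled_sin m (Y w) ^+ 2) * \int[P]_w ind w.
  have := rectangle_cos_indep i (2 * m.+1%:R^-1) 0 0 0 mA.
  pose k : R := m.+1%:R ^+ 2 / 2.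
  have sq y : scaled_sin m y ^+ 2 = k * (1 - cos (2 * m.+1%:R^-1 * y + 0)).
    have -> : 2 * m.+1%:R^-1 * y + 0 = (m.+1%:R^-1 * y) *+ 2.
      by rewrite addr0 -(mulr_natl (_ * y)) mulrA.
    by rewrite /scaled_sin cos_mulr2n cos2sin2 /k -(mulr_natl (1 - _)); field.
  have mc : measurable_fun setT (fun w => cos (2 * m.+1%:R^-1 * Y w + 0)).
    by apply: measurableT_comp => //; apply: measurable_funD => //; exact: measurable_funM.
  have ic := iprod mc (fun w => cos_max _).
  have -> : (fun w => cos (2 * m.+1%:R^-1 * Y w + 0) * cos (0 * X i w + 0) * \prod_(j < n) \1_(A j) (X j w)) =
     (fun w => cos (2 * m.+1%:R^-1 * Y w + 0) * ind w).
    by apply/funext => w; rewrite mul0r !addr0 cos0 mulr1.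
  have -> : (fun w => cos (0 * X i w + 0) * \prod_(j < n) \1_(A j) (X j w)) = ind.
    by apply/funext => w; rewrite mul0r addr0 cos0 mul1r.
  move=> E.
  under eq_Rintegral do rewrite sq -mulrA mulrBl mul1r.
  under [X in _ = X * _]eq_Rintegral do rewrite sq.
  have i1 : P.-integrable setT (EFin \o (fun=> 1 : R)).
    exact: (finite_measure_integrable_cst P 1 measurableT).
  rewrite RintegralZl//; last by apply: integrableRB; [exact: iprod|exact: iind].
  rewrite RintegralZl//; last exact: integrableRB.
  rewrite !RintegralB//; [|exact: iprod|exact: iind].
  by rewrite E Rintegral_cst_prob; ring.
have l1 : \int[P]_w (scaled_sin m (Y w) ^+ 2 * ind w) @[m --> \oo] --> \int[P]_w (Y w ^+ 2 * ind w).
  apply: (@Rintegral_dominated_cvg _ _ _ P _ _ (fun w => Y w ^+ 2)) => //.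
  - by move=> m; apply: measurable_funM => //; apply: measurable_funX; exact: mscaled.
  - move=> w; apply: cvgM; last exact: cvg_cst.
    by under eq_fun do rewrite expr2; rewrite expr2; apply: cvgM; exact: scaled_sin_cvg.
  - move=> m w; rewrite normrM -[Y w ^+ 2]ger0_norm ?sqr_ge0//.
    by rewrite (le_trans _ (_ : `|scaled_sin m (Y w) ^+ 2| <= _)) ?ler_piMr// !normrX lerXn2r ?nnegrE// scaled_sin_le.
have l2 : \int[P]_w (scaled_sin m (Y w) ^+ 2 * ind w) @[m --> \oo] -->
    \int[P]_w (Y w ^+ 2) * \int[P]_w ind w.
  rewrite (funext E); apply: cvgM; last exact: cvg_cst.
  apply: (@Rintegral_dominated_cvg _ _ _ P _ _ (fun w => Y w ^+ 2)) => //.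
  - by move=> m; apply: measurable_funX; exact: mscaled.
  - move=> w.
    by under eq_fun do rewrite expr2; rewrite expr2; apply: cvgM; exact: scaled_sin_cvg.
  - move=> m w; rewrite -[Y w ^+ 2]ger0_norm ?sqr_ge0//.
    by rewrite !normrX lerXn2r ?nnegrE// scaled_sin_le.
exact: (cvg_unique _ l1 l2).
Qed.

End independence.

(** * Laws of paths and the hitting event *)

Section path_law.
Context {R : realType}.

Definition cylinder (I : set R) : set (set (R -> R)) :=
  [set S | exists n (t : nat -> R) (A : nat -> set R),
    [/\ forall j, I (t j), forall j, measurable (A j) &
        S = [set f | forall j, (j < n)%N -> A j (f (t j))]]].

Lemma cylinder_setI_closed (I : set R) : setI_closed (cylinder I).
Proof.
move=> _ _ [n [t [A [It mA ->]]]] [n' [t' [A' [It' mA' ->]]]].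
exists (n + n')%N, (fun j => if (j < n)%N then t j else t' (j - n)%N),
  (fun j => if (j < n)%N then A j else A' (j - n)%N); split.
- by move=> j; case: ifP.
- by move=> j; case: ifP.
- apply/seteqP; split => f /=.
    move=> [fA fA'] j jn; case: ltnP => nj; first exact: fA.
    by apply: fA'; rewrite ltn_subLR.
  move=> fA; split => j jn.
    by have := fA j (leq_trans jn (leq_addr _ _)); rewrite jn.
  by have := fA (n + j)%N; rewrite ltn_add2l jn ltnNge leq_addr/= addKn => /(_ isT).
Qed.

Lemma measurable_coordinate (I : set R) (t : R) : I t ->
  measurable_fun [set: g_sigma_algebraType (cylinder I)]
    ((fun f => f t) : g_sigma_algebraType (cylinder I) -> R).
Proof.
move=> It _ A mA; rewrite setTI; apply: sub_sigma_algebra.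
exists 1%N, (fun=> t), (fun=> A); split => //.
apply/seteqP; split => f /=; first by move=> fA j _.
by move=> /(_ 0%N isT).
Qed.

Context d (T : measurableType d) (X : R -> T -> R) (I : set R).
Hypothesis mX : forall t, measurable_fun setT (X t).

Lemma measurable_path_event (S : set (R -> R)) : <<s cylinder I >> S ->
  measurable [set w | S (fun t => X t w)].
Proof.
suff : <<s cylinder I >> `<=` [set S | measurable [set w | S (fun t => X t w)]] by exact.
apply: smallest_sub; first split => /=.
  - exact: measurable0.
  - move=> A mA; rewrite (_ : [set w | _] = ~` [set w | A (fun t => X t w)]).
      exact: measurableC.
    by apply/seteqP; split => w /= => [[]|].
  - move=> F mF.
    rewrite (_ : [set w | _] = \bigcup_k [set w | F k (fun t => X t w)])//.
    exact: bigcupT_measurable.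
move=> _ [n [t [A [It mA ->]]]] /=.
rewrite (_ : [set w | _] = \bigcap_(j in `I_n) (X (t j) @^-1` A j)); last first.
  by apply/seteqP; split => w /= H j jn; exact: H.
apply: bigcap_measurableType => j _; rewrite -[_ @^-1` _]setTI; exact: mX.
Qed.

End path_law.

Section path_law_unique.
Context (R : realType) d1 d2 (T1 : measurableType d1) (T2 : measurableType d2).
Variables (P1 : probability T1 R) (P2 : probability T2 R).
Variables (X1 : R -> T1 -> R) (X2 : R -> T2 -> R) (I : set R).
Hypotheses (mX1 : forall t, measurable_fun setT (X1 t)).
Hypotheses (mX2 : forall t, measurable_fun setT (X2 t)).

Lemma Rintegral_rectangle d (T : measurableType d) (P : probability T R)
    n (X : nat -> T -> R) (A : nat -> set R) :
  (forall j, measurable_fun setT (X j)) -> (forall j, measurable (A j)) ->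
  \int[P]_w (\prod_(j < n) \1_(A j) (X j w)) =
  fine (P [set w | forall j, (j < n)%N -> A j (X j w)]).
Proof.
move=> mX mA; rewrite /Rintegral.
rewrite (_ : (fun w => _) = (fun w => (\1_[set w | forall j, (j < n)%N -> A j (X j w)] w)%:E)).
  rewrite integral_indic//= ?setIT//.
  rewrite (_ : [set w | _] = \bigcap_(j in `I_n) (X j @^-1` A j)); last first.
    by apply/seteqP; split => w /= H j jn; exact: H.
  apply: bigcap_measurableType => j _; rewrite -[_ @^-1` _]setTI; exact: mX.
apply/funext => w; congr EFin; rewrite indicE.
have [H|H] := pselect (forall j, (j < n)%N -> A j (X j w)).
  rewrite mem_set// big1// => j _; rewrite indicE mem_set//.
  exact: H.
rewrite memNset//; move/existsNP : H => [j /not_implyP[jn nA]].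
by rewrite (bigD1 (Ordinal jn))//= indicE memNset// mul0r.
Qed.

Hypothesis same_cos : forall n (t : nat -> R) (a : nat -> R) c, (forall j, I (t j)) ->
  \int[P1]_w cos (\sum_(j < n) a j * X1 (t j) w + c) =
  \int[P2]_w cos (\sum_(j < n) a j * X2 (t j) w + c).

(** Cosine transforms determine the probabilities of cylinders, and cylinders are
    closed under intersection. *)
Lemma path_law_unique (S : set (R -> R)) : <<s cylinder I >> S ->
  P1 [set w | S (fun t => X1 t w)] = P2 [set w | S (fun t => X2 t w)].
Proof.
pose p1 (S : set (R -> R)) := [set w | S (fun t => X1 t w)].
pose p2 (S : set (R -> R)) := [set w | S (fun t => X2 t w)].
have m1 A : <<s cylinder I >> A -> measurable (p1 A) by exact: measurable_path_event.
have m2 A : <<s cylinder I >> A -> measurable (p2 A) by exact: measurable_path_event.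
apply: (@dynkin_induction _ (g_sigma_algebraType (cylinder I)) (cylinder I)
  (fun S => P1 (p1 S) = P2 (p2 S))) => //.
- exact: cylinder_setI_closed.
- by rewrite (_ : p1 _ = setT)// (_ : p2 _ = setT)// !probability_setT.
- move=> _ [n [t [A [It mA ->]]]].
  have sG : <<s cylinder I >> [set f | forall j, (j < n)%N -> A j (f (t j))].
    by apply: sub_sigma_algebra; exists n, t, A.
  rewrite -[LHS]fineK ?fin_num_measure//; last exact: m1.
  rewrite -[RHS]fineK ?fin_num_measure//; last exact: m2.
  congr EFin; rewrite -(@Rintegral_rectangle _ _ P1 n (X1 \o t))//; last by move=> j; exact: mX1.
  rewrite -(@Rintegral_rectangle _ _ P2 n (X2 \o t))//; last by move=> j; exact: mX2.
  have one T (P : T -> R) : P = (fun w => 1 * P w) by apply/funext => w; rewrite mul1r.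
  rewrite (one _ (fun w => \prod_(j < n) _)) [in RHS](one _ (fun w => \prod_(j < n) _)).
  apply: (@cos_determines_rectangles _ _ _ _ _ P1 P2 n (X1 \o t) (X2 \o t)
    (cst 1) (cst 1) 1) => //.
  - by move=> j; exact: mX1.
  - by move=> j; exact: mX2.
  - by move=> w; rewrite normr1.
  - by move=> w; rewrite normr1.
  - move=> a c; have := same_cos n a c It; rewrite /=.
    by under [X in _ -> X = _]eq_Rintegral do rewrite mul1r; under [X in _ -> _ = X]eq_Rintegral do rewrite mul1r.
- move=> A mA H.
  rewrite (_ : p1 _ = ~` p1 A)// (_ : p2 _ = ~` p2 A)//.
  by rewrite !probability_setC ?H//; [exact: m2|exact: m1].
- move=> F mF tF H.
  rewrite (_ : p1 _ = \bigcup_k p1 (F k))// (_ : p2 _ = \bigcup_k p2 (F k))//.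
  have tp1 : trivIset [set: nat] (fun k => p1 (F k)).
    apply/trivIsetP => i j _ _ ij; move/trivIsetP : tF => /(_ i j Logic.I Logic.I ij) Fij.
    by apply/seteqP; split => // w [Fi Fj]; have : (F i `&` F j) (X1^~ w) by []; rewrite Fij.
  have tp2 : trivIset [set: nat] (fun k => p2 (F k)).
    apply/trivIsetP => i j _ _ ij; move/trivIsetP : tF => /(_ i j Logic.I Logic.I ij) Fij.
    by apply/seteqP; split => // w [Fi Fj]; have : (F i `&` F j) (X2^~ w) by []; rewrite Fij.
  have mp1 k : measurable (p1 (F k)) := m1 _ (mF k).
  have mp2 k : measurable (p2 (F k)) := m2 _ (mF k).
  rewrite measure_bigcup// [RHS]measure_bigcup//.
  by apply: eq_eseriesr => k _; exact: H.
Qed.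

End path_law_unique.

Section hitting_event.
Context {R : realType}.
Variables (l : R) (u v : R -> R).
Hypotheses (l0 : 0 < l) (cu : continuous u) (cv : continuous v).
Hypotheses (u0 : forall x, 0 <= u x) (v0 : forall x, 0 <= v x).

Definition grid_time i j : R := l * i%:R / j.+1%:R.

Lemma grid_time_itv i j : (i <= j.+1)%N -> 0 <= grid_time i j <= l.
Proof.
move=> ij; rewrite /grid_time divr_ge0 ?mulr_ge0 ?(ltW l0)//=.
by rewrite ler_pdivrMr// ler_pM2l// ler_nat.
Qed.

Lemma grid_time_approx (t e : R) : 0 <= t <= l -> 0 < e ->
  exists i j, [/\ (i <= j.+1)%N, grid_time i j <= t & t - e < grid_time i j].
Proof.
move=> /andP[t0 tl] e0.
pose j := Num.truncn (l / e); pose i := Num.truncn (t * j.+1%:R / l).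
have tj0 : 0 <= t * j.+1%:R / l by rewrite divr_ge0 ?mulr_ge0 ?(ltW l0).
have /andP[il ir] := truncn_itv tj0; rewrite -/i in il ir.
have jl : l < e * j.+1%:R by rewrite mulrC -ltr_pdivrMr//; exact: truncnS_gt.
exists i, j; split.
- rewrite -(ler_nat R) (le_trans il)// ler_pdivrMr// mulrC ler_pM2l//.
- by rewrite /grid_time ler_pdivrMr// mulrC -ler_pdivlMr.
- rewrite /grid_time ltr_pdivlMr// mulrBl.
  by move: ir; rewrite ltr_pdivrMr// -(natr1 i) => ir; lra.
Qed.

Lemma within_continuous_eps (f : R -> R) : {within `[0, l], continuous f} ->
  forall t e, 0 <= t <= l -> 0 < e ->
  exists2 del, 0 < del & forall s, 0 <= s <= l -> `|t - s| < del -> `|f t - f s| < e.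
Proof.
move=> /subspace_continuousP cf t e tl e0.
have /cvgrPdist_lt /(_ e e0) : f @ within `[0, l] (nbhs t) --> f t.
  by apply: cf; rewrite /= in_itv.
rewrite near_withinE => /nbhs_ballP[del /= del0 Hdel]; exists del => // s sl ts.
by apply: Hdel; rewrite /= ?in_itv.
Qed.

(** The path avoids the closed set [v = 0] up to the hitting time exactly when
    [v] has a positive lower bound along it, by compactness.  Such a bound, and
    the approach of [u] to 0, can be tested on a countable dense set of times. *)
Lemma hits_beforeP (f : R -> R) : {within `[0, l], continuous f} ->
  hits_before l f [set x | u x = 0] [set x | v x = 0] <->
  exists m : nat, forall n : nat, exists i j, [/\ (i <= j.+1)%N,
    u (f (grid_time i j)) < n.+1%:R^-1 &
    forall i' j', (i' <= j'.+1)%N -> grid_time i' j' <= grid_time i j ->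
      m.+1%:R^-1 <= v (f (grid_time i' j'))].
Proof.
move=> cf.
have cuf : {within `[0, l], continuous (u \o f)}.
  by apply: within_continuous_comp; [move=> x _; exact: cu|exact: cf].
have cvf : {within `[0, l], continuous (v \o f)}.
  by apply: within_continuous_comp; [move=> x _; exact: cv|exact: cf].
have sub (t : R) : t <= l -> `[0, t]%classic `<=` `[0, l]%classic.
  by move=> tl s /=; rewrite !in_itv/= => /andP[-> st]; rewrite (le_trans st).
split=> [[t [/andP[t0 tl] uft vf]]|[m H]].
  have [c] := EVT_min t0 (continuous_subspaceW (sub t tl) cvf).
  rewrite in_itv/= => c0t cmin.
  have vc : 0 < v (f c) by rewrite lt_neqAle v0 andbT eq_sym; apply/eqP; exact: vf.
  exists (Num.truncn (v (f c))^-1) => n.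
  have t0l : 0 <= t <= l by rewrite t0.
  have n0 : 0 < n.+1%:R^-1 :> R by rewrite invr_gt0.
  have [del del0 Hdel] := within_continuous_eps cuf t0l n0.
  have [i [j [ij gt tg]]] := grid_time_approx t0l del0.
  exists i, j; split => //.
    have near_t : `|t - grid_time i j| < del by rewrite ger0_norm ?subr_ge0//; lra.
    have := Hdel _ (grid_time_itv ij) near_t.
    by rewrite /= (uft : u (f t) = 0) sub0r normrN ger0_norm.
  move=> i' j' ij' gg; apply: (@le_trans _ _ (v (f c))).
    rewrite -[leRHS]invrK lef_pV2 ?posrE ?invr_gt0//.
    by apply/ltW/truncnS_gt.
  apply: cmin; rewrite in_itv/= (le_trans gg gt) andbT.
  by have /andP[] := grid_time_itv ij'.
set c : R := m.+1%:R^-1 in H.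
have c0 : 0 < c by rewrite invr_gt0.
pose K := [set s | 0 <= s <= l /\ forall s', 0 <= s' <= s -> c <= v (f s')].
have KH n : exists2 g, K g & u (f g) < n.+1%:R^-1.
  have [i [j [ij ug vg]]] := H n; exists (grid_time i j) => //.
  have /andP[g0 gl] := grid_time_itv ij.
  split => [|s' /andP[s0 sg]]; first by rewrite g0.
  rewrite leNgt; apply/negP => vs.
  have s0l : 0 <= s' <= l by rewrite s0 (le_trans sg).
  have vs0 : 0 < c - v (f s') by rewrite subr_gt0.
  have [del del0 Hdel] := within_continuous_eps cvf s0l vs0.
  have [i' [j' [ij' gs sg']]] := grid_time_approx s0l del0.
  have near_s : `|s' - grid_time i' j'| < del by rewrite ger0_norm ?subr_ge0//; lra.
  have := Hdel _ (grid_time_itv ij') near_s; have := vg _ _ ij' (le_trans gs sg).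
  by rewrite /= ltr_norml => vg' /andP[]; lra.
have Kub s : K s -> s <= l by case=> /andP[].
have supK : has_sup K.
  by have [g Kg _] := KH 0%N; split; [exists g|exists l => s; exact: Kub].
pose T := sup K.
have T0 : 0 <= T.
  have [g Kg _] := KH 0%N; apply: (@le_trans _ _ g); first by case: Kg => /andP[].
  by apply: ub_le_sup => //; case: supK.
have Tl : T <= l by apply: ge_sup; [case: supK|move=> s; exact: Kub].
have vT s : 0 <= s <= T -> c <= v (f s).
  move=> /andP[s0 sT]; rewrite leNgt; apply/negP => vs.
  have s0l : 0 <= s <= l by rewrite s0 (le_trans sT).
  have vs0 : 0 < c - v (f s) by rewrite subr_gt0.
  have [del del0 Hdel] := within_continuous_eps cvf s0l vs0.
  have [k Kk Tk] := sup_adherent del0 supK; rewrite -/T in Tk.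
  have kT : k <= T by apply: ub_le_sup => //; case: supK.
  case: Kk => k0l Kk.
  have [sk|ks] := leP s k.
    by have := Kk s; rewrite s0 sk leNgt vs => /(_ isT).
  have near_s : `|s - k| < del by rewrite gtr0_norm ?subr_gt0//; lra.
  have := Hdel k k0l near_s; have := Kk k; rewrite lexx.
  case/andP : k0l => -> _ => /(_ isT) vk.
  by rewrite /= ltr_norml => /andP[]; lra.
have [t1] := EVT_min T0 (continuous_subspaceW (sub T Tl) cuf).
rewrite in_itv/= => /andP[t10 t1T] t1min; exists t1; split.
- by rewrite t10 (le_trans t1T).
- rewrite /=; have [//|ut1] := eqVneq (u (f t1)) 0.
  have {}ut1 : 0 < u (f t1) by rewrite lt_neqAle eq_sym ut1 u0.
  have [g Kg ug] := KH (Num.truncn (u (f t1))^-1).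
  have gT : g <= T by apply: ub_le_sup => //; case: supK.
  have := t1min g; rewrite in_itv/= gT andbT.
  case: Kg => /andP[-> _] _ => /(_ isT) /le_lt_trans /(_ ug).
  rewrite ltNge => /negP[]; rewrite -[leRHS]invrK lef_pV2 ?posrE ?invr_gt0//.
  exact/ltW/truncnS_gt.
- move=> s /andP[s0 st1] /= vs; have := vT s.
  by rewrite s0 (le_trans st1 t1T) vs leNgt c0 => /(_ isT).
Qed.

End hitting_event.

Section hitting_event_measurable.
Context {R : realType}.
Variables (l : R) (u v : R -> R).
Hypotheses (l0 : 0 < l) (cu : continuous u) (cv : continuous v).

Lemma measurable_grid_event : <<s cylinder `[0, l] >> [set f : R -> R |
  exists m : nat, forall n : nat, exists i j, [/\ (i <= j.+1)%N,
    u (f (grid_time l i j)) < n.+1%:R^-1 &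
    forall i' j', (i' <= j'.+1)%N -> grid_time l i' j' <= grid_time l i j ->
      m.+1%:R^-1 <= v (f (grid_time l i' j'))]].
Proof.
pose T := g_sigma_algebraType (cylinder `[0, l]).
have mcoord (g : R -> R) (i j : nat) (B : set R) : continuous g -> measurable B ->
    (i <= j.+1)%N -> measurable ([set f | B (g (f (grid_time l i j)))] : set T).
  move=> cg mB ij.
  have := @measurable_coordinate R `[0, l] (grid_time l i j) _ measurableT (g @^-1` B).
  rewrite setTI; apply; first by rewrite /= in_itv/=; exact: grid_time_itv.
  by rewrite -[g @^-1` B]setTI; apply: continuous_measurable_fun.
pose S1 n i j : set T := [set f | (i <= j.+1)%N /\ u (f (grid_time l i j)) < n.+1%:R^-1].
pose S2 m i j i' j' : set T := [set f | (i' <= j'.+1)%N ->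
  grid_time l i' j' <= grid_time l i j -> m.+1%:R^-1 <= v (f (grid_time l i' j'))].
have mS1 n i j : measurable (S1 n i j).
  have [ij|ij] := boolP (i <= j.+1)%N; last first.
    by rewrite (_ : S1 n i j = set0)//; apply/seteqP; split => // f [] /=; rewrite (negbTE ij).
  rewrite (_ : S1 n i j = [set f | `]-oo, n.+1%:R^-1[%classic (u (f (grid_time l i j)))]).
    by apply: mcoord.
  by apply/seteqP; split => f; rewrite /S1/= in_itv/= ij; [case|].
have mS2 m i j i' j' : measurable (S2 m i j i' j').
  have [/andP[ij gg]|H] := boolP ((i' <= j'.+1)%N && (grid_time l i' j' <= grid_time l i j)).
    rewrite (_ : S2 _ _ _ _ _ = [set f | `[m.+1%:R^-1, +oo[%classic (v (f (grid_time l i' j')))]).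
      by apply: mcoord.
    apply/seteqP; split => f; rewrite /S2/= in_itv/= andbT; first by move=> /(_ ij gg).
    by move=> H _ _.
  rewrite (_ : S2 _ _ _ _ _ = setT)//; apply/seteqP; split => // f _ ij gg.
  by move: H; rewrite ij gg.
rewrite (_ : [set f | _] = \bigcup_m \bigcap_n \bigcup_i \bigcup_j
    (S1 n i j `&` \bigcap_i' \bigcap_j' S2 m i j i' j')).
  suff : measurable (\bigcup_m \bigcap_n \bigcup_i \bigcup_j
    (S1 n i j `&` \bigcap_i' \bigcap_j' S2 m i j i' j')) by [].
  apply: bigcupT_measurable => m; apply: bigcapT_measurable => n.
  apply: bigcupT_measurable => i; apply: bigcupT_measurable => j.
  apply: measurableI => //; apply: bigcapT_measurable => i'.
  exact: bigcapT_measurable.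
apply/seteqP; split => f /=.
  move=> [m H]; exists m => // n _; have [i [j [ij ufi vfi]]] := H n.
  by exists i => //; exists j => //; split => // i' _ j' _; exact: vfi.
move=> [m _ H]; exists m => n; have [i _ [j _ [[ij ufi] vfi]]] := H n Logic.I.
by exists i, j; split => // i' j'; exact: (vfi i' Logic.I j' Logic.I).
Qed.

End hitting_event_measurable.

Section lattice_zeros.
Context {R : realType}.

Lemma normr_sin_int (k : int) (y : R) : `|sin (pi * k%:~R + y)| = `|sin y|.
Proof.
have nat_case (n : nat) z : `|sin (pi * n%:R + z)| = `|sin z| :> R.
  elim: n z => [|n IH] z; first by rewrite mulr0 add0r.
  rewrite -natr1 mulrDr mulr1 addrAC sinDpi normrN.
  exact: IH.
case: k => n; first exact: nat_case.
rewrite NegzE mulrNz -(nat_case n.+1 (_ + y)).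
by congr (`|sin _|); rewrite -pmulrn; ring.
Qed.

Lemma sin_pi_eq0 (z : R) : sin (pi * z) = 0 <-> exists k : int, z = k%:~R.
Proof.
split=> [s0|[k ->]]; last first.
  by apply/eqP; rewrite -normr_eq0 -[pi * _]addr0 normr_sin_int sin0 normr0.
exists (Num.floor z).
have /andP[zl zr] := real_floor_itv (num_real z).
pose w := z - (Num.floor z)%:~R.
have w0 : 0 <= w by rewrite subr_ge0.
have w1 : w < 1 by rewrite ltrBlDl; move: zr; rewrite intrD.
have sw : sin (pi * w) = 0.
  apply/eqP; rewrite -normr_eq0 -(normr_sin_int (Num.floor z)) -mulrDr /w addrC subrK s0 normr0//.
apply/eqP; rewrite -subr_eq0 -/w; apply/negPn/negP => wn0.
have wgt0 : 0 < w by rewrite lt_neqAle eq_sym wn0.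
have : 0 < sin (pi * w).
  by apply: sin_gt0_pi; rewrite mulr_gt0 ?pi_gt0//= gtr_pMr ?pi_gt0.
by rewrite sw ltxx.
Qed.

(** Continuous functions whose zero sets are the two lattices. *)
Definition even_gauge (r x : R) := `|sin (pi * (x / (2 * r)))|.
Definition odd_gauge (r x : R) := `|cos (pi * (x / (2 * r)))|.

Lemma continuous_even_gauge r : continuous (even_gauge r).
Proof.
move=> x; apply: cvg_norm; apply: continuous_comp; last exact: continuous_sin.
by apply: cvgM; [exact: cvg_cst|apply: cvgM; [exact: cvg_id|exact: cvg_cst]].
Qed.

Lemma continuous_odd_gauge r : continuous (odd_gauge r).
Proof.
move=> x; apply: cvg_norm; apply: continuous_comp; last exact: continuous_cos.
by apply: cvgM; [exact: cvg_cst|apply: cvgM; [exact: cvg_id|exact: cvg_cst]].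
Qed.

Lemma even_latticeE (r : R) : 0 < r -> even_lattice r = [set x | even_gauge r x = 0].
Proof.
move=> r0; have rn0 : r != 0 by rewrite gt_eqF.
apply/seteqP; split => x /=.
  move=> [k ->]; apply/eqP; rewrite normr_eq0; apply/eqP/sin_pi_eq0; exists k.
  by rewrite intrM; field.
move=> /eqP; rewrite normr_eq0 => /eqP/sin_pi_eq0[k xk]; exists k.
by rewrite intrM -xk; field.
Qed.

Lemma odd_latticeE (r : R) : 0 < r -> odd_lattice r = [set x | odd_gauge r x = 0].
Proof.
move=> r0; have rn0 : r != 0 by rewrite gt_eqF.
have oddE x : cos (pi * (x / (2 * r))) = sin (pi * (x / (2 * r) + 2^-1)).
  by rewrite mulrDr sinDpihalf.
apply/seteqP; split => x /=.
  move=> [k ->]; apply/eqP; rewrite normr_eq0 oddE; apply/eqP/sin_pi_eq0; exists (k + 1).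
  by rewrite !intrD intrM; field.
move=> /eqP; rewrite normr_eq0 oddE => /eqP/sin_pi_eq0[k xk]; exists (k - 1).
have -> : x = (k%:~R - 2^-1) * (2 * r) by rewrite -xk; field.
by rewrite intrD intrM intrB; field.
Qed.

End lattice_zeros.

(** * Moments of the bridge and symmetry of the hitting probability *)

Section gaussian_families.
Context d (T : measurableType d) (R : realType) (P : probability T R).

Lemma normal_moments_sqr_integrable (X : T -> R) m v : has_normal_moments P X m v ->
  P.-integrable setT (EFin \o (fun w => (X w - m) ^+ 2)).
Proof. by case=> /(_ 2%N isT). Qed.

Lemma gaussian_rv_sqr_integrable (X : T -> R) : measurable_fun setT X -> gaussian_rv P X ->
  P.-integrable setT (EFin \o X) /\
  P.-integrable setT (EFin \o (fun w => (X w - \int[P]_w X w) ^+ 2)).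
Proof.
move=> mX /(gaussian_rv_moments mX) [m [v NX]].
split; first exact: normal_moments_integrable NX.
by rewrite (normal_moments_mean NX); exact: normal_moments_sqr_integrable NX.
Qed.

(** Only means and covariances appear on the right: two Gaussian families that
    share them have the same cosine transforms. *)
Lemma gaussian_sum_cos n (X : nat -> T -> R) (a : nat -> R) (c : R) :
  (forall j, (j < n)%N -> measurable_fun setT (X j)) ->
  (forall j, (j < n)%N -> gaussian_rv P (X j)) ->
  gaussian_rv P (fun w => \sum_(j < n) a j * X j w) ->
  \int[P]_w cos (\sum_(j < n) a j * X j w + c) =
  cos (\sum_(j < n) a j * \int[P]_w X j w + c) *
  expR (- ((\sum_(i < n) \sum_(j < n) a i * (a j *
    \int[P]_w ((X i w - \int[P]_w X i w) * (X j w - \int[P]_w X j w)))) / 2)).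
Proof.
move=> mX gX gS.
have mS : measurable_fun setT (fun w => \sum_(j < n) a j * X j w).
  apply: measurable_sum => j; apply: measurable_funM => //; exact: mX.
have [m [v NS]] := gaussian_rv_moments mS gS.
rewrite (normal_moments_cos c NS).
have iX j : (j < n)%N -> P.-integrable setT (EFin \o X j).
  by move=> jn; have [] := gaussian_rv_sqr_integrable (mX j jn) (gX j jn).
have Em : m = \sum_(j < n) a j * \int[P]_w X j w.
  rewrite -(normal_moments_mean NS) (@Rintegral_sum _ _ _ P n (fun j w => a j * X j w)).
    by apply: eq_bigr => j _; rewrite RintegralZl//; exact: iX.
  by move=> j jn; apply: integrableRZ; exact: iX.
rewrite -Em; congr (cos _ * expR (- (_ / 2))).
have [_ _ <- _ _] := NS; rewrite Em.
set m' := fun j => \int[P]_w X j w.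
have iXX i j : (i < n)%N -> (j < n)%N ->
    P.-integrable setT (EFin \o (fun w => (X i w - m' i) * (X j w - m' j))).
  move=> ni nj; apply: integrable_mul_sqr.
  - by apply: measurable_funB => //; exact: mX.
  - by apply: measurable_funB => //; exact: mX.
  - by have [] := gaussian_rv_sqr_integrable (mX i ni) (gX i ni).
  - by have [] := gaussian_rv_sqr_integrable (mX j nj) (gX j nj).
have E w : (\sum_(j < n) a j * X j w - \sum_(j < n) a j * m' j) ^+ 2 =
    \sum_(i < n) \sum_(j < n) a i * (a j * ((X i w - m' i) * (X j w - m' j))).
  rewrite -sumrB expr2 big_distrl/=; apply: eq_bigr => i _.
  by rewrite big_distrr/=; apply: eq_bigr => j _; ring.
under eq_Rintegral do rewrite E.
rewrite (@Rintegral_sum _ _ _ P n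
  (fun i w => \sum_(j < n) a i * (a j * ((X i w - m' i) * (X j w - m' j))))).
  apply: eq_bigr => i _.
  rewrite (@Rintegral_sum _ _ _ P n
    (fun j w => a i * (a j * ((X i w - m' i) * (X j w - m' j))))).
    apply: eq_bigr => j _.
    by rewrite RintegralZl ?RintegralZl//; [|apply: integrableRZ]; exact: iXX.
  by move=> j jn; do 2 apply: integrableRZ; exact: iXX.
move=> i ni; apply: (@integrableR_sum _ _ _ P n
    (fun j w => a i * (a j * ((X i w - m' i) * (X j w - m' j))))).
by move=> j jn; do 2 apply: integrableRZ; exact: iXX.
Qed.

End gaussian_families.

Section bridge_moments.
Context d (T : measurableType d) (R : realType) (P : probability T R).
Variables (x l y : R) (B : R -> {RV P >-> R}).
Hypothesis bB : brownian_bridge P x l y B.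

Lemma bridge_gaussian n (t a : nat -> R) : (forall j, (j < n)%N -> 0 <= t j <= l) ->
  gaussian_rv P (fun w => \sum_(j < n) a j * B (t j) w).
Proof.
move=> tl; case: bB => _ gB _ _; apply: (gB n (t \o val) (a \o val)).
by move=> i; rewrite /= in_itv/=; exact: tl.
Qed.

Lemma bridge_gaussian1 t : 0 <= t <= l -> gaussian_rv P (B t).
Proof.
move=> tl; have := @bridge_gaussian 1 (cst t) (cst 1) (fun _ _ => tl).
by congr gaussian_rv; apply/funext => w; rewrite big_ord1 mul1r.
Qed.

Lemma bridge_mean t : 0 <= t <= l -> \int[P]_w B t w = x + t / l * (y - x).
Proof.
by move=> tl; case: bB => _ _ /(_ t tl) E _; move: E; rewrite unlock /Rintegral => ->.
Qed.

Lemma bridge_cov s t : 0 <= s -> s <= t -> t <= l ->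
  \int[P]_w ((B s w - \int[P]_w B s w) * (B t w - \int[P]_w B t w)) = s * (1 - t / l).
Proof.
move=> s0 st tl; case: bB => _ _ _ /(_ s t s0 st tl).
rewrite unlock /Rintegral unlock => E; move: E.
by move=> /(congr1 fine) /= <-.
Qed.

Lemma bridge_integrable t : 0 <= t <= l -> P.-integrable setT (EFin \o B t).
Proof.
by move=> /bridge_gaussian1/(gaussian_rv_sqr_integrable (measurable_funP (B t))) [].
Qed.

End bridge_moments.

Section hitting_probability.
Context {R : realType}.

Lemma hit_path_event (l r : R) : 0 < l -> 0 < r ->
  exists2 S : set (R -> R), <<s cylinder `[0, l] >> S &
    forall f : R -> R, {within `[0, l], continuous f} ->
      S f <-> hits_before l f (even_lattice r) (odd_lattice r).
Proof.
move=> l0 r0; have cu := @continuous_even_gauge R r; have cv := @continuous_odd_gauge R r.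
eexists; first exact: (measurable_grid_event l0 cu cv).
move=> f cf; rewrite (even_latticeE r0) (odd_latticeE r0).
have u0 z : 0 <= even_gauge r z by exact: normr_ge0.
have v0 z : 0 <= odd_gauge r z by exact: normr_ge0.
by have [H1 H2] := hits_beforeP l0 cu cv u0 v0 cf; split.
Qed.

Lemma even_latticeN (r z : R) : even_lattice r (- z) <-> even_lattice r z.
Proof.
have H u : even_lattice r u -> even_lattice r (- u).
  by move=> [k ->]; exists (- k); rewrite mulrN intrN mulNr.
by split=> [/H|/H//]; rewrite opprK.
Qed.

Lemma odd_latticeN (r z : R) : odd_lattice r (- z) <-> odd_lattice r z.
Proof.
have H u : odd_lattice r u -> odd_lattice r (- u).
  move=> [k ->]; exists (- k - 1); rewrite -mulNr -intrN; congr (_%:~R * _); ring.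
by split=> [/H|/H//]; rewrite opprK.
Qed.

Lemma hits_beforeN (l r : R) f :
  hits_before l (fun t => - f t) (even_lattice r) (odd_lattice r) <->
  hits_before l f (even_lattice r) (odd_lattice r).
Proof.
by split => -[t [tl /even_latticeN At Cs]]; exists t; split => // s /Cs;
  apply: contra_not => /odd_latticeN.
Qed.

Lemma measurable_hit d (T : measurableType d) (P : probability T R)
    (x l y r : R) (B : R -> {RV P >-> R}) :
  0 < l -> 0 < r -> brownian_bridge P x l y B ->
  measurable [set w | hits_before l (fun t => B t w) (even_lattice r) (odd_lattice r)].
Proof.
move=> l0 r0 bB; have [S mS SP] := hit_path_event l0 r0.
rewrite (_ : [set w | _] = [set w | S (fun t => B t w)]).
  exact: (measurable_path_event (fun t => measurable_funP (B t)) mS).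
have [cB _ _ _] := bB.
by apply/seteqP; split => w /= /(SP _ (cB w)).
Qed.

Lemma hit_prob_itv d (T : measurableType d) (P : probability T R)
    (x l y r : R) (B : R -> {RV P >-> R}) :
  0 < l -> 0 < r -> brownian_bridge P x l y B ->
  0 <= hit_even_before_odd_prob P l r B <= 1.
Proof.
move=> l0 r0 bB; have mE := measurable_hit l0 r0 bB.
rewrite fine_ge0// -lee_fin fineK ?fin_num_measure//.
exact: probability_le1.
Qed.

(** The process [- B2] has the means and covariances of [B1], hence the same path
    law, and negation preserves both lattices. *)
Lemma hit_prob_reflect d1 d2 (T1 : measurableType d1) (T2 : measurableType d2)
    (P1 : probability T1 R) (P2 : probability T2 R) (x l y r : R)
    (B1 : R -> {RV P1 >-> R}) (B2 : R -> {RV P2 >-> R}) :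
  0 < l -> 0 < r -> brownian_bridge P1 x l y B1 ->
  brownian_bridge P2 (- x) l (- y) B2 ->
  hit_even_before_odd_prob P2 l r B2 = hit_even_before_odd_prob P1 l r B1.
Proof.
move=> l0 r0 b1 b2; rewrite /hit_even_before_odd_prob.
have [S mS SP] := hit_path_event l0 r0.
have [c1 _ _ _] := b1; have [c2 _ _ _] := b2.
pose X2 t w := - B2 t w.
have mB1 t : measurable_fun setT (B1 t : T1 -> R) by exact: measurable_funP.
have mX2 t : measurable_fun setT (X2 t).
  by apply: measurableT_comp => //; exact: measurable_funP.
have cX2 w : {within `[0, l], continuous (X2^~ w)}.
  apply: within_continuous_comp; last exact: c2.
  by move=> z _; exact: opp_continuous.
transitivity (fine (P2 [set w | S (X2^~ w)])).
  congr (fine (P2 _)); apply/seteqP; split => w /=.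
    by move=> H; apply/(SP _ (cX2 w))/hits_beforeN.
  by move=> /(SP _ (cX2 w)) /hits_beforeN.
transitivity (fine (P1 [set w | S (fun t => B1 t w)])); last first.
  congr (fine (P1 _)); apply/seteqP; split => w /=.
    by move=> /(SP _ (c1 w)).
  by move=> H; apply/(SP _ (c1 w)).
congr fine; apply: (path_law_unique mX2 mB1 _ mS) => n t a c tI.
have tl j : 0 <= t j <= l by have := tI j; rewrite /= in_itv.
have gX2 (b : nat -> R) : gaussian_rv P2 (fun w => \sum_(j < n) b j * X2 (t j) w).
  have := bridge_gaussian b2 (n := n) (t := t) (fun j => - b j) (fun j _ => tl j).
  congr gaussian_rv; apply/funext => w; apply: eq_bigr => j _.
  by rewrite mulrN mulNr.
rewrite (@gaussian_sum_cos _ _ _ P2 n (X2 \o t))//; last 2 first.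
- by move=> j _; exact: mX2.
- move=> j _.
  have := bridge_gaussian b2 (n := 1) (t := cst (t j)) (cst (-1)) (fun _ _ => tl j).
  by congr gaussian_rv; apply/funext => w; rewrite big_ord1 /= mulN1r.
rewrite (@gaussian_sum_cos _ _ _ P1 n (B1 \o t))//; last 2 first.
- by move=> j _; exact: (bridge_gaussian1 b1 (tl j)).
- by apply: (bridge_gaussian b1) => j _; exact: tl.
have E2 s : 0 <= s <= l -> \int[P2]_w X2 s w = \int[P1]_w B1 s w.
  move=> sl; rewrite /X2 (bridge_mean b1 sl).
  under eq_Rintegral do rewrite -mulN1r.
  rewrite RintegralZl//; last exact: (bridge_integrable b2 sl).
  by rewrite (bridge_mean b2 sl); ring.
have C2 s s' : 0 <= s -> s <= s' -> s' <= l ->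
    \int[P2]_w ((X2 s w - \int[P2]_w X2 s w) * (X2 s' w - \int[P2]_w X2 s' w)) =
    \int[P1]_w ((B1 s w - \int[P1]_w B1 s w) * (B1 s' w - \int[P1]_w B1 s' w)).
  move=> s0 ss sl; rewrite (bridge_cov b1)// -(bridge_cov b2 s0 ss sl).
  have sl1 : 0 <= s <= l by rewrite s0 (le_trans ss).
  have sl2 : 0 <= s' <= l by rewrite sl (le_trans s0).
  rewrite !E2// (bridge_mean b1 sl1) (bridge_mean b1 sl2) (bridge_mean b2 sl1) (bridge_mean b2 sl2).
  by apply: eq_Rintegral => w _; rewrite /X2; ring.
congr (cos _ * expR (- (_ / 2))).
  by congr (_ + _); apply: eq_bigr => j _; rewrite /= E2.
apply: eq_bigr => i _; apply: eq_bigr => j _; congr (_ * (_ * _)).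
have /andP[i0 il] := tl i; have /andP[j0 jl] := tl j.
have [ij|/ltW ji] := leP (t i) (t j); first exact: C2.
under eq_Rintegral do rewrite mulrC.
under [RHS]eq_Rintegral do rewrite mulrC.
exact: C2.
Qed.

End hitting_probability.

(** * A discrete supermartingale bound for leaving a cell with moving walls *)

Section exit_bound.
Context d (T : measurableType d) (R : realType) (P : probability T R).
Variables (alpha beta eta K l y : R) (up : bool).
Hypotheses (l0 : 0 < l) (alpha0 : 0 < alpha) (ab : alpha < beta).
Hypotheses (eta0 : 0 < eta) (K0 : 0 <= K).
Let r := beta - alpha.
Hypothesis K_drift : (beta + r) / r <= K * (l - 2 * beta * r).

(** Distance to the moving wall opposite to the one chosen by [up]. *)
Definition exit_lin (x c : R) := if up then x - alpha * c else beta * c - x.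
Definition exit_gap (x c : R) := (x - alpha * c) * (beta * c - x).
(** With [c = 1 + s / l] this is the supermartingale [V]: harmonic part, clock and
    concave correction. *)
Definition exit_value (x c : R) := exit_lin x c / r + (c - 1) + K * exit_gap x c.

(** The walls are moved inwards by [eta], so that a small jump out of [keep]
    does not cross the true walls. *)
Definition keep (c : R) : set R := `[(alpha + eta) * c, (beta - eta) * c]%classic.
Definition target (c : R) : set R :=
  if up then `](beta - eta) * c, +oo[%classic else `]-oo, (alpha + eta) * c[%classic.

Let r0 : 0 < r. Proof. by rewrite subr_gt0. Qed.

(** These constants are far from optimal; it only matters that they depend neither
    on the mesh nor on the step. *)
Definition jump_cst0 := 1 + (1 / 2 + beta) / r + K * (r + 2 * r * beta + 2 * beta ^+ 2).
Definition jump_cst1 := 1 / (2 * r) + K * (r + 2).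
Definition jump_cst := jump_cst0 / (eta ^+ 2 / 4) ^+ 2 + jump_cst1 / (eta ^+ 2 / 4).

Let b0 : 0 < beta := lt_trans alpha0 ab.

Ltac nonneg := do ![done | exact: ltW | apply: addr_ge0 | apply: mulr_ge0 |
  rewrite invr_ge0 | apply: exprn_ge0].

Lemma jump_cst0_ge0 : 0 <= jump_cst0.
Proof. by rewrite /jump_cst0; nonneg. Qed.

Lemma jump_cst1_ge0 : 0 <= jump_cst1.
Proof. by rewrite /jump_cst1; nonneg. Qed.

Lemma jump_cst_ge0 : 0 <= jump_cst.
Proof.
have j0 := jump_cst0_ge0; have j1 := jump_cst1_ge0.
by rewrite /jump_cst; nonneg.
Qed.

Lemma exit_value_crude x c e Y : 1 <= c <= 2 -> 0 <= e <= 1 -> keep c x ->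
  1 - exit_value (x + Y) (c + e) <= jump_cst0 + jump_cst1 * Y ^+ 2.
Proof.
move=> /andP[c1 c2] /andP[e0 e1]; rewrite /keep/= in_itv/= => /andP[xa xb].
set p := x - alpha * c; set q := beta * c - x.
have ec0 : 0 <= eta * c by rewrite mulr_ge0// ?(ltW eta0)// (le_trans _ c1).
have p0 : 0 <= p by rewrite /p; lra.
have q0 : 0 <= q by rewrite /q; lra.
have pq : p + q <= 2 * r by rewrite /p /q /r; have := r0; rewrite /r; nra.
have ae : 0 <= alpha * e <= beta.
  by rewrite mulr_ge0 ?(ltW alpha0)//=; apply: le_trans (ltW ab); rewrite ler_piMr// ltW.
have be : 0 <= beta * e <= beta by rewrite mulr_ge0 ?(ltW b0)//= ler_piMr// ltW.
have Y1 : Y <= (1 + Y ^+ 2) / 2 by have := sqr_ge0 (Y - 1); nra.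
have Y2 : - Y <= (1 + Y ^+ 2) / 2 by have := sqr_ge0 (Y + 1); nra.
have lin : - exit_lin (x + Y) (c + e) <= (1 + Y ^+ 2) / 2 + beta.
  rewrite /exit_lin; case: up.
    have -> : x + Y - alpha * (c + e) = p + Y - alpha * e by rewrite /p; ring.
    lra.
  have -> : beta * (c + e) - (x + Y) = q - Y + beta * e by rewrite /q; ring.
  lra.
have gap : - exit_gap (x + Y) (c + e) <=
    r + 2 * r * beta + 2 * beta ^+ 2 + (r + 2) * Y ^+ 2.
  have -> : exit_gap (x + Y) (c + e) =
    p * q + p * (beta * e) + (q - p) * Y - q * (alpha * e) - (Y - alpha * e) * (Y - beta * e).
    by rewrite /exit_gap /p /q; ring.
  have pq0 : 0 <= p * q by rewrite mulr_ge0.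
  have pb0 : 0 <= p * (beta * e) by rewrite mulr_ge0// ; case/andP : be.
  have qa : q * (alpha * e) <= 2 * r * beta.
    by case/andP : ae => ? ?; apply: ler_pM => //; lra.
  have qp : (p - q) * Y <= r * (1 + Y ^+ 2).
    have h1 : p * Y <= p * ((1 + Y ^+ 2) / 2) by rewrite ler_wpM2l.
    have h2 : q * - Y <= q * ((1 + Y ^+ 2) / 2) by rewrite ler_wpM2l.
    have h3 : (p + q) * ((1 + Y ^+ 2) / 2) <= 2 * r * ((1 + Y ^+ 2) / 2).
      by rewrite ler_wpM2r// divr_ge0// addr_ge0// sqr_ge0.
    lra.
  have quad : (Y - alpha * e) * (Y - beta * e) <= 2 * Y ^+ 2 + 2 * beta ^+ 2.
    case/andP : ae => ? ?; case/andP : be => ? ?.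
    set s := alpha * e in pb0 qa qp * ; set t := beta * e in pb0 qa qp *.
    have := sqr_ge0 (Y + s); have := sqr_ge0 (Y + t).
    have : s ^+ 2 <= beta ^+ 2 by rewrite lerXn2r// nnegrE// ltW.
    have : t ^+ 2 <= beta ^+ 2 by rewrite lerXn2r// nnegrE// ltW.
    have : s * t <= beta ^+ 2 by rewrite expr2 ler_pM.
    nra.
  lra.
have linr : - (exit_lin (x + Y) (c + e) / r) <= ((1 + Y ^+ 2) / 2 + beta) / r.
  by rewrite -mulNr ler_pM2r ?invr_gt0.
have gapK := ler_wpM2l K0 gap.
have -> : jump_cst0 + jump_cst1 * Y ^+ 2 =
    1 + ((1 + Y ^+ 2) / 2 + beta) / r +
    K * (r + 2 * r * beta + 2 * beta ^+ 2 + (r + 2) * Y ^+ 2).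
  by rewrite /jump_cst0 /jump_cst1; field; rewrite gt_eqF.
rewrite /exit_value; lra.
Qed.

(** A jump larger than [eta / 2] may overshoot the true walls and make the value
    negative.  The loss is charged to the fourth power of the jump, whose
    expectation is of the order of the square of the time step. *)
Lemma exit_value_jump x c e Y : 1 <= c <= 2 -> 0 <= e <= 1 -> keep c x ->
  eta / 2 < `|Y| -> 1 - exit_value (x + Y) (c + e) <= jump_cst * Y ^+ 4.
Proof.
move=> c12 e01 kx Yeta; apply: le_trans (exit_value_crude Y c12 e01 kx) _.
set k := eta ^+ 2 / 4.
have k0 : 0 < k by rewrite divr_gt0// exprn_gt0.
have kY : k <= Y ^+ 2.
  rewrite -[Y ^+ 2]real_normK ?num_real//.
  have -> : k = (eta / 2) ^+ 2 by rewrite /k; field.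
  by rewrite lerXn2r// ?nnegrE ?ltW// divr_gt0.
have j0 := jump_cst0_ge0; have j1 := jump_cst1_ge0.
have u1 : 1 <= Y ^+ 2 / k by rewrite ler_pdivlMr// mul1r.
have -> : jump_cst * Y ^+ 4 = jump_cst0 * (Y ^+ 2 / k) ^+ 2 + jump_cst1 * Y ^+ 2 * (Y ^+ 2 / k).
  by rewrite /jump_cst -/k; field; rewrite gt_eqF.
apply: lerD.
  by rewrite -[leLHS]mulr1 ler_wpM2l// -[leLHS](expr1n _ 2) lerXn2r ?nnegrE// (le_trans ler01).
by rewrite -[leLHS]mulr1 ler_wpM2l// mulr_ge0// sqr_ge0.
Qed.

Lemma exit_value_ge0 x c e Y : 1 <= c -> 0 <= e -> 2 * beta * e <= eta -> keep c x ->
  `|Y| <= eta / 2 -> 0 <= exit_value (x + Y) (c + e).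
Proof.
move=> c1 e0 ee; rewrite /keep/= in_itv/= => /andP[xa xb]; rewrite ler_norml => /andP[Y1 Y2].
have ec0 : eta <= eta * c by rewrite ler_peMr// ltW.
have ae : alpha * e <= beta * e by rewrite ler_wpM2r// ltW.
have be0 : 0 <= beta * e by rewrite mulr_ge0// ltW.
have p0 : 0 <= x + Y - alpha * (c + e) by lra.
have q0 : 0 <= beta * (c + e) - (x + Y) by lra.
rewrite /exit_value addr_ge0//; last by rewrite mulr_ge0// /exit_gap mulr_ge0.
rewrite addr_ge0//; last lra.
by rewrite divr_ge0// ?(ltW r0)// /exit_lin; case: up.
Qed.

Lemma exit_value_target x c e Y : 1 <= c -> 0 <= e -> 2 * beta * e <= eta -> keep c x ->
  eta <= r -> `|Y| <= eta / 2 -> target (c + e) (x + Y) ->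
  1 - eta / r <= exit_value (x + Y) (c + e).
Proof.
move=> c1 e0 ee kx er Yeta tx.
move: kx Yeta; rewrite /keep/= in_itv/= => /andP[xa xb]; rewrite ler_norml => /andP[Y1 Y2].
have ec0 : eta <= eta * c by rewrite ler_peMr// ltW.
have ae : alpha * e <= beta * e by rewrite ler_wpM2r// ltW.
have be0 : 0 <= beta * e by rewrite mulr_ge0// ltW.
have p0 : 0 <= x + Y - alpha * (c + e) by lra.
have q0 : 0 <= beta * (c + e) - (x + Y) by lra.
have G0 : 0 <= K * exit_gap (x + Y) (c + e) by rewrite mulr_ge0// /exit_gap mulr_ge0.
suff lin : 1 - eta / r <= exit_lin (x + Y) (c + e) / r by rewrite /exit_value; lra.
have -> : 1 - eta / r = (r - eta) / r by field; rewrite gt_eqF.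
rewrite ler_pM2r ?invr_gt0//; apply: (@le_trans _ _ ((r - eta) * (c + e))).
  by rewrite ler_peMr ?subr_ge0//; lra.
move: tx; rewrite /target /exit_lin /r; case: up; rewrite /= in_itv/= ?andbT => tx; lra.
Qed.

Lemma exit_value_step x c e Y mu nu :
  mu = (if up then 1 else -1) -> nu = (if up then - alpha else beta) ->
  exit_value (x + Y) (c + e) = exit_value x c +
    ((mu / r + K * ((alpha + beta) * c + (alpha + beta) * e)) * Y
     - 2 * K * (x * Y) - K * Y ^+ 2
     + e * (nu / r + 1 + K * ((alpha + beta) * x - 2 * alpha * beta * c - alpha * beta * e))).
Proof.
move=> -> ->; rewrite /exit_value /exit_lin /exit_gap.
by case: up; field; rewrite gt_eqF.
Qed.

Variables (N : nat) (X : nat -> T -> R).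
Hypothesis N0 : (0 < N)%N.
Let e : R := N%:R^-1.
Hypothesis mX : forall i, measurable_fun setT (X i).
Hypothesis gX : forall n (a : nat -> R), (n <= N.+1)%N ->
  gaussian_rv P (fun w => \sum_(j < n) a j * X j w).
Hypothesis meanX : forall i, (i <= N)%N -> \int[P]_w X i w = y.
Hypothesis covX : forall i j, (i <= j)%N -> (j <= N)%N ->
  \int[P]_w ((X i w - y) * (X j w - y)) = l * e * i%:R.
Hypothesis X0 : {ae P, forall w, X 0%N w = y}.
Hypotheses (ya : alpha <= y <= beta) (e_small : 2 * beta * e <= eta) (eta_r : eta <= r).

Let c (i : nat) : R := 1 + i%:R * e.
Let ind i w : R := \prod_(j < i.+1) \1_(keep (c j)) (X j w).
Let Y i w := X i.+1 w - X i w.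
Let V i w := exit_value (X i w) (c i).
Let hit i w : R := ind i w * \1_(target (c i.+1)) (X i.+1 w).

Let e0 : 0 < e. Proof. by rewrite invr_gt0 ltr0n. Qed.
Let e1 : e <= 1. Proof. by rewrite invf_le1 ?ltr0n// ler1n. Qed.
Let Ne : N%:R * e = 1. Proof. by rewrite mulfV// pnatr_eq0 -lt0n. Qed.
Let c12 i : (i <= N)%N -> 1 <= c i <= 2.
Proof.
move=> iN; have h1 : 0 <= i%:R * e by rewrite mulr_ge0// ltW.
have h2 : i%:R * e <= 1 by rewrite -[leRHS]Ne ler_pM2r// ler_nat.
by apply/andP; rewrite /c; split; lra.
Qed.
Let cS i : c i.+1 = c i + e. Proof. by rewrite /c -natr1; ring. Qed.

Let mkeep x : measurable (keep x). Proof. exact: measurable_itv. Qed.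
Let mtarget x : measurable (target x).
Proof. by rewrite /target; case: up; exact: measurable_itv. Qed.

Let mind i : measurable_fun setT (ind i).
Proof.
by apply: measurable_prod => j _; exact: measurableT_comp.
Qed.

Let ind01 i w : ind i w = 0 \/ (ind i w = 1 /\ forall j, (j <= i)%N -> keep (c j) (X j w)).
Proof.
have [H|H] := pselect (forall j, (j <= i)%N -> keep (c j) (X j w)).
  by right; split => //; rewrite /ind big1// => j _; rewrite indicE mem_set//; apply: H; rewrite -ltnS.
left; move/existsNP : H => [j /not_implyP[ji nk]].
by rewrite /ind (bigD1 (Ordinal (ji : (j < i.+1)%N)))//= indicE memNset// mul0r.
Qed.

Let indS i w : ind i.+1 w = ind i w * \1_(keep (c i.+1)) (X i.+1 w).
Proof. by rewrite /ind big_ord_recr. Qed.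

Let gX1 i : (i <= N)%N -> gaussian_rv P (X i).
Proof.
move=> iN; have := @gX i.+1 (fun j => (j == i)%:R) iN.
congr gaussian_rv; apply/funext => w.
rewrite big_ord_recr/= eqxx mul1r big1 ?add0r// => j _.
by rewrite ltn_eqF ?mul0r.
Qed.

Let gXY i : (i < N)%N -> forall (a : nat -> R) b,
  gaussian_rv P (fun w => \sum_(j < i.+1) a j * X j w + b * Y i w).
Proof.
move=> iN a b.
have := @gX i.+2 (fun j => if j == i.+1 then b else if j == i then a i - b else a j) iN.
congr gaussian_rv; apply/funext => w; rewrite !big_ord_recr/= !eqxx.
rewrite (ltn_eqF (ltnSn i)) /Y.
under eq_bigr => j _ do rewrite (ltn_eqF (ltn_ord j)) (ltn_eqF (ltn_trans (ltn_ord j) (ltnSn i))).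
ring.
Qed.

Let mY i : measurable_fun setT (Y i). Proof. exact: measurable_funB. Qed.

Let iX i : (i <= N)%N -> P.-integrable setT (EFin \o X i).
Proof. by move=> iN; have [] := gaussian_rv_sqr_integrable (mX i) (gX1 iN). Qed.

Let iXX i j : (i <= N)%N -> (j <= N)%N ->
  P.-integrable setT (EFin \o (fun w => (X i w - y) * (X j w - y))).
Proof.
move=> iN jN; have [_ h1] := gaussian_rv_sqr_integrable (mX i) (gX1 iN).
have [_ h2] := gaussian_rv_sqr_integrable (mX j) (gX1 jN).
rewrite meanX// in h1; rewrite meanX// in h2.
by apply: integrable_mul_sqr => //; exact: measurable_funB.
Qed.

Let meanY i : (i < N)%N -> \int[P]_w Y i w = 0.
Proof.
move=> iN; rewrite RintegralB//; [|exact: iX|exact/iX/ltnW].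
by rewrite !meanX ?subrr// ltnW.
Qed.

Let covXY i : (i < N)%N -> forall j, (j <= i)%N ->
  \int[P]_w ((X j w - y) * Y i w) = 0.
Proof.
move=> iN j ji.
have jN : (j <= N)%N by rewrite (leq_trans ji)// ltnW.
have iN' := ltnW iN.
transitivity (\int[P]_w ((X j w - y) * (X i.+1 w - y) - (X j w - y) * (X i w - y))).
  by apply: eq_Rintegral => w _; rewrite /Y; ring.
rewrite RintegralB//; [|exact: iXX|exact: iXX].
by rewrite !covX ?subrr// leqW.
Qed.

Let varY i : (i < N)%N -> \int[P]_w (Y i w ^+ 2) = l * e.
Proof.
move=> iN; have iN' := ltnW iN.
transitivity (\int[P]_w ((X i.+1 w - y) * (X i.+1 w - y) - (X i w - y) * (X i w - y)
    - 2 * ((X i w - y) * Y i w))).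
  by apply: eq_Rintegral => w _; rewrite /Y; ring.
have iXY : P.-integrable setT (EFin \o (fun w => (X i w - y) * Y i w)).
  have := integrableRB (iXX iN' iN) (iXX iN' iN').
  by apply: eq_integrable => // w _; congr EFin; rewrite /Y; ring.
rewrite RintegralB//; [|apply: integrableRB; exact: iXX|exact: integrableRZ].
rewrite RintegralZl// covXY// mulr0 subr0 RintegralB//; [|exact: iXX|exact: iXX].
by rewrite !covX// -natr1; ring.
Qed.

Let momY i : (i < N)%N -> has_normal_moments P (Y i) 0 (l * e).
Proof.
move=> iN; have gY : gaussian_rv P (Y i).
  have := gXY iN (fun=> 0) 1; congr gaussian_rv; apply/funext => w.
  by rewrite big1 ?add0r ?mul1r// => j _; rewrite mul0r.
have [m [v NY]] := gaussian_rv_moments (mY i) gY.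
have m0 : m = 0 by rewrite -(normal_moments_mean NY) meanY.
have v0 : v = l * e.
  rewrite -(varY iN); have [_ _ <- _ _] := NY.
  by apply: eq_Rintegral => w _; rewrite m0 subr0.
by rewrite m0 v0 in NY.
Qed.

Let indB i w : 0 <= ind i w <= 1.
Proof. by case: (ind01 i w) => [->|[-> _]]; rewrite ?lexx ?ler01. Qed.

Let iindM i (f : T -> R) : P.-integrable setT (EFin \o f) ->
  P.-integrable setT (EFin \o (fun w => f w * ind i w)).
Proof.
move=> intf; apply: le_integrable (intf) => //.
  by apply/measurable_EFinP/measurable_funM => //; apply/measurable_EFinP; case/integrableP: intf.
move=> w _; rewrite lee_fin normrM; have /andP[h0 h1] := indB i w.
by rewrite ler_piMr// ger0_norm.
Qed.

Let iind i : P.-integrable setT (EFin \o ind i).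
Proof.
apply: (@integrable_bounded _ _ _ _ _ 1) => // w.
by have /andP[h0 h1] := indB i w; rewrite ger0_norm.
Qed.

Let iV i : (i <= N)%N -> P.-integrable setT (EFin \o V i).
Proof.
move=> iN; have iZ := integrableRB (iX iN) (finite_measure_integrable_cst P y measurableT).
have iZ2 := iXX iN iN.
pose mu : R := if up then 1 else -1; pose nu := if up then - alpha else beta.
have E w : V i w = exit_value y (c i) +
    ((mu / r + K * ((alpha + beta) * c i)) - 2 * K * y) * (X i w - y)
     + (- K) * ((X i w - y) * (X i w - y)).
  rewrite /V -{1}(subrK y (X i w)) addrC -[c i in LHS]addr0.
  by rewrite (@exit_value_step y (c i) 0 (X i w - y) mu nu)// !mulr0 !mul0r; ring.
have := integrableRD (integrableRD (finite_measure_integrable_cst P (exit_value y (c i)) measurableT)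
  (integrableRZ ((mu / r + K * ((alpha + beta) * c i)) - 2 * K * y) iZ)) (integrableRZ (- K) iZ2).
by apply: eq_integrable => // w _; rewrite /= E.
Qed.

(** The supermartingale property.  The terms linear in the increment integrate to
    0, its square contributes [- K l e], and [K_drift] is what makes this outweigh
    the motion of the walls together with the clock. *)
Let exit_step i : (i < N)%N ->
  \int[P]_w (V i.+1 w * ind i w) <= \int[P]_w (V i w * ind i w).
Proof.
move=> iN; have iN' := ltnW iN.
pose mu : R := if up then 1 else -1; pose nu := if up then - alpha else beta.
pose A := mu / r + K * ((alpha + beta) * c i + (alpha + beta) * e).
have gi := gXY iN; have mk j : measurable (keep (c j)) by exact: mkeep.
have cov0 j : (j < i.+1)%N ->
    \int[P]_w ((X j w - \int[P]_w X j w) * (Y i w - \int[P]_w Y i w)) = 0.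
  move=> ji; rewrite meanY// meanX; last by rewrite (leq_trans _ iN').
  by rewrite -[RHS](covXY iN (ji : (j <= i)%N)); apply: eq_Rintegral => w _; rewrite subr0.
have ci0 : 0 <= beta * c i by have /andP[ci1 _] := c12 iN'; rewrite mulr_ge0 ?(ltW b0)// (le_trans ler01).
have kb : forall x, keep (c i) x -> `|x| <= beta * c i.
  move=> x; rewrite /keep/= in_itv/= => /andP[xa xb].
  have /andP[ci1 _] := c12 iN'.
  have h1 : 0 <= eta * c i by rewrite mulr_ge0 ?(ltW eta0)// (le_trans ler01).
  have h2 : 0 <= alpha * c i by rewrite mulr_ge0 ?(ltW alpha0)// (le_trans ler01).
  by rewrite ler_norml; apply/andP; split; nra.
have I1 := rectangle_mean_indep mX (mY i) gi cov0 (A := fun j => keep (c j)) ord_max mk.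
have I2 := rectangle_cross_indep mX (mY i) gi cov0 (A := fun j => keep (c j)) (i := ord_max) mk ci0 kb.
have I3 := rectangle_sqr_indep mX (mY i) gi cov0 (A := fun j => keep (c j)) ord_max mk.
rewrite meanY// mul0r -/(ind i) in I1.
rewrite meanY// mul0r /= -/(ind i) in I2.
rewrite varY// -/(ind i) in I3.
have [iYk _ _ _ _] := momY iN.
have iY1 : P.-integrable setT (EFin \o Y i).
  by have := iYk 1%N isT; apply: eq_integrable => // w _; rewrite /= subr0.
have iY2 : P.-integrable setT (EFin \o (fun w => Y i w ^+ 2)).
  by have := iYk 2%N isT; apply: eq_integrable => // w _; rewrite /= subr0.
have iXY : P.-integrable setT (EFin \o (fun w => Y i w * X i w)).
  have iZ := integrableRB (iXX iN' iN) (iXX iN' iN').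
  have := integrableRD iZ (integrableRZ y iY1).
  by apply: eq_integrable => // w _; congr EFin; rewrite /Y; ring.
have iXYind : P.-integrable setT (EFin \o (fun w => Y i w * (X i w * ind i w))).
  have := @iindM i _ iXY.
  by apply: eq_integrable => // w _; rewrite /= mulrA.
(* an upper bound for the value at step [i.+1], expanded in the increment [Y] *)
pose rhs w := V i w * ind i w + A * (Y i w * ind i w) - 2 * K * (Y i w * (X i w * ind i w))
  - K * (Y i w ^+ 2 * ind i w) + K * l * e * ind i w.
have i1 := @iindM i _ (iV iN').
have i2 := integrableRZ A (@iindM i _ iY1).
have i3 := integrableRZ (2 * K) iXYind.
have i4 := integrableRZ K (@iindM i _ iY2).
have i5 := integrableRZ (K * l * e) (iind i).
have i12 := integrableRD i1 i2; have i123 := integrableRB i12 i3.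
have i1234 := integrableRB i123 i4.
apply: (@le_trans _ _ (\int[P]_w rhs w)); last first.
  rewrite /rhs RintegralD// RintegralB// RintegralB// RintegralD//.
  rewrite RintegralZl ?I1//; last exact: iindM.
  rewrite RintegralZl ?I2// RintegralZl ?I3//; last exact: iindM.
  by rewrite RintegralZl//; lra.
apply: le_Rintegral => //.
- exact/iindM/iV.
- exact: integrableRD.
move=> w _; rewrite /rhs; case: (ind01 i w) => [->|[-> kX]]; first by rewrite !mulr0; lra.
rewrite !mulr1.
have -> : V i.+1 w = exit_value (X i w + Y i w) (c i + e) by rewrite /V cS /Y subrKC.
rewrite (@exit_value_step _ _ _ _ mu nu)// -/A -/(V i w).
suff : e * (nu / r + 1 + K * ((alpha + beta) * X i w - 2 * alpha * beta * c i - alpha * beta * e))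
    <= e * (K * l) by lra.
rewrite ler_pM2l//.
have nub : nu / r + 1 <= (beta + r) / r.
  rewrite mulrDl divff ?gt_eqF// lerD2r ler_pM2r ?invr_gt0// /nu; case: up => //.
  by apply: (@le_trans _ _ 0); [rewrite oppr_le0 ltW|exact: ltW].
have := kX i (leqnn i); rewrite /keep/= in_itv/= => /andP[xa xb].
have /andP[ci1 ci2] := c12 iN'.
have xb' : X i w <= beta * c i.
  by apply: le_trans xb _; rewrite ler_wpM2r ?gerBl ?(ltW eta0)// (le_trans ler01).
have ab0 : 0 <= alpha * beta * e by rewrite !mulr_ge0// ltW.
have inner : (alpha + beta) * X i w - 2 * alpha * beta * c i - alpha * beta * e <= 2 * beta * r.
  have h1 : (alpha + beta) * X i w <= (alpha + beta) * (beta * c i).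
    by rewrite ler_wpM2l// addr_ge0// ltW.
  have h2 : beta * r * c i <= beta * r * 2 by rewrite ler_wpM2l// mulr_ge0// ltW.
  move: h2; rewrite /r; lra.
have := ler_wpM2l K0 inner; move: K_drift; lra.
Qed.

Let disj_keep_target (x z : R) : 0 < x -> keep x z -> target x z -> False.
Proof.
move=> x0; rewrite /keep /target/= in_itv/= => /andP[h1 h2].
have h3 : eta * x <= r * x by rewrite ler_wpM2r// ltW.
case: up; rewrite /= in_itv/= ?andbT => h4; first by have := le_lt_trans h2 h4; rewrite ltxx.
by have := le_lt_trans h1 h4; rewrite ltxx.
Qed.

Let indic1 (A : set R) x : A x -> \1_A x = 1 :> R.
Proof. by move=> Ax; rewrite indicE mem_set. Qed.

Let indic0 (A : set R) x : ~ A x -> \1_A x = 0 :> R.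
Proof. by move=> Ax; rewrite indicE memNset. Qed.

(** What is lost by stopping at step [i.+1]: the path that leaves through the
    target has value at least [1 - eta / r], and one that leaves elsewhere has
    value at least 0, up to large jumps. *)
Let exit_loss i w : (i < N)%N ->
  V i.+1 w * ind i.+1 w + (1 - eta / r) * hit i w - jump_cst * Y i w ^+ 4 <= V i.+1 w * ind i w.
Proof.
move=> iN; rewrite indS /hit.
have C0 : 0 <= jump_cst * Y i w ^+ 4 by rewrite mulr_ge0 ?jump_cst_ge0// exprn_even_ge0.
case: (ind01 i w) => [->|[-> kX]]; first by rewrite !mul0r !mulr0; lra.
rewrite !mul1r mulr1.
have /andP[ciS1 _] := c12 iN; rewrite cS in ciS1.
have [kS|nkS] := pselect (keep (c i.+1) (X i.+1 w)).
  rewrite (indic1 kS) mulr1 indic0 ?mulr0; first lra.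
  apply: disj_keep_target kS; rewrite cS; apply: lt_le_trans ciS1.
  exact: ltr01.
rewrite (indic0 nkS) mulr0 add0r.
have VE : V i.+1 w = exit_value (X i w + Y i w) (c i + e) by rewrite /V cS /Y subrKC.
have k := kX i (leqnn i).
have eta01 : 0 <= eta / r <= 1.
  by rewrite divr_ge0 ?(ltW eta0) ?(ltW r0)//= ler_pdivrMr// mul1r.
have hb : 0 <= (\1_(target (c i.+1)) (X i.+1 w) : R) <= 1.
  by rewrite indicE; case: (_ \in _); rewrite ?lexx ?ler01.
have /andP[ci1 ci2] := c12 (ltnW iN).
have [Ys|Yl] := leP `|Y i w| (eta / 2); last first.
  have := @exit_value_jump (X i w) (c i) e (Y i w); rewrite ci1 ci2 e1 (ltW e0) -VE => /(_ isT isT k Yl).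
  by move: hb eta01 => /andP[hb0 hb1] /andP[r1 r2]; nra.
have V0 : 0 <= V i.+1 w by rewrite VE; apply: exit_value_ge0 => //; exact: ltW.
have [tS|ntS] := pselect (target (c i.+1) (X i.+1 w)).
  rewrite indicE mem_set// mulr1.
  have : 1 - eta / r <= V i.+1 w.
    rewrite VE; apply: exit_value_target => //; first exact: ltW.
    by rewrite -cS /Y subrKC.
  lra.
by rewrite indicE memNset// mulr0; lra.
Qed.

Let mhit i : measurable_fun setT (hit i).
Proof.
by apply: measurable_funM => //; exact: measurableT_comp.
Qed.

Let hit01 i w : 0 <= hit i w <= 1.
Proof.
rewrite /hit indicE; have /andP[h0 h1] := indB i w.
by case: (_ \in _); rewrite ?mulr1 ?mulr0 ?h0 ?h1 ?lexx ?ler01.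
Qed.

Let ihit i : P.-integrable setT (EFin \o hit i).
Proof.
apply: (@integrable_bounded _ _ _ _ _ 1) => // w.
by have /andP[h0 h1] := hit01 i w; rewrite ger0_norm.
Qed.

Let exit_step_loss i : (i < N)%N ->
  \int[P]_w (V i.+1 w * ind i.+1 w) + (1 - eta / r) * \int[P]_w hit i w
    - 3 * jump_cst * (l * e) ^+ 2 <= \int[P]_w (V i w * ind i w).
Proof.
move=> iN; apply: le_trans (exit_step iN).
have [iYk _ _ Y4 _] := momY iN.
have iY4 : P.-integrable setT (EFin \o (fun w => Y i w ^+ 4)).
  by have := iYk 4%N isT; apply: eq_integrable => // w _; rewrite /= subr0.
have Y4' : \int[P]_w (Y i w ^+ 4) = 3 * (l * e) ^+ 2.
  by rewrite -Y4; apply: eq_Rintegral => w _; rewrite subr0.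
have i1 := @iindM i.+1 _ (iV iN).
have i2 := integrableRZ (1 - eta / r) (ihit i).
have i3 := integrableRZ jump_cst iY4.
have i12 := integrableRD i1 i2.
have -> : 3 * jump_cst * (l * e) ^+ 2 = \int[P]_w (jump_cst * Y i w ^+ 4).
  by rewrite RintegralZl// Y4'; ring.
rewrite -RintegralZl// -RintegralD// -RintegralB//.
apply: le_Rintegral => //; first exact: integrableRB.
- exact/iindM/iV.
- by move=> w _; exact: exit_loss.
Qed.

Let exit_sum k : (k <= N)%N ->
  \int[P]_w (V k w * ind k w) + (1 - eta / r) * \sum_(i < k) \int[P]_w hit i w
    - k%:R * (3 * jump_cst * (l * e) ^+ 2) <= \int[P]_w (V 0%N w * ind 0%N w).
Proof.
elim: k => [_|k IH kN]; first by rewrite big_ord0 mulr0 mul0r addr0 subr0.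
have h := exit_step_loss kN; have {}IH := IH (ltnW kN).
by rewrite big_ord_recr/= -natr1; lra.
Qed.

Let exit_start : \int[P]_w (V 0%N w * ind 0%N w) <= exit_value y 1.
Proof.
have V0 : 0 <= exit_value y 1.
  have /andP[y1 y2] := ya.
  have lin0 : 0 <= exit_lin y 1 by rewrite /exit_lin; case: up; lra.
  have gap0 : 0 <= exit_gap y 1 by rewrite /exit_gap mulr_ge0//; lra.
  by rewrite /exit_value subrr addr0 addr_ge0// mulr_ge0// invr_ge0 ltW.
have c0E : c 0%N = 1 by rewrite /c mul0r addr0.
rewrite /Rintegral (ae_eq_integral (fun w => (exit_value y 1 * ind 0%N w)%:E))//.
- rewrite -/(Rintegral _ _ _) -[leRHS](Rintegral_cst_prob P).
  apply: le_Rintegral => //.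
  + exact: integrableRZ.
  + exact: finite_measure_integrable_cst.
  + by move=> w _; have /andP[h0 h1] := indB 0%N w; rewrite ler_piMr.
- by have /integrableP[] := @iindM 0%N _ (@iV 0%N isT).
- by have /integrableP[] := integrableRZ (exit_value y 1) (iind 0%N).
- by apply: filterS X0 => w; rewrite /V c0E => -> _.
Qed.

Definition survives i : set T := [set w | forall j, (j <= i)%N -> keep (c j) (X j w)].

Definition exit_event : set T := [set w | survives N w \/
  exists2 i, (i < N)%N & survives i w /\ target (c i.+1) (X i.+1 w)].

Lemma measurable_survives i : measurable (survives i).
Proof.
rewrite (_ : survives i = \bigcap_(j in `I_i.+1) (X j @^-1` keep (c j))); last first.
  by apply/seteqP; split => w /= H j ji; exact: H.
by apply: bigcap_measurableType => j _; rewrite -[_ @^-1` _]setTI; exact: mX.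
Qed.

Lemma measurable_exit_event : measurable exit_event.
Proof.
rewrite (_ : exit_event = survives N `|`
   \bigcup_(i in `I_N) (survives i `&` X i.+1 @^-1` target (c i.+1))); last first.
  by apply/seteqP; split => w [|]; [left|move=> [i iN Hi]; right; exists i|left|move=> [i iN Hi]; right; exists i].
apply: measurableU; first exact: measurable_survives.
apply: bigcup_measurable => i _; apply: measurableI; first exact: measurable_survives.
by rewrite -[_ @^-1` _]setTI; exact: mX.
Qed.

(** Summing over the steps: the value starts from [exit_value y 1] and is at least
    1 on the paths that survive until the horizon; each of the [N] steps costs an
    error of order [1 / N ^ 2]. *)
Lemma discrete_exit_bound :
  (1 - eta / r) * fine (P exit_event) <= exit_value y 1 + 3 * jump_cst * l ^+ 2 / N%:R.
Proof.
have eta1 : 0 <= 1 - eta / r by rewrite subr_ge0 ler_pdivrMr// mul1r.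
have step := exit_sum (leqnn N).
have start := exit_start.
have survive1 i w : survives i w -> ind i w = 1.
  move=> H; rewrite /ind big1// => j _; rewrite indicE mem_set//; apply: H; by rewrite -ltnS.
have stop : \int[P]_w ind N w <= \int[P]_w (V N w * ind N w).
  apply: le_Rintegral => //; first exact/iindM/iV.
  move=> w _; case: (ind01 N w) => [->|[-> kX]]; first by rewrite mulr0.
  rewrite mulr1; have := kX N (leqnn N); rewrite /keep/= in_itv/= => /andP[xa xb].
  have cN : c N = 2 by rewrite /c Ne.
  have h : 0 <= eta * c N by rewrite cN mulr_ge0// ltW.
  have p0 : 0 <= X N w - alpha * c N by lra.
  have q0 : 0 <= beta * c N - X N w by lra.
  rewrite /V /exit_value; have h1 : 0 <= K * exit_gap (X N w) (c N) by rewrite !mulr_ge0.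
  have h2 : 0 <= exit_lin (X N w) (c N) / r.
    by rewrite mulr_ge0 ?invr_ge0 ?(ltW r0)// /exit_lin; case: up.
  by move: h1 h2; rewrite cN; lra.
have PF : fine (P exit_event) <= \int[P]_w ind N w + \sum_(i < N) \int[P]_w hit i w.
  rewrite -(@Rintegral_sum _ _ _ P N hit)// -RintegralD//; last exact: integrableR_sum.
  have mF := measurable_exit_event.
  have -> : fine (P exit_event) = \int[P]_w (\1_exit_event w).
    by rewrite /Rintegral integral_indic// setIT.
  apply: le_Rintegral => //.
  - apply: (@integrable_bounded _ _ _ _ _ 1) => // w; rewrite indicE.
    by case: (_ \in _); rewrite ?normr1 ?normr0.
  - by apply: integrableRD => //; exact: integrableR_sum.
  move=> w _; have hit0 : 0 <= \sum_(i < N) hit i w.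
    by apply: sumr_ge0 => i _; have /andP[] := hit01 i w.
  have /andP[ind0 ind1] := indB N w.
  rewrite indicE; have [|nF] := boolP (w \in exit_event); last by rewrite addr_ge0.
  rewrite inE => -[/survive1 ->|[i iN [/survive1 indi ti]]]; first by rewrite lerDl.
  rewrite (bigD1 (Ordinal iN))//= /hit indi mul1r indicE mem_set//= addrCA lerDl addr_ge0//.
  by apply: sumr_ge0 => j _; have /andP[] := hit01 j w.
have := ler_wpM2l eta1 PF.
have ind_int : 0 <= \int[P]_w ind N w by apply: Rintegral_ge0 => w _; have /andP[] := indB N w.
have eta2 : eta / r * \int[P]_w ind N w >= 0.
  by rewrite mulr_ge0// divr_ge0 ?(ltW eta0)// ltW.
have -> : 3 * jump_cst * l ^+ 2 / N%:R = N%:R * (3 * jump_cst * (l * e) ^+ 2).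
  by rewrite -/e; transitivity (3 * jump_cst * l ^+ 2 * e * (N%:R * e)); [rewrite Ne mulr1|ring].
move: start stop step eta2; lra.
Qed.

End exit_bound.

(** * From the grid to continuous paths *)

Section almost_sure.
Context d (T : measurableType d) (R : realType) (P : probability T R).
Local Open Scope ereal_scope.

Lemma prob_ae_le (A B : set T) : measurable A -> measurable B ->
  {ae P, forall w, A w -> B w} -> P A <= P B.
Proof.
move=> mA mB [Z [mZ PZ ZP]].
apply: (@le_trans _ _ (P (B `|` Z))).
  rewrite le_measure ?inE//; first exact: measurableU.
  move=> w Aw; have [Bw|nBw] := pselect (B w); [by left|right].
  by apply: ZP => /(_ Aw).
apply: le_trans (measureU2 _ _ _) _ => //.
by rewrite [X in _ + X <= _](PZ : _ = 0) adde0.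
Qed.

Lemma prob_ae_eq (A B : set T) : measurable A -> measurable B ->
  {ae P, forall w, A w <-> B w} -> P A = P B.
Proof.
move=> mA mB AB; apply/eqP; rewrite eq_le; apply/andP; split; apply: prob_ae_le => //.
  by apply: filterS AB => w [].
by apply: filterS AB => w [].
Qed.

End almost_sure.

Section liminf.
Context d (T : measurableType d) (R : realType) (P : probability T R).

(** The lemma of Fatou for events. *)
Lemma liminf_prob_le (A : nat -> set T) (u : nat -> R) (b : R) :
  (forall n, measurable (A n)) ->
  (\forall n \near \oo, fine (P (A n)) <= u n) ->
  u n @[n --> \oo] --> b ->
  fine (P (\bigcup_n \bigcap_(k in [set k | (n <= k)%N]) A k)) <= b.
Proof.
move=> mA Au ub; pose G n := \bigcap_(k in [set k | (n <= k)%N]) A k.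
have mG n : measurable (G n) by apply: bigcap_measurableType => k _; exact: mA.
have Gb n : fine (P (G n)) <= b.
  apply: (cvgr_to_ge ub); near=> k; apply: (@le_trans _ _ (fine (P (A k)))); last by near: k.
  rewrite fine_le ?fin_num_measure// le_measure ?inE// => w; apply.
  by near: k; exists n.
have ndG : nondecreasing_seq G.
  move=> m n mn; apply/subsetPset => w Gm k /= nk; apply: Gm => /=.
  exact: leq_trans mn nk.
have mUG : measurable (\bigcup_n G n) by exact: bigcupT_measurable.
have cG : fine (P (G n)) @[n --> \oo] --> fine (P (\bigcup_n G n)).
  apply: fine_cvg; rewrite fineK ?fin_num_measure//.
  exact: nondecreasing_cvg_mu.
by apply: (cvgr_to_le cG); exact: nearW.
Unshelve. all: by end_near. Qed.

End liminf.

Section grid.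
Context {R : realType}.
Variable l : R.
Hypothesis l0 : 0 < l.

(** In the clock [t / (1 - t / l)] this is the time [i l / N]. *)
Definition bridge_grid N i : R := l * (i%:R / (i%:R + N%:R)).

Lemma bridge_grid_itv N i : (0 < N)%N -> 0 <= bridge_grid N i <= l.
Proof.
move=> N0; have iN : 0 < i%:R + N%:R :> R by rewrite ltr_wpDl// ltr0n.
rewrite /bridge_grid mulr_ge0 ?(ltW l0) ?divr_ge0 ?(ltW iN)//=.
by rewrite ger_pMr// ler_pdivrMr// mul1r lerDl.
Qed.

Lemma bridge_grid_mono N i j : (0 < N)%N -> (i <= j)%N -> bridge_grid N i <= bridge_grid N j.
Proof.
move=> N0 ij; have iN k : 0 < k%:R + N%:R :> R by rewrite ltr_wpDl// ltr0n.
rewrite /bridge_grid ler_pM2l// ler_pdivrMr// mulrAC ler_pdivlMr//.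
have h : i%:R * N%:R <= j%:R * N%:R :> R by rewrite ler_wpM2r// ler_nat.
by rewrite !mulrDr [leLHS]addrC [leRHS]addrC (mulrC j%:R i%:R) lerD2r.
Qed.

Lemma bridge_grid_approx t del : 0 <= t < l -> 0 < del ->
  exists N0, forall N, (N0 <= N)%N -> (0 < N)%N ->
    exists2 i, bridge_grid N i <= t & t - del < bridge_grid N i.
Proof.
move=> /andP[t0 tl] del0; exists (Num.truncn (l / del)).+1 => N N0N N0.
have lt0 : 0 < l - t by rewrite subr_gt0.
have x0 : 0 <= N%:R * t / (l - t) by rewrite divr_ge0 ?mulr_ge0// ltW.
pose i := Num.truncn (N%:R * t / (l - t)); exists i.
all: have /andP[il ir] := truncn_itv x0; rewrite -/i in il ir.
all: have iN : 0 < i%:R + N%:R :> R by rewrite ltr_wpDl// ltr0n.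
  rewrite /bridge_grid mulrA ler_pdivrMr//; move: il; rewrite ler_pdivlMr//; lra.
rewrite /bridge_grid mulrA ltr_pdivlMr//; move: ir; rewrite ltr_pdivrMr// -(natr1 i) => ir.
have lN : l < del * N%:R.
  rewrite mulrC -ltr_pdivrMr//; apply: lt_le_trans (truncnS_gt _) _.
  by rewrite ler_nat.
have di : 0 <= del * i%:R by rewrite mulr_ge0// ltW.
lra.
Qed.

(** The path leaves the open cell for the first time, through the wall [up]. *)
Definition first_exit (alpha beta : R) (up : bool) (f : R -> R) : Prop :=
  exists t, [/\ 0 <= t <= l, f t = (if up then beta else alpha) &
    forall s, 0 <= s < t -> alpha < f s < beta].

Definition grid_exit (alpha beta eta : R) (up : bool) N (f : R -> R) : Prop :=
  (forall j, (j <= N)%N -> alpha + eta <= f (bridge_grid N j) <= beta - eta) \/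
  exists2 i, (i < N)%N &
    (forall j, (j <= i)%N -> alpha + eta <= f (bridge_grid N j) <= beta - eta) /\
    (if up then beta - eta < f (bridge_grid N i.+1) else f (bridge_grid N i.+1) < alpha + eta).

(** Until it leaves through one wall the path keeps a positive distance from the
    other one.  If [eta] is below this distance and the grid has a point just
    before the exit, the first grid point outside the shrunk cell lies beyond the
    chosen wall. *)
Lemma first_exit_grid (alpha beta : R) up f : {within `[0, l], continuous f} ->
  alpha < f 0 < beta -> f l < alpha -> first_exit alpha beta up f ->
  exists2 eta1, 0 < eta1 & forall eta, 0 < eta -> eta <= eta1 ->
    exists N0, forall N, (N0 <= N)%N -> (0 < N)%N -> grid_exit alpha beta eta up N f.
Proof.
move=> cf /andP[fa fb] fl [t [/andP[t0 tl] ft fs]].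
have ab : alpha < beta := lt_trans fa fb.
have {}tl : t < l.
  rewrite lt_neqAle tl andbT; apply/eqP => tE; move: fl; rewrite -tE ft.
  by case: up {ft}; rewrite ?ltxx// ltNge (ltW ab).
have sub : `[0, t]%classic `<=` `[0, l]%classic.
  by move=> s /=; rewrite !in_itv/= => /andP[-> st]; rewrite (le_trans st (ltW tl)).
have cft := continuous_subspaceW sub cf.
have [eta2 eta20 Heta2] : exists2 eta2, 0 < eta2 &
    forall s, 0 <= s <= t -> if up then alpha + eta2 <= f s else f s <= beta - eta2.
  case: up ft => ft.
    have [c] := EVT_min t0 cft; rewrite in_itv/= => /andP[c0 ct] cmin.
    exists (f c - alpha) => [|s st]; last by rewrite subrKC; apply: cmin; rewrite in_itv.
    rewrite subr_gt0; move: ct; rewrite le_eqVlt => /predU1P[->|ct]; first by rewrite ft.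
    by have := fs c; rewrite c0 => /(_ ct)/andP[].
  have [c] := EVT_max t0 cft; rewrite in_itv/= => /andP[c0 ct] cmax.
  exists (beta - f c) => [|s st]; last first.
    by have := cmax s; rewrite in_itv/= => /(_ st); lra.
  rewrite subr_gt0; move: ct; rewrite le_eqVlt => /predU1P[->|ct]; first by rewrite ft.
  by have := fs c; rewrite c0 => /(_ ct)/andP[].
pose eta1 := Num.min eta2 (Num.min (f 0 - alpha) (beta - f 0)).
exists eta1 => [|eta eta0 eta_le]; first by rewrite !lt_min eta20 !subr_gt0 fa fb.
have : eta <= eta1 by [].
rewrite !le_min => /andP[eta_2 /andP[eta_a eta_b]].
have t0l : 0 <= t <= l by rewrite t0 ltW.
have [del del0 Hdel] := within_continuous_eps cf t0l eta0.
have t0l' : 0 <= t < l by rewrite t0.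
have [N0 HN0] := bridge_grid_approx t0l' del0.
exists N0 => N N0N N_gt0.
have [|] := pselect (forall j, (j <= N)%N -> alpha + eta <= f (bridge_grid N j) <= beta - eta).
  by left.
move=> /existsNP[j /not_implyP[jN nj]]; right.
(* [k] is the first grid index outside the shrunk cell *)
pose bad j := ~~ (alpha + eta <= f (bridge_grid N j) <= beta - eta).
have exb : exists j, bad j by exists j; exact/negP.
case: (ex_minnP exb) => k badk kmin.
have kN : (k <= N)%N by apply: leq_trans jN; apply: kmin; exact/negP.
have good i : (i < k)%N -> alpha + eta <= f (bridge_grid N i) <= beta - eta.
  by move=> ik; apply/negPn/negP => /kmin; rewrite leqNgt ik.
case: k badk kmin kN good => [|k] badk kmin kN good.
  move: badk; rewrite /bad /bridge_grid mul0r mulr0 => /negP[].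
  by apply/andP; split; lra.
exists k => //; split; first by move=> i ik; exact: good.
(* otherwise a grid point just before [t] would already be outside *)
have tk : bridge_grid N k.+1 <= t.
  rewrite leNgt; apply/negP => tk.
  have [i it ti] := HN0 N N0N N_gt0.
  have ik : (i < k.+1)%N.
    by rewrite ltnNge; apply/negP => /(bridge_grid_mono N_gt0)/(lt_le_trans tk); rewrite ltNge it.
  have := good i ik; have near_t : `|t - bridge_grid N i| < del.
    by rewrite ger0_norm ?subr_ge0//; lra.
  have := Hdel _ (bridge_grid_itv i N_gt0) near_t.
  rewrite ltr_norml ft; case: up {ft Heta2} => /andP[h1 h2] /andP[h3 h4]; lra.
have /andP[k0 _] := bridge_grid_itv k.+1 N_gt0.
have := Heta2 (bridge_grid N k.+1); rewrite k0 tk => /(_ isT).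
move: badk; rewrite /bad negb_and -!ltNge.
by case: up {ft Heta2} => /orP[] h1 h2; lra.
Qed.

End grid.

Section bridge_exit.
Context d (T : measurableType d) (R : realType) (P : probability T R).
Variables (l y : R) (B : R -> {RV P >-> R}).
Hypotheses (l0 : 0 < l) (bB : brownian_bridge P y l 0 B).

(** The variance vanishes at the two ends of the bridge. *)
Lemma bridge_endpoint (t : R) : 0 <= t <= l -> t * (1 - t / l) = 0 ->
  {ae P, forall w, B t w = y + t / l * (0 - y)}.
Proof.
move=> tl var0; have /andP[t0 tl'] := tl.
have [iB iB2] := gaussian_rv_sqr_integrable (measurable_funP (B t)) (bridge_gaussian1 bB tl).
rewrite (bridge_mean bB tl) in iB2.
have := bridge_cov bB t0 (lexx t) tl'; rewrite var0 (bridge_mean bB tl).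
set m := y + t / l * (0 - y) in iB2 *.
have mZ : measurable_fun setT (fun w => B t w - m) by exact: measurable_funB.
move=> int0.
have : (\int[P]_w `|((B t w - m) ^+ 2)%:E| = 0)%E.
  rewrite -[RHS]/(0%:E) -int0 /Rintegral fineK.
    by apply: eq_integral => w _; rewrite /= ger0_norm ?sqr_ge0// expr2.
  have := integrable_fin_num measurableT iB2.
  by rewrite /comp; congr (_ \is a fin_num); apply: eq_integral => w _; rewrite /= expr2.
have mZ2 : measurable_fun setT (EFin \o (fun w => (B t w - m) ^+ 2)).
  by apply/measurable_EFinP; exact: measurable_funX.
move=> /(ae_eq_integral_abs P measurableT mZ2).
by apply: filterS => w /(_ Logic.I)[] /eqP; rewrite sqrf_eq0 subr_eq0 => /eqP.
Qed.

Let X N i w : R := B (bridge_grid l N i) w * (1 + i%:R * N%:R^-1).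

Let gridE N i : (0 < N)%N ->
  (1 + i%:R * N%:R^-1) * (1 - bridge_grid l N i / l) = 1 :> R.
Proof.
move=> N0; have Nn0 : N%:R != 0 :> R by rewrite pnatr_eq0 -lt0n.
have iN : i%:R + N%:R != 0 :> R by rewrite gt_eqF// ltr_wpDl// ltr0n.
by rewrite /bridge_grid; field; rewrite Nn0 iN gt_eqF.
Qed.

Let gridlE N i : (0 < N)%N ->
  (1 + i%:R * N%:R^-1) * bridge_grid l N i = l / N%:R * i%:R :> R.
Proof.
move=> N0; have Nn0 : N%:R != 0 :> R by rewrite pnatr_eq0 -lt0n.
have iN : i%:R + N%:R != 0 :> R by rewrite gt_eqF// ltr_wpDl// ltr0n.
by rewrite /bridge_grid; field; rewrite Nn0 iN.
Qed.

Let X_mean N i : (0 < N)%N -> \int[P]_w X N i w = y.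
Proof.
move=> N0; have tl := bridge_grid_itv l0 i N0.
rewrite /X RintegralZr//; last exact: (bridge_integrable bB tl).
rewrite (bridge_mean bB tl) sub0r mulrN mulrC.
have -> : y - bridge_grid l N i / l * y = (1 - bridge_grid l N i / l) * y by ring.
by rewrite mulrA gridE// mul1r.
Qed.

Let X_cov N i j : (0 < N)%N -> (i <= j)%N ->
  \int[P]_w ((X N i w - y) * (X N j w - y)) = l / N%:R * i%:R.
Proof.
move=> N0 ij; have tl k := bridge_grid_itv l0 k N0.
have /andP[ti0 _] := tl i; have /andP[_ tjl] := tl j.
have tij := bridge_grid_mono l0 N0 ij.
set ci : R := 1 + i%:R * N%:R^-1; set cj : R := 1 + j%:R * N%:R^-1.
have E w : (X N i w - y) * (X N j w - y) = (ci * cj) *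
    ((B (bridge_grid l N i) w - \int[P]_w B (bridge_grid l N i) w) *
     (B (bridge_grid l N j) w - \int[P]_w B (bridge_grid l N j) w)).
  rewrite !(bridge_mean bB (tl _)).
  have yE k : y = (1 + k%:R * N%:R^-1) * (y + bridge_grid l N k / l * (0 - y)).
    transitivity ((1 + k%:R * N%:R^-1) * (1 - bridge_grid l N k / l) * y); last by ring.
    by rewrite gridE ?mul1r.
  transitivity ((X N i w - ci * (y + bridge_grid l N i / l * (0 - y))) *
    (X N j w - cj * (y + bridge_grid l N j / l * (0 - y)))).
    by rewrite -(yE i) -(yE j).
  by rewrite /X -/ci -/cj; ring.
under eq_Rintegral do rewrite E.
rewrite RintegralZl//; last first.
  by apply: integrable_mul_sqr; [exact: measurable_funB|exact: measurable_funB
    |have [] := gaussian_rv_sqr_integrable (measurable_funP _) (bridge_gaussian1 bB (tl i))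
    |have [] := gaussian_rv_sqr_integrable (measurable_funP _) (bridge_gaussian1 bB (tl j))].
rewrite (bridge_cov bB)// mulrA -(mulrA ci) (mulrC cj) mulrA -mulrA.
by rewrite gridlE// gridE// mulr1.
Qed.

Let X_gauss N n (a : nat -> R) : (0 < N)%N ->
  gaussian_rv P (fun w => \sum_(j < n) a j * X N j w).
Proof.
move=> N0.
have := @bridge_gaussian _ _ _ _ _ _ _ _ bB n (bridge_grid l N)
  (fun j => a j * (1 + j%:R * N%:R^-1)) (fun j _ => bridge_grid_itv l0 j N0).
congr gaussian_rv; apply/funext => w; apply: eq_bigr => j _; rewrite /X; ring.
Qed.

Let X_start N : {ae P, forall w, X N 0%N w = y}.
Proof.
have t0 : 0 <= (0 : R) <= l by rewrite lexx ltW.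
have := bridge_endpoint t0 (mul0r _); apply: filterS => w.
by rewrite mul0r mul0r addr0 /X /bridge_grid !mul0r mulr0 addr0 mulr1.
Qed.

Variables (alpha beta K : R) (up : bool).
Hypotheses (alpha0 : 0 < alpha) (ya : alpha < y < beta) (K0 : 0 <= K).
Hypothesis K_drift :
  (beta + (beta - alpha)) / (beta - alpha) <= K * (l - 2 * beta * (beta - alpha)).

Let gridF eta N := exit_event alpha beta eta up N (X N).

Let grid_exitP eta N w : (0 < N)%N ->
  grid_exit l alpha beta eta up N (B^~ w) -> gridF eta N w.
Proof.
move=> N0; have c0 i : 0 < 1 + i%:R * N%:R^-1 :> R by rewrite ltr_pwDl// mulr_ge0// invr_ge0.
have keepE j : alpha + eta <= B (bridge_grid l N j) w <= beta - eta ->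
    keep alpha beta eta (1 + j%:R * N%:R^-1) (X N j w).
  by rewrite /keep/= in_itv/= /X !ler_pM2r.
case=> [H|[i iN [H ti]]]; [left|right].
  by move=> j jN; apply/keepE/H.
exists i => //; split; first by move=> j ji; apply/keepE/H.
by rewrite /target /X; case: up ti => ti; rewrite /= in_itv/= ?andbT ltr_pM2r.
Qed.

(** A path that leaves through the chosen wall belongs to the discrete exit events
    of all sufficiently fine grids, for every sufficiently small [eta]; so the
    lemma of Fatou applies, first along the grids and then along [eta]. *)
Lemma first_exit_prob_le (S : set T) : measurable S ->
  (forall w, B 0 w = y -> B l w = 0 -> S w -> first_exit l alpha beta up (B^~ w)) ->
  fine (P S) <= exit_lin alpha beta up y 1 / (beta - alpha) + K * ((y - alpha) * (beta - y)).
Proof.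
move=> mS Sexit; have /andP[ya1 ya2] := ya.
have ab : alpha < beta := lt_trans ya1 ya2.
have r0 : 0 < beta - alpha by rewrite subr_gt0.
have b0 : 0 < beta := lt_trans alpha0 ab.
pose eta m : R := m.+1%:R^-1.
have eta0 m : 0 < eta m by rewrite invr_gt0.
have cinv : n.+1%:R^-1 @[n --> \oo] --> (0 : R) by exact: cvg_harmonic.
have eta_near e : 0 < e -> \forall m \near \oo, eta m < e.
  by move=> e0; exact: (cvgr_lt 0).
set v := _ + _.
have vE : v = exit_value alpha beta K up y 1.
  by rewrite /exit_value /exit_gap subrr addr0 !mulr1.
have mF m N : measurable (gridF (eta m) N.+1).
  apply: measurable_exit_event => i; apply: measurable_funM => //; exact: measurable_funP.
pose G m := \bigcup_n \bigcap_(N in [set N | (n <= N)%N]) gridF (eta m) N.+1.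
have mG m : measurable (G m).
  by apply: bigcupT_measurable => n; apply: bigcap_measurableType => k _; exact: mF.
have GP : \forall m \near \oo, fine (P (G m)) <= v / (1 - eta m / (beta - alpha)).
  near=> m.
  have er : eta m < beta - alpha by near: m; exact: eta_near.
  have er0 : 0 < 1 - eta m / (beta - alpha) by rewrite subr_gt0 ltr_pdivrMr// mul1r.
  pose u N := (v + 3 * jump_cst alpha beta (eta m) K * l ^+ 2 * N.+1%:R^-1) / (1 - eta m / (beta - alpha)).
  apply: (@liminf_prob_le _ _ _ P _ u) => //.
    near=> N; rewrite ler_pdivlMr// mulrC vE; apply: discrete_exit_bound => //.
    - by move=> i; apply: measurable_funM => //; exact: measurable_funP.
    - by move=> n a _; exact: X_gauss.
    - by move=> i _; exact: X_mean.
    - by move=> i j ij _; exact: X_cov.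
    - by rewrite !ltW.
    - have -> : eta m = 2 * beta * (eta m / (2 * beta)) by field; rewrite gt_eqF.
      rewrite ler_pM2l ?mulr_gt0//; apply/ltW; near: N.
      by apply: (cvgr_lt 0) => //; rewrite divr_gt0 ?mulr_gt0.
    - exact: ltW.
  apply: cvgMl; rewrite -[X in _ --> X]addr0; apply: cvgD; first exact: cvg_cst.
  by rewrite -(mulr0 (3 * jump_cst alpha beta (eta m) K * l ^+ 2)); apply: cvgMr.
have HP : fine (P (\bigcup_n \bigcap_(m in [set m | (n <= m)%N]) G m)) <= v.
  apply: (liminf_prob_le mG GP).
  rewrite [X in _ --> X](_ : v = v / (1 - 0 / (beta - alpha))); last first.
    by rewrite mul0r subr0 divr1.
  apply: cvgMr; apply: cvgV; first by rewrite mul0r subr0.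
  by apply: cvgB; [exact: cvg_cst|exact: cvgMl].
set H := \bigcup_n _ in HP.
have mH : measurable H.
  by apply: bigcupT_measurable => n; apply: bigcap_measurableType => k _; exact: mG.
apply: le_trans HP.
rewrite fine_le ?fin_num_measure//.
have t0 : 0 <= (0 : R) <= l by rewrite lexx ltW.
have tl : 0 <= l <= l by rewrite lexx ltW.
have z0 := bridge_endpoint t0 (mul0r _).
have zl : {ae P, forall w, B l w = y + l / l * (0 - y)}.
  by apply: bridge_endpoint => //; rewrite divff ?gt_eqF// subrr mulr0.
apply: prob_ae_le => //.
apply: filterS2 z0 zl => w; rewrite mul0r mul0r addr0 divff ?gt_eqF// mul1r sub0r subrr.
move=> B0 Bl Sw; have [cB _ _ _] := bB.
have B0w : alpha < B 0 w < beta by rewrite B0.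
have Blw : B l w < alpha by rewrite Bl.
have [eta1 eta10 Heta] := first_exit_grid l0 (cB w) B0w Blw (Sexit w B0 Bl Sw).
have [M _ HM] := eta_near _ eta10.
exists M => // m /= Mm.
have [N0 HN0] := Heta _ (eta0 m) (ltW (HM _ Mm)).
exists N0 => // N /= N0N; apply: grid_exitP => //; apply: HN0 => //.
exact: leq_trans N0N _.
Unshelve. all: by end_near. Qed.

End bridge_exit.

(** * The hitting probability on a cell of the lattice *)

Section lattice_parity.
Context {R : realType}.
Implicit Types (r x z : R) (k : nat).

Lemma odd_lattice_nat r k : odd k -> odd_lattice r (k%:R * r).
Proof.
move=> ok; exists (k./2%:Z); congr (_ * r).
by rewrite -[in LHS](odd_double_half k) ok -muln2 mulnC addnC !pmulrn; congr (_%:~R); lia.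
Qed.

Lemma even_lattice_nat r k : ~~ odd k -> even_lattice r (k%:R * r).
Proof.
move=> ok; exists (k./2%:Z); congr (_ * r).
by rewrite -[in LHS](odd_double_half k) (negbTE ok) -muln2 mulnC !pmulrn; congr (_%:~R); lia.
Qed.

Lemma even_odd_disjoint r z : 0 < r -> even_lattice r z -> odd_lattice r z -> False.
Proof.
move=> r0 [i ->] [j] /mulIf => /(_ (lt0r_neq0 r0)) /eqP; rewrite eqr_int => /eqP; lia.
Qed.

Lemma lattice_gap r k z : 0 < r -> k%:R * r < z < k.+1%:R * r ->
  ~ (even_lattice r z \/ odd_lattice r z).
Proof.
move=> r0 /andP[kz zk].
have gap (j : int) : z = j%:~R * r -> False.
  move=> zE; move: kz zk; rewrite zE !ltr_pM2r// !pmulrn !ltr_int; lia.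
by case=> -[j /gap].
Qed.

Lemma dist_attained x (A : set R) (a : R) : A a ->
  (forall b, A b -> `|x - a| <= `|x - b|) -> dist x A = `|x - a|.
Proof.
move=> Aa amin; apply/eqP; rewrite eq_le; apply/andP; split.
  by apply: ge_inf; [exists 0 => _ [b _ <-]|exists a].
by apply: lb_le_inf; [exists `|x - a|, a|move=> _ [b Ab <-]; exact: amin].
Qed.

Lemma dist_odd_lattice r k x : 0 < r -> k%:R * r <= x <= k.+1%:R * r ->
  d_o r x = if odd k then x - k%:R * r else k.+1%:R * r - x.
Proof.
move=> r0 /andP[kx xk].
have Sk : k.+1%:R * r = k%:R * r + r by rewrite -natr1 mulrDl mul1r.
have int_le (i j : int) : i <= j -> i%:~R * r <= j%:~R * r.
  by move=> ij; rewrite ler_pM2r// ler_int.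
case: ifPn => ok.
  rewrite /d_o (@dist_attained _ _ (k%:R * r)).
  - by rewrite ger0_norm ?subr_ge0.
  - exact: odd_lattice_nat.
  move=> _ [j ->]; rewrite ger0_norm ?subr_ge0//.
  have [jk|kj] := leP (2 * j + 1) k%:Z.
    have := int_le _ _ jk; rewrite -pmulrn => h.
    by apply: le_trans (ler_norm _); lra.
  have kj2 : k.+2%:Z <= 2 * j + 1 by lia.
  have := int_le _ _ kj2; rewrite -pmulrn -(natr1 k.+1) mulrDl mul1r => h.
  by rewrite -normrN; apply: le_trans (ler_norm _); lra.
rewrite /d_o (@dist_attained _ _ (k.+1%:R * r)).
- by rewrite -normrN opprB ger0_norm ?subr_ge0.
- exact: odd_lattice_nat.
move=> _ [j ->]; rewrite -normrN opprB ger0_norm ?subr_ge0//.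
have [kj|jk] := leP k.+1%:Z (2 * j + 1).
  have := int_le _ _ kj; rewrite -pmulrn => h.
  by rewrite -normrN; apply: le_trans (ler_norm _); lra.
have kj2 : 2 * j + 2 <= k%:Z by lia.
have := int_le _ _ kj2; rewrite -pmulrn => h.
have jE : (2 * j + 2)%:~R * r = (2 * j + 1)%:~R * r + r :> R.
  by rewrite -[X in _ = _ + X]mul1r -mulrDl -intrD1 -addrA.
by apply: le_trans (ler_norm _); lra.
Qed.

Lemma dist_odd_latticeN r x : d_o r (- x) = d_o r x.
Proof.
rewrite /d_o /dist; congr inf; apply/seteqP; split => _ [a Aa <-]; exists (- a).
- exact/odd_latticeN.
- by rewrite -normrN; congr (`|_|); ring.
- exact/odd_latticeN.
- by rewrite -normrN; congr (`|_|); ring.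
Qed.

Lemma dist_odd_lattice_itv r x : 0 < r -> 0 <= d_o r x <= r.
Proof.
move=> r0; wlog x0 : x / 0 <= x => [H|].
  have [/H//|/ltW x0] := leP 0 x.
  by rewrite -dist_odd_latticeN; apply: H; rewrite oppr_ge0.
have xr : 0 <= x / r by rewrite divr_ge0// ltW.
have /andP[kl kr] := truncn_itv xr; set k := Num.truncn _ in kl kr.
have kx : k%:R * r <= x by rewrite -ler_pdivlMr.
have xk : x <= k.+1%:R * r by rewrite -ler_pdivrMr// ltW.
have Sk : k.+1%:R * r = k%:R * r + r by rewrite -natr1 mulrDl mul1r.
rewrite (@dist_odd_lattice _ k)// ?kx//.
by case: ifP => _; apply/andP; split; lra.
Qed.

End lattice_parity.

Section first_exit_exists.
Context {R : realType}.

Lemma first_exit_exists (l alpha beta : R) f : 0 < l -> {within `[0, l], continuous f} ->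
  alpha < f 0 < beta -> f l < alpha -> exists up, first_exit l alpha beta up f.
Proof.
move=> l0 cf f0 fl.
pose K := [set t | 0 <= t <= l /\ ~~ (alpha < f t < beta)].
have Kl : K l by split; [rewrite lexx ltW|rewrite negb_and -!leNgt (ltW fl)].
have infK : has_inf K by split; [exists l|exists 0 => t [/andP[]]].
pose t := inf K.
have t0 : 0 <= t by apply: lb_le_inf; [exists l|move=> s [/andP[]]].
have tl : t <= l by apply: ge_inf => //; case: infK.
have inside s : 0 <= s < t -> alpha < f s < beta.
  move=> /andP[s0 st]; apply/negPn/negP => fs.
  have Ks : K s by split; rewrite // s0 (le_trans (ltW st) tl).
  by have := ge_inf (proj2 infK) Ks; rewrite leNgt st.
have tl0 : 0 <= t <= l by rewrite t0.
have leave : ~~ (alpha < f t < beta).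
  apply/negP => /andP[a_ft ft_b].
  have e0 : 0 < Num.min (f t - alpha) (beta - f t) by rewrite lt_min !subr_gt0 a_ft.
  have [del del0 Hdel] := within_continuous_eps cf tl0 e0.
  have [s Ks st] := inf_adherent del0 infK; rewrite -/t in st.
  have ts : t <= s by apply: ge_inf => //; case: infK.
  case: Ks => sl /negP; apply.
  have near_s : `|t - s| < del by rewrite -normrN ger0_norm; lra.
  have := Hdel s sl near_s; rewrite lt_min !ltr_norml => /andP[/andP[h1 h2] /andP[h3 h4]].
  by apply/andP; split; lra.
have t_gt0 : 0 < t.
  by rewrite lt_neqAle t0 andbT; apply/eqP => tE; move: leave; rewrite -tE f0.
(* just before [t] the path is inside, so that it cannot jump across a wall *)
have close e : 0 < e -> exists s, [/\ alpha < f s, f s < beta & `|f t - f s| < e].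
  move=> e0; have [del del0 Hdel] := within_continuous_eps cf tl0 e0.
  pose s := Num.max 0 (t - del / 2).
  have s0 : 0 <= s by rewrite le_max lexx.
  have st : s < t by rewrite gt_max t_gt0/= ltrBlDl ltrDr divr_gt0.
  have sdel : t - s < del.
    have : t - del / 2 <= s by rewrite le_max lexx orbT.
    by lra.
  have /andP[h1 h2] := inside s (introT andP (conj s0 st)).
  exists s; split => //; apply: Hdel; first by rewrite s0 (le_trans (ltW st)).
  by rewrite ger0_norm ?subr_ge0// ltW.
have fa : alpha <= f t.
  rewrite leNgt; apply/negP => fta.
  have e0 : 0 < alpha - f t by rewrite subr_gt0.
  by have [s [h1 h2]] := close _ e0; rewrite ltr_norml => /andP[h3 h4]; lra.
have fb : f t <= beta.
  rewrite leNgt; apply/negP => fta.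
  have e0 : 0 < f t - beta by rewrite subr_gt0.
  by have [s [h1 h2]] := close _ e0; rewrite ltr_norml => /andP[h3 h4]; lra.
move: leave; rewrite negb_and -!leNgt => /orP[fta|ftb].
  by exists false, t; split => //; apply/eqP; rewrite eq_le fta.
by exists true, t; split => //; apply/eqP; rewrite eq_le fb.
Qed.

End first_exit_exists.

Section pointwise.
Context d (T : measurableType d) (R : realType) (P : probability T R).
Variables (l r x : R) (B : R -> {RV P >-> R}) (k : nat).
Hypotheses (l0 : 0 < l) (r0 : 0 < r) (bB : brownian_bridge P x l 0 B) (k0 : (0 < k)%N).

Let alpha := k%:R * r.
Let beta := k.+1%:R * r.
Let E := [set w | hits_before l (fun t => B t w) (even_lattice r) (odd_lattice r)].

Let Sk : beta = alpha + r. Proof. by rewrite /beta -natr1 mulrDl mul1r. Qed.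

Let wall_parity up : if up == odd k then even_lattice r (if up then beta else alpha)
  else odd_lattice r (if up then beta else alpha).
Proof.
rewrite /beta /alpha; case: up; case: (boolP (odd k)) => ok /=.
- by apply: even_lattice_nat; rewrite /= ok.
- by apply: odd_lattice_nat; rewrite /= ok.
- exact: odd_lattice_nat.
- exact: even_lattice_nat.
Qed.

(** Inside a cell there is no lattice point, so the first lattice point that is met
    is the wall through which the path leaves, and [odd k] tells which wall is
    even. *)
Lemma hit_first_exit f : {within `[0, l], continuous f} ->
  alpha < f 0 < beta -> f l < alpha ->
  (hits_before l f (even_lattice r) (odd_lattice r) -> first_exit l alpha beta (odd k) f) /\
  (~ hits_before l f (even_lattice r) (odd_lattice r) -> first_exit l alpha beta (~~ odd k) f).
Proof.
move=> cf f0 fl; have [up ex] := first_exit_exists l0 cf f0 fl.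
have := wall_parity up; have [t [tl ft fs]] := ex; rewrite -ft.
have gap s : 0 <= s < t -> ~ (even_lattice r (f s) \/ odd_lattice r (f s)).
  by move=> /fs; exact: lattice_gap.
case: eqP => [upE ev|/eqP upE od]; split => hit.
- by rewrite -upE.
- case: hit; exists t; split => // s /andP[s0]; rewrite le_eqVlt => /predU1P[->|st].
    exact: even_odd_disjoint ev.
  by move=> o; apply: (gap s); [rewrite s0|right].
- case: hit => s [/andP[s0 sl] es no]; have [ts|st] := leP t s.
    by case: (no t) => //; case/andP : tl => ->.
  by case: (gap s); [rewrite s0|left].
- by move: ex upE; case: up {ft}; case: (odd k).
Qed.

(** The exit bounds for the two walls have harmonic parts that add up to 1, so
    together they enclose the hitting probability. *)
Lemma hit_prob_interior : alpha < x < beta ->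
  `|hit_even_before_odd_prob P l r B - (if odd k then x - alpha else beta - x) / r| <=
  19 / 8 * (beta * r / l).
Proof.
move=> /andP[ax xb].
have mE : measurable E := measurable_hit l0 r0 bB.
set q := hit_even_before_odd_prob P l r B.
have /andP[q0 q1] : 0 <= q <= 1 := hit_prob_itv l0 r0 bB.
have alpha_r : r <= alpha by rewrite /alpha ler_peMl// ?(ltW r0)// ler1n.
set b := beta * r / l.
have beta0 : 0 < beta by rewrite mulr_gt0.
have b0 : 0 < b by rewrite divr_gt0// mulr_gt0.
set phi := _ / r.
have /andP[phi0 phi1] : 0 <= phi <= 1.
  rewrite /phi; case: ifP => _; rewrite divr_ge0 ?(ltW r0)//= ?subr_ge0 ?(ltW ax) ?(ltW xb)//.
    by rewrite ler_pdivrMr// mul1r; move: xb ax; rewrite Sk; lra.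
  by rewrite ler_pdivrMr// mul1r; move: xb ax; rewrite Sk; lra.
(* beyond [b = 8 / 19] the claimed bound exceeds 1 *)
have [bl|bg] := leP b (8 / 19); last by rewrite ler_norml; apply/andP; split; lra.
have bE : beta * r = b * l by rewrite /b mulfVK// gt_eqF.
(* the smallest constant that the drift condition allows *)
pose K := (beta + r) / (r * (l * (1 - 2 * b))).
have den0 : 0 < 1 - 2 * b by lra.
have K0 : 0 <= K.
  by rewrite divr_ge0 ?addr_ge0 ?mulr_ge0// ?(ltW beta0) ?(ltW r0) ?(ltW l0) ?(ltW den0).
have rE : beta - alpha = r by rewrite Sk; ring.
have K_drift : (beta + (beta - alpha)) / (beta - alpha) <= K * (l - 2 * beta * (beta - alpha)).
  have -> : l - 2 * beta * (beta - alpha) = l * (1 - 2 * b).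
    by rewrite rE -mulrA bE; ring.
  have -> : K * (l * (1 - 2 * b)) = (beta + r) / r.
    by rewrite /K; field; rewrite ?(gt_eqF r0) ?(gt_eqF l0) ?(gt_eqF den0).
  by rewrite rE.
have alpha0 : 0 < alpha by apply: lt_le_trans alpha_r.
have xab : alpha < x < beta by rewrite ax.
have fe w : B 0 w = x -> B l w = 0 ->
  (E w -> first_exit l alpha beta (odd k) (B^~ w)) /\
  (~ E w -> first_exit l alpha beta (~~ odd k) (B^~ w)).
  move=> B0 Bl; have [cB _ _ _] := bB.
  by apply: hit_first_exit; rewrite ?B0 ?Bl//; exact: cB.
have gapK : K * ((x - alpha) * (beta - x)) <= 19 / 8 * b.
  apply: (@le_trans _ _ (K * (r ^+ 2 / 4))).
    apply: ler_wpM2l => //; have := sqr_ge0 (x - alpha - (beta - x)).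
    by rewrite Sk; nra.
  have -> : K * (r ^+ 2 / 4) = (beta + r) * r / l / (4 * (1 - 2 * b)).
    by rewrite /K; field; rewrite ?(gt_eqF r0) ?(gt_eqF l0) ?(gt_eqF den0).
  rewrite ler_pdivrMr ?mulr_gt0//.
  have : (beta + r) * r / l <= 3 / 2 * b.
    rewrite /b (mulrA (3 / 2)) ler_pM2r ?invr_gt0// mulrA ler_pM2r// Sk; lra.
  by move: (b) b0 bl => z z0 zl uz; apply: le_trans uz _; nra.
have up_bound := first_exit_prob_le l0 bB alpha0 xab K0 K_drift mE
  (fun w h1 h2 => (fe w h1 h2).1).
have down_bound := first_exit_prob_le l0 bB alpha0 xab K0 K_drift (measurableC mE)
  (fun w h1 h2 => (fe w h1 h2).2).
have PC : fine (P (~` E)) = 1 - q.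
  by rewrite probability_setC// fineB ?fin_num_measure.
rewrite PC rE in down_bound; rewrite -/(hit_even_before_odd_prob P l r B) -/q rE in up_bound.
have linE : exit_lin alpha beta (odd k) x 1 / r = phi.
  by rewrite /exit_lin /phi !mulr1; case: odd.
have linC : exit_lin alpha beta (~~ odd k) x 1 / r = 1 - phi.
  by rewrite /exit_lin /phi !mulr1; case: odd => /=; rewrite Sk; field; rewrite gt_eqF.
rewrite linE in up_bound; rewrite linC in down_bound.
by rewrite ler_norml; apply/andP; split; lra.
Qed.

Lemma hit_prob_lattice : x = alpha ->
  hit_even_before_odd_prob P l r B = (~~ odd k)%:R.
Proof.
move=> xE; rewrite /hit_even_before_odd_prob -/E.
have t0 : 0 <= (0 : R) <= l by rewrite lexx ltW.
have z0 := bridge_endpoint bB t0 (mul0r _).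
have mE : measurable E := measurable_hit l0 r0 bB.
have EP : {ae P, forall w, E w <-> ~~ odd k}.
  apply: filterS z0 => w; rewrite !mul0r addr0 xE => B0; split.
    move=> [t [/andP[t0' _] _ /(_ 0)]]; rewrite lexx t0' B0 => /(_ isT) no.
    by apply/negP => /(odd_lattice_nat r).
  move=> ev; have ev' := even_lattice_nat r ev; exists 0; split => //; first by rewrite B0.
  move=> s; rewrite -eq_le => /eqP <-; rewrite B0.
  exact: even_odd_disjoint ev'.
have [ok|ok] := boolP (odd k).
  rewrite (@prob_ae_eq _ _ _ P E set0) ?measure0//.
  by apply: filterS EP => w; rewrite ok => -[h1 _]; split => // /h1.
rewrite (@prob_ae_eq _ _ _ P E setT) ?probability_setT//.
by apply: filterS EP => w; rewrite ok => -[_ h2]; split => // _; exact: h2.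
Qed.

End pointwise.

(** * Integration against the Gaussian density *)

Section integral_monotone.
Context d (T : measurableType d) (R : realType) (mu : {measure set T -> \bar R}).
Local Open Scope ereal_scope.

(** The integral of a nonnegative function is a supremum over the simple functions
    below it.  The lemma is applied to [varrho], which is a family of probabilities
    on unrelated spaces and comes with no regularity in [y]. *)
Lemma ge0_le_integral_nonmeasurable (D : set T) (f g : T -> \bar R) :
  (forall x, D x -> 0 <= f x) -> (forall x, D x -> f x <= g x) ->
  \int[mu]_(x in D) f x <= \int[mu]_(x in D) g x.
Proof.
move=> f0 fg; have g0 x : D x -> 0 <= g x by move=> Dx; apply: le_trans (f0 x Dx) (fg x Dx).
rewrite ge0_integralE// ge0_integralE//; apply: le_ereal_sup => _ [h /= hf <-].
exists h => //= x; apply: le_trans (hf x) _; rewrite /patch.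
by case: ifPn => // /set_mem; exact: fg.
Qed.

End integral_monotone.

Section brownian_marginal.
Context d (T : measurableType d) (R : realType) (P : probability T R).
Variables (W : R -> {RV P >-> R}) (t : R).
Hypotheses (BM : standard_brownian_motion P W) (t0 : 0 < t).

Lemma brownian_law A : measurable A ->
  P (W t @^-1` A) = normal_prob 0 (Num.sqrt t) A.
Proof.
move=> mA; have [_ W0 _ /(_ 0 t (lexx 0) t0 A mA)] := BM; rewrite subr0 => <-.
apply: prob_ae_eq.
- by rewrite -[_ @^-1` _]setTI; exact: measurable_funP.
- rewrite (_ : [set w | _] = (fun w => W t w - W 0 w) @^-1` A)//.
  by rewrite -[_ @^-1` _]setTI; apply: measurable_funB.
- by apply: filterS W0 => w /= ->; rewrite subr0.
Qed.

Lemma brownian_variance : \int[P]_w (W t w ^+ 2) = t /\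
  P.-integrable setT (EFin \o (fun w => W t w ^+ 2)).
Proof.
have s0 : Num.sqrt t != 0 by rewrite gt_eqF// sqrtr_gt0.
have mp : measurable_fun [set: R] (fun x : R => (x - 0) ^+ 2).
  by apply: measurable_funX; exact: measurable_funB.
have [] := @integral_density_law _ _ _ P _ (measurable_funP (W t)) _ mp _
  (measurable_normal_pdf 0 (Num.sqrt t)) (normal_pdf_ge0 0 (Num.sqrt t)) brownian_law
  (integrable_normal_pow 0 s0 (isT : (2 <= 4)%N)).
rewrite normal_variance// sqr_sqrtr ?(ltW t0)// => i1 i2; split.
  by rewrite -[RHS]i2; apply: eq_Rintegral => w _; rewrite subr0.
by apply: eq_integrable i1 => // w _; rewrite /= subr0.
Qed.

Lemma brownian_small_ball b : 0 <= b ->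
  (P (W t @^-1` `[0%R, b]%classic) <= (b / Num.sqrt t)%:E)%E.
Proof.
move=> b0; rewrite brownian_law// /normal_prob.
have s0 : 0 < Num.sqrt t by rewrite sqrtr_gt0.
have peak : normal_peak (Num.sqrt t) <= (Num.sqrt t)^-1.
  rewrite /normal_peak lef_pV2 ?posrE//; last first.
    by rewrite sqrtr_gt0 mulrn_wgt0// mulr_gt0 ?pi_gt0// exprn_gt0.
  rewrite sqr_sqrtr ?(ltW t0)// ler_sqrt; last by rewrite mulrn_wge0// mulr_ge0 ?pi_ge0 ?ltW.
  rewrite -mulrnAr ler_peMr ?(ltW t0)//.
  have := pi_ge2 R; rewrite mulr2n; lra.
apply: (@le_trans _ _ (\int[lebesgue_measure]_(x in `[0%R, b]) (cst (normal_peak (Num.sqrt t))%:E) x)%E).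
  apply: ge0_le_integral_nonmeasurable => x _ /=; rewrite lee_fin.
    exact: normal_pdf_ge0.
  by apply: normal_pdf_ub; rewrite gt_eqF.
rewrite integral_cst//= lebesgue_measure_itv/= lte_fin.
have [bgt|] := ltP 0 b; last first.
  by rewrite mule0 lee_fin divr_ge0// ltW.
by rewrite -EFinB subr0 -EFinM lee_fin mulrC ler_wpM2l.
Qed.

End brownian_marginal.

(** Both sides are integrals against the law of [X]. *)
Lemma ge0_density_integral d (T : measurableType d) (R : realType) (P : probability T R)
    (X : T -> R) (p : R -> R) (g : R -> \bar R) :
  measurable_fun setT X -> is_density P X p ->
  measurable_fun setT g -> (forall x, 0 <= g x)%E ->
  (\int[lebesgue_measure]_y (g y * (p y)%:E) = \int[P]_w g (X w))%E.
Proof.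
move=> mX [mp p0 law] mg g0.
pose X' : T -> measurableTypeR R := X.
have mX' : measurable_fun [set: T] X' by [].
rewrite -(@ge0_integral_density _ _ R lebesgue_measure (pushforward P X') p mp p0 law g mg g0).
exact: (@ge0_integral_pushforward _ _ _ _ _ _ mX' P setT g measurableT mg (fun y _ => g0 y)).
Qed.

Section final.
Context (R : realType).
Variables (sigma h theta : R).
Hypotheses (sigma0 : 0 < sigma) (h0 : 0 < h) (theta0 : 0 < theta).
Context (d' : R -> measure_display) (Omega' : forall y : R, measurableType (d' y)).
Variables (Q : forall y : R, probability (Omega' y) R).
Variables (B : forall y : R, R -> {RV (Q y) >-> R}).
Hypothesis B_bridge : forall y : R, brownian_bridge (Q y) (y / sigma) theta 0 (B y).
Variable q : R -> R.
Hypothesis q_def : forall y : R,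
  q y = hit_even_before_odd_prob (Q y) theta (h / sigma) (B y).

Let r0 : 0 < h / sigma. Proof. by rewrite divr_gt0. Qed.

Lemma varrho_symmetric y : varrho h q (- y) = varrho h q y.
Proof.
rewrite /varrho dist_odd_latticeN !q_def; congr (_ - _).
apply: (hit_prob_reflect theta0 r0 (B_bridge y)).
by have := B_bridge (- y); rewrite mulNr oppr0.
Qed.

Lemma varrho_le1 y : `|varrho h q y| <= 1.
Proof.
rewrite /varrho q_def; have /andP[q0 q1] := hit_prob_itv theta0 r0 (B_bridge y).
have /andP[d0 dh] := dist_odd_lattice_itv y h0.
have e0 : 0 <= d_o h y / h by rewrite divr_ge0// ltW.
have e1 : d_o h y / h <= 1 by rewrite ler_pdivrMr// mul1r.
by rewrite ler_norml; apply/andP; split; lra.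
Qed.

(** Here [k] is the index of the cell of [y], and [k >= 1] because [h <= y]. *)
Lemma varrho_far y : h <= y ->
  `|varrho h q y| <= 19 / 8 * ((y + h) * h / (sigma ^+ 2 * theta)).
Proof.
move=> hy; have yh0 : 0 <= y / h by rewrite divr_ge0 ?ltW// (lt_le_trans h0).
have /andP[kl kr] := truncn_itv yh0; set k := Num.truncn _ in kl kr.
have k0 : (0 < k)%N.
  rewrite lt0n; apply/eqP => k0; move: kr; rewrite k0 ltr_pdivrMr// mul1r.
  by rewrite ltNge hy.
have kx : k%:R * h <= y by rewrite -ler_pdivlMr.
have xk : y < k.+1%:R * h by rewrite -ltr_pdivrMr.
have scale c : c * (h / sigma) = c * h / sigma by rewrite mulrA.
have dE : d_o h y / h =
    (if odd k then y / sigma - k%:R * (h / sigma) else k.+1%:R * (h / sigma) - y / sigma) / (h / sigma).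
  rewrite (@dist_odd_lattice _ _ k)// ?kx ?ltW//.
  by case: ifP => _; field; rewrite !gt_eqF.
have rhs0 : 0 <= 19 / 8 * ((y + h) * h / (sigma ^+ 2 * theta)).
  by rewrite !mulr_ge0 ?invr_ge0 ?addr_ge0 ?mulr_ge0 ?exprn_ge0// ?ltW// (lt_le_trans h0).
rewrite /varrho dE q_def.
(* at a lattice point the bridge starts on the lattice and [varrho] vanishes *)
move: kx; rewrite le_eqVlt => /predU1P[kE|kx].
  have xE : y / sigma = k%:R * (h / sigma) by rewrite scale kE.
  rewrite (hit_prob_lattice theta0 r0 (B_bridge y) xE) xE; case: (odd k) => /=; first by rewrite subrr mul0r subrr normr0.
  have -> : k.+1%:R * (h / sigma) - k%:R * (h / sigma) = h / sigma by rewrite -natr1; ring.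
  by rewrite divff ?gt_eqF// subrr normr0.
have inter : k%:R * (h / sigma) < y / sigma < k.+1%:R * (h / sigma).
  by rewrite !scale !ltr_pM2r ?invr_gt0// kx.
apply: le_trans (hit_prob_interior theta0 r0 (B_bridge y) k0 inter) _.
rewrite ler_pM2l//.
have -> : (y + h) * h / (sigma ^+ 2 * theta) = (y + h) / sigma * (h / sigma) / theta.
  by field; rewrite !gt_eqF.
rewrite ler_pM2r ?invr_gt0// ler_pM2r// scale ler_pM2r ?invr_gt0//.
by rewrite -natr1 mulrDl mul1r lerD2r ltW.
Qed.

Context (d : measure_display) (Omega : measurableType d) (P : probability Omega R).
Variables (W : R -> {RV P >-> R}) (p : R -> R).
Hypothesis BM : standard_brownian_motion P W.
Hypothesis p_density : is_density P (fun w => sigma * W theta w) p.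

Let a := h / (sigma * Num.sqrt theta).

Let s0 : 0 < Num.sqrt theta. Proof. by rewrite sqrtr_gt0. Qed.

Let a0 : 0 < a. Proof. by rewrite divr_gt0// mulr_gt0. Qed.

Let a2E : a ^+ 2 = h ^+ 2 / (sigma ^+ 2 * theta).
Proof. by rewrite /a expr_div_n exprMn sqr_sqrtr// ltW. Qed.

Let mX : measurable_fun setT (fun w => sigma * W theta w).
Proof. by apply: measurable_funM => //; exact: measurable_funP. Qed.

Let p0 y : 0 <= p y. Proof. by have [_] := p_density. Qed.

Let integral_le_density (D : set R) :
  (\int[lebesgue_measure]_(y in D) (`|varrho h q y| * p y)%:E <=
   \int[lebesgue_measure]_(y in D) (p y)%:E)%E.
Proof.
apply: ge0_le_integral_nonmeasurable => y _; rewrite lee_fin ?mulr_ge0//.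
by rewrite ler_piMl// varrho_le1.
Qed.

Lemma varrho_integral_near :
  (\int[lebesgue_measure]_(y in `[0%R, h]) (`|varrho h q y| * p y)%:E <= a%:E)%E.
Proof.
apply: le_trans (integral_le_density _) _.
have [_ _ <-] := p_density; last exact: measurable_itv.
have -> : (fun w => sigma * W theta w) @^-1` `[0, h]%classic =
    W theta @^-1` `[0, h / sigma]%classic.
  apply/seteqP; split => w; rewrite /= !in_itv/= pmulr_rge0// ler_pdivlMr//.
    by rewrite mulrC.
  by rewrite mulrC.
apply: le_trans (brownian_small_ball BM theta0 (ltW r0)) _.
by rewrite lee_fin /a invfM mulrA.
Qed.

(** The bound of [varrho_far] is linear in [y]; dominating it by a quadratic
    function, whose Gaussian integral is explicit, costs nothing in the leading
    constant [19 / 8]. *)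
Lemma varrho_integral_far :
  (\int[lebesgue_measure]_(y in `[h, +oo[) (`|varrho h q y| * p y)%:E <=
   (29 / 10 * a + a ^+ 2)%:E)%E.
Proof.
(* for [a > 1 / 3] the claimed bound exceeds 1, the total mass *)
have [a3|a3] := leP a 3^-1; last first.
  apply: le_trans (integral_le_density _) _.
  have [_ _ <-] := p_density; last exact: measurable_itv.
  by apply: le_trans (probability_le1 _ _) _; rewrite ?lee_fin; [rewrite -[_ @^-1` _]setTI; apply: mX|nra].
(* [a z] is replaced by [a (1 + z ^ 2) / 2], where [z = y / (sigma sqrt theta)] *)
pose g y := 19 / 8 * (a * (1 + y ^+ 2 / (sigma ^+ 2 * theta)) / 2 + a ^+ 2).
have st0 : 0 < sigma ^+ 2 * theta by rewrite mulr_gt0// exprn_gt0.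
have g0 y : 0 <= g y.
  have z0 : 0 <= 1 + y ^+ 2 / (sigma ^+ 2 * theta) by rewrite addr_ge0// divr_ge0 ?sqr_ge0// ltW.
  by rewrite mulr_ge0// addr_ge0 ?sqr_ge0// divr_ge0// mulr_ge0// ltW.
have mg : measurable_fun setT g.
  apply: measurable_funM => //; apply: measurable_funD => //.
  apply: measurable_funM => //; apply: measurable_funM => //.
  by apply: measurable_funD => //; apply: measurable_funM => //; exact: measurable_funX.
have far y : h <= y -> `|varrho h q y| <= g y.
  move=> hy; apply: le_trans (varrho_far hy) _; rewrite /g ler_pM2l//.
  have -> : (y + h) * h / (sigma ^+ 2 * theta) = a * (y / (sigma * Num.sqrt theta)) + a ^+ 2.
    rewrite a2E /a; move: (Num.sqrt theta) s0 (sqr_sqrtr (ltW theta0)) => u u0 <-.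
    by field; rewrite !gt_eqF.
  rewrite lerD2r -mulrA ler_pM2l//.
  have -> : y ^+ 2 / (sigma ^+ 2 * theta) = (y / (sigma * Num.sqrt theta)) ^+ 2.
    by rewrite expr_div_n exprMn sqr_sqrtr// ltW.
  move: (y / _) => z; have := sqr_ge0 (z - 1); nra.
apply: (@le_trans _ _ (\int[lebesgue_measure]_y ((g y)%:E * (p y)%:E))%E).
  rewrite integral_mkcond; apply: ge0_le_integral_nonmeasurable => y _; rewrite /patch.
    by case: ifP => // _; rewrite lee_fin mulr_ge0.
  case: ifPn => [/set_mem/=|_]; last by rewrite -EFinM lee_fin mulr_ge0.
  by rewrite in_itv/= andbT => hy; rewrite -EFinM lee_fin ler_wpM2r// far.
rewrite (@ge0_density_integral _ _ _ _ _ _ (EFin \o g) mX p_density)//; last exact/measurable_EFinP.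
have [EW2 iW2] := brownian_variance BM theta0.
have gE w : g (sigma * W theta w) =
    19 / 8 * (a / 2 + a ^+ 2) + (19 / 8 * a / (2 * theta)) * (W theta w ^+ 2).
  by rewrite /g; field; rewrite !gt_eqF.
have ic := finite_measure_integrable_cst P (19 / 8 * (a / 2 + a ^+ 2)) measurableT.
have iz := integrableRZ (19 / 8 * a / (2 * theta)) iW2.
have ig : P.-integrable setT (EFin \o (fun w => g (sigma * W theta w))).
  by apply: eq_integrable (integrableRD ic iz) => // w _; rewrite /= gE.
rewrite -[leLHS]fineK; last exact: (integrable_fin_num measurableT ig).
rewrite lee_fin.
rewrite -/(Rintegral P setT (fun w => g (sigma * W theta w))).
have -> : \int[P]_w g (sigma * W theta w) = 19 / 8 * (a + a ^+ 2).
  under eq_Rintegral do rewrite gE.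
  rewrite RintegralD// Rintegral_cst_prob RintegralZl// EW2.
  by field; rewrite gt_eqF.
by move: (a) a0 a3 => z z0 z3; nra.
Qed.

End final.

Theorem proposition4p7 (R : realType) (T sigma h theta : R)
  (T_gt0 : 0 < T) (sigma_gt0 : 0 < sigma) (h_gt0 : 0 < h)
  (theta_gt0 : 0 < theta) (theta_leT : theta <= T)
  (* the Brownian motion W and the density p of sigma * W_theta *)
  (d : measure_display) (Omega : measurableType d) (P : probability Omega R)
  (W : R -> {RV P >-> R}) (W_BM : standard_brownian_motion P W)
  (p : R -> R) (p_density : is_density P (fun w => sigma * W theta w) p)
  (* for each y, a Brownian bridge from y / sigma to 0 of length theta *)
  (d' : R -> measure_display) (Omega' : forall y : R, measurableType (d' y))
  (Q : forall y : R, probability (Omega' y) R)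
  (B : forall y : R, R -> {RV (Q y) >-> R})
  (B_bridge : forall y : R, brownian_bridge (Q y) (y / sigma) theta 0 (B y))
  (q : R -> R)
  (q_def : forall y : R,
     q y = hit_even_before_odd_prob (Q y) theta (h / sigma) (B y)) :
  [/\ forall y : R, varrho h q (- y) = varrho h q y,
      (\int[lebesgue_measure]_(y in `[0%R, h]) (`|varrho h q y| * p y)%:E
        <= (26 / 10 * (h / (sigma * Num.sqrt theta))
            + h ^+ 2 / (sigma ^+ 2 * theta))%:E)%E &
      (\int[lebesgue_measure]_(y in `[h, +oo[) (`|varrho h q y| * p y)%:E
        <= (29 / 10 * (h / (sigma * Num.sqrt theta))
            + h ^+ 2 / (sigma ^+ 2 * theta))%:E)%E].
Proof.
have a_ge0 : 0 <= h / (sigma * Num.sqrt theta) by rewrite divr_ge0 ?mulr_ge0// ltW.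
have sqE : h ^+ 2 / (sigma ^+ 2 * theta) = (h / (sigma * Num.sqrt theta)) ^+ 2.
  by rewrite expr_div_n exprMn sqr_sqrtr// ltW.
split.
- exact: (varrho_symmetric sigma_gt0 h_gt0 theta_gt0 B_bridge q_def).
- have near := varrho_integral_near sigma_gt0 h_gt0 theta_gt0 B_bridge q_def W_BM p_density.
  apply: (le_trans near); rewrite lee_fin sqE; nra.
- rewrite sqE.
  exact: (varrho_integral_far sigma_gt0 h_gt0 theta_gt0 B_bridge q_def W_BM p_density).
Qed.
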